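(* Let $f:\Omega\times\mathbb R\to\mathbb R$ satisfy the structural assumption (A) stated in the context, and let $A_F:\mathcal V_0\to(\mathcal V_0)^\star$ be the (surjective, continuous and bounded) operator defined by $$\langle A_F(u),v\rangle_{(\mathcal V_0)^\star,\mathcal V_0}=\int_\Omega(L_D)^{s/2}u\,(L_D)^{s/2}v\,dx+\int_\Omega f(x,u)v\,dx,\qquad u,v\in\mathcal V_0 .$$ Then $A_F$ is also injective, hence invertible, and its inverse $A_F^{-1}$ is bounded from $(\mathcal V_0)^\star$ into $\mathcal V_0$. In addition, if $f$ satisfies the following growth condition: there exists a constant $c\in(0,1]$ such that $$c|f(x,\xi-\eta)|\le|f(x,\xi)-f(x,\eta)|$$ for a.e. $x\in\Omega$ and for all $\xi,\eta\in\mathbb R$, then $A_F^{-1}$ is also continuous from $(\mathcal V_0)^\star$ into $\mathcal V_0$. Furthermore, if $r>(2^\star)'=\frac{2N}{N+2s}$, then $A_F^{-1}:L^r(\Omega)\to\mathcal V_0$ and $A_F^{-1}:L^r(\Omega)\to L^p(\Omega)$ are compact for every $p\in(1,2^\star)$.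
   Context: Setting. $N\ge 1$, $0<s<1$, and $\Omega\subset\mathbb R^N$ is an arbitrary bounded open set. The coefficients $a_{ij}\in L^\infty(\Omega)$ are real, measurable, symmetric ($a_{ij}=a_{ji}$ a.e.) and elliptic: there is $\gamma>0$ with $\sum_{i,j}a_{ij}(x)\xi_i\xi_j\ge\gamma|\xi|^2$ for all $\xi\in\mathbb R^N$ and a.e. $x\in\Omega$. $L_D$ is the positive self-adjoint operator on $L^2(\Omega)$ associated with the closed form $\mathcal E_D(u,v)=\sum_{i,j}\int_\Omega a_{ij}D_iu\,D_jv\,dx$, $u,v\in H^1_0(\Omega)$. It has compact resolvent, eigenvalues $0<\lambda_1\le\lambda_2\le\cdots\to\infty$ and an orthonormal basis of eigenfunctions $(\varphi_n)$ of $L^2(\Omega)$. For $\theta\ge0$, $\mathbb H^\theta(\Omega)=\{u\in L^2(\Omega):\|u\|^2_{\mathbb H^\theta(\Omega)}:=\sum_n\lambda_n^\theta u_n^2<\infty\}$, with $u_n=\int_\Omega u\varphi_n\,dx$. Powers are defined spectrally, $(L_D)^{\alpha}u=\sum_n\lambda_n^{\alpha}u_n\varphi_n$, so $\|u\|_{\mathbb H^s(\Omega)}=\|(L_D)^{s/2}u\|_{L^2(\Omega)}$. Assumption (A) on $f$. For a.e. $x\in\Omega$: $f(x,\cdot)$ is odd, strictly increasing, continuous, $f(x,0)=0$, and $\lim_{t\to\infty}f(x,t)=\infty$; for all $t$, $f(\cdot,t)$ is measurable. Let $\widetilde f(x,\cdot)$ be the inverse of $f(x,\cdot)$, $F(x,t)=\int_0^{|t|}f(x,\tau)\,d\tau$,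 $\widetilde F(x,t)=\int_0^{|t|}\widetilde f(x,\tau)\,d\tau$. There are constants $c_1,c_2\in(0,1]$ independent of $x$ such that for a.e. $x\in\Omega$ and all $t\in\mathbb R$: $c_1tf(x,t)\le F(x,t)\le tf(x,t)$ and $c_2t\widetilde f(x,t)\le\widetilde F(x,t)\le t\widetilde f(x,t)$. Space. $L_F(\Omega)$ is the space of measurable $u$ with $F(\cdot,u(\cdot))\in L^1(\Omega)$, with Luxemburg norm $\|u\|_{F,\Omega}=\inf\{k>0:\int_\Omega F(x,u(x)/k)\,dx\le1\}$. $\mathcal V_0=\mathbb H^s(\Omega)\cap L_F(\Omega)$ with norm $\|u\|_{\mathcal V_0}=\|u\|_{\mathbb H^s(\Omega)}+\|u\|_{F,\Omega}$; it is a reflexive Banach space with dual $(\mathcal V_0)^\star$. It is known that under (A) the operator $A_F$ is well defined, hemicontinuous, strictly monotone, continuous, surjective and bounded. A (nonlinear) operator is called bounded if it maps bounded sets to bounded sets, and compact if it is continuous and maps bounded sets to relatively compact sets. $L^r(\Omega)$ is viewed as a subspace of $(\mathcal V_0)^\star$ via $\langle z,v\rangle=\int_\Omega zv\,dx$. Exponent. $2^\star=\frac{2N}{N-2s}$ if $N\ge2$, or if $N=1$ and $0<s<\frac12$; if $N=1$ and $s=\frac12$, $2^\star$ is any number in $[1,\infty)$. In these cases $\mathcal V_0\hookrightarrow\mathbb H^s(\Omega)\hookrightarrow L^{2^\star}(\Omega)$ continuously. (If $N=1$ and $\frac12<s<1$, one has instead the continuous embedding $\mathcal V_0\hookrightarrow\mathbb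 H^s(\Omega)\hookrightarrow C^{0,s-\frac12}(\overline\Omega)$, and no value of $2^\star$ is specified.) $(2^\star)'$ denotes the conjugate exponent of $2^\star$. *)

(* Defs.v *)
From HB Require Import structures.
From mathcomp Require Import all_boot all_order all_algebra.
From mathcomp Require Import all_classical all_reals all_analysis.
Set Implicit Arguments.
Unset Strict Implicit.
Unset Printing Implicit Defensive.
Import Order.TTheory GRing.Theory Num.Theory.
Import numFieldTopology.Exports numFieldNormedType.Exports.
Local Open Scope classical_set_scope.
Local Open Scope ring_scope.

Section lebesgue_outer.
Context (R : realType) (n : nat).
Local Notation T := 'rV[R]_n.+1.

Definition box (ab : T * T) : set T :=
  [set x | forall i, ab.1 0 i < x 0 i <= ab.2 0 i].

Definition box_volume (ab : T * T) : \bar R :=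
  (\prod_(i < n.+1) Num.max 0 (ab.2 0 i - ab.1 0 i))%:E.

Definition lebesgue_outer (A : set T) : \bar R :=
  ereal_inf [set (\sum_(k <oo) box_volume (B k))%E |
    B in [set B : nat -> T * T | A `<=` \bigcup_k box (B k)]].

Local Open Scope ereal_scope.

Let box_volume_ge0 ab : 0 <= box_volume ab.
Proof. by rewrite lee_fin prodr_ge0// => i _; rewrite le_max lexx. Qed.

Let lebesgue_outer_ge0 A : 0 <= lebesgue_outer A.
Proof.
by apply: le_ereal_inf_tmp => x [B _ <-{x}]; apply: nneseries_ge0.
Qed.

Let lebesgue_outer0 : lebesgue_outer set0 = 0.
Proof.
apply/eqP; rewrite eq_le; apply/andP; split; last exact/lebesgue_outer_ge0.
apply: ereal_inf_lbound; exists (fun=> (0, 0)%R) => //.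
apply: eseries0 => k _ _; rewrite /box_volume big_ord_recl.
by rewrite mxE subr0 maxxx mul0r.
Qed.

Let le_lebesgue_outer : {homo lebesgue_outer : A B / A `<=` B >-> A <= B}.
Proof.
move=> A B AB; apply/ereal_inf_le_tmp => x [C BC <-{x}].
by exists C => //; exact: subset_trans AB BC.
Qed.

Let lebesgue_outer_sigma_subadditive : sigma_subadditive lebesgue_outer.
Proof.
move=> A; have [[i ioo]|] := pselect (exists i, lebesgue_outer (A i) = +oo).
  rewrite (eseries_pinfty _ _ ioo) ?leey// => k _.
  by rewrite -ltNye (lt_le_trans _ (lebesgue_outer_ge0 _)).
rewrite -forallNE => Aoo.
suff add2e (e : {posnum R}) : lebesgue_outer (\bigcup_k A k) <=
    \sum_(i <oo) lebesgue_outer (A i) + e%:num%:E.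
  by apply/lee_addgt0Pr => _/posnumP[].
rewrite (le_trans _ (epsilon_trick _ _ _))//.
pose P k (B : nat -> T * T) := A k `<=` \bigcup_j box (B j) /\
  \sum_(j <oo) box_volume (B j) <=
    lebesgue_outer (A k) + (e%:num / (2 ^ k.+1)%:R)%:E.
have [G PG] : {G : nat -> nat -> T * T & forall k, P k (G k)}.
  apply: (@choice _ _ P) => k; rewrite /P.
  have Afin : lebesgue_outer (A k) \is a fin_num.
    by rewrite ge0_fin_numE// ltey; apply/eqP/Aoo.
  have ek : (0 < e%:num / (2 ^ k.+1)%:R)%R by [].
  have [_ [B AB <-] Bl] := lb_ereal_inf_adherent ek Afin.
  by exists B; split=> //; exact/ltW.
have G_ge0 x : 0 <= (box_volume \o uncurry G) x by exact: box_volume_ge0.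
apply: (@le_trans _ _ (\esum_(i in setT) (box_volume \o uncurry G) i)).
  apply: ereal_inf_lbound => /=.
  have /card_esym/ppcard_eqP[f] := card_nat2.
  exists (uncurry G \o f).
    move=> t [i _ /((PG i).1)[j _ ?]].
    by exists (f^-1%FUN (i, j)) => //=; rewrite invK ?inE.
  rewrite -(esum_pred_image (box_volume \o uncurry G) _ xpredT)
    ?[fun=> _]set_true//.
  by rewrite image_eq.
rewrite (_ : esum _ _ = \sum_(i <oo) \sum_(j <oo) box_volume (G i j)).
  apply: lee_lim.
  - by apply: is_cvg_nneseries => *; exact: nneseries_ge0.
  - by apply: is_cvg_nneseries => *; rewrite adde_ge0.
  - by near=> k; apply: lee_sum => i _; exact: (PG i).2.
pose J : nat -> set (nat * nat) := fun i => [set (i, j) | j in setT].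
rewrite (_ : setT = \bigcup_k J k).
  rewrite esum_bigcupT//=.
    rewrite -(image_id [set: nat]) -fun_true esum_pred_image//; last first.
      by move=> k _; exact: esum_ge0.
    apply: eq_eseriesr => /= j _.
    rewrite -(esum_pred_image (box_volume \o uncurry G) (pair j) predT)//=.
      by congr esum; rewrite predeqE => -[a b]; split; move=> [i _ <-]; exists i.
    by move=> ? ? _ _; exact: (@can_inj _ _ _ snd).
  apply/trivIsetP => i j _ _ ij.
  rewrite predeqE => -[k m] /=; split => //= -[] [_] _ [<-{k} _].
  by move=> [m' _] [] /esym/eqP; rewrite (negbTE ij).
by rewrite predeqE => -[a b]; split => // _; exists a => //; exists b.
Unshelve. all: by end_near. Qed.

HB.instance Definition _ := isOuterMeasure.Build R T lebesgue_outer
  lebesgue_outer0 lebesgue_outer_ge0 le_lebesgue_outer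
  lebesgue_outer_sigma_subadditive.

End lebesgue_outer.

Section euclid.
Context (R : realType) (n : nat).
Let outer : {outer_measure set 'rV[R]_n.+1 -> \bar R} := @lebesgue_outer R n.

(* R^(n+1), carrying both its usual topology and the sigma-algebra of
   Lebesgue (i.e. Caratheodory) measurable sets. *)
Definition euclid := 'rV[R]_n.+1.
HB.instance Definition _ := NormedModule.on euclid.
HB.instance Definition _ := @isMeasurable.Build (outer.-cara)%mdisp euclid
  outer.-caratheodory
  (caratheodory_measurable_set0 outer)
  (@caratheodory_measurable_setC _ _ outer)
  (@caratheodory_measurable_bigcup _ _ outer).

Definition leb : set euclid -> \bar R := @lebesgue_outer R n.
HB.instance Definition _ := isMeasure.Build _ euclid R leb
  (@caratheodory_measure0 _ _ outer)
  (@caratheodory_measure_ge0 _ _ outer)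
  (@caratheodory_measure_sigma_additive _ _ outer).

End euclid.
Arguments leb : clear implicits.

(* Function spaces are sets of functions carrying a seminorm that vanishes
   exactly on the functions that are zero almost everywhere; no quotient is
   taken, so equality in such a space is equality almost everywhere. *)
Record seminormed (R : realType) (E : zmodType) := Seminormed {
  carrier : set E ;
  snorm : E -> R }.

Definition sn_bounded (R : realType) (E : zmodType) (X : seminormed R E)
    (A : set E) :=
  A `<=` carrier X /\ exists M, forall x, A x -> snorm X x <= M.

Section operators.
Context (R : realType) (E E' : zmodType).
Implicit Types (X : seminormed R E) (Y : seminormed R E') (B : E -> E').

Definition maps_into X Y B := forall x, carrier X x -> carrier Y (B x).

Definition bounded_op X Y B := maps_into X Y B /\
  forall A, sn_bounded X A -> sn_bounded Y (B @` A).

Definition continuous_op X Y B := maps_into X Y B /\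
  forall x e, carrier X x -> 0 < e -> exists2 d, 0 < d &
    forall y, carrier X y -> snorm X (y - x) < d -> snorm Y (B y - B x) < e.

Definition sn_closure X (A : set E) : set E :=
  [set x | carrier X x /\
    forall e, 0 < e -> exists2 y, A y & snorm X (y - x) < e].

(* [compact] for the topology of the seminorm: every proper filter on K has a
   cluster point in K. *)
Definition sn_compact X (K : set E) :=
  forall F : set_system E, ProperFilter F -> F K ->
    exists2 x, K x & forall A e, F A -> 0 < e ->
      exists2 y, A y & snorm X (y - x) < e.

Definition relatively_compact X (A : set E) := sn_compact X (sn_closure X A).

End operators.

Definition compact_op (R : realType) (E E' : zmodType) (X : seminormed R E)
    (Y : seminormed R E') (B : E -> E') :=
  continuous_op X Y B /\
  forall A, sn_bounded X A -> relatively_compact Y (B @` A).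

(* A functional is a function on all of E of which only the values on the
   carrier of X are relevant. *)
Definition dual (R : realType) (E : lmodType R) (X : seminormed R E) :
    seminormed R (E -> R) := {|
  carrier := [set l | (forall (k : R) u v, carrier X u -> carrier X v ->
                         l (k *: u + v) = k * l u + l v) /\
                      exists C, forall u, carrier X u -> `|l u| <= C * snorm X u];
  snorm := fun l =>
    sup [set `|l u| | u in [set u | carrier X u /\ snorm X u <= 1]] |}.

Section domain.
Context (R : realType) (n : nat) (Omega : set (euclid R n)).
Local Notation T := (euclid R n).
Local Notation mu := (leb R n).
Implicit Types (u v w g : T -> R) (i j : 'I_n.+1).

Definition Lp (p : \bar R) : seminormed R (T -> R) := {|
  carrier := [set u | measurable_fun Omega u /\
                      ('N[mu]_p[EFin \o (u \_ Omega)] < +oo)%E];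
  snorm := fun u => fine 'N[mu]_p[EFin \o (u \_ Omega)]%E |}.

Definition ip u v : R := \int[mu]_(x in Omega) (u x * v x).

(* z : L^r(Omega) seen as the functional v |-> \int_Omega z v *)
Definition functional_of (z : T -> R) : (T -> R) -> R := fun v => ip z v.

Definition pderiv i u : T -> R := fun x => 'D_(delta_mx 0 i : T) u x.

Definition smooth u := forall (l : seq 'I_n.+1) x,
  {for x, continuous (foldr pderiv u l)} /\
  forall i, derivable (foldr pderiv u l) x (delta_mx 0 i).

Definition test_function u := smooth u /\
  exists K : set T, [/\ compact K, K `<=` Omega & forall x, ~ K x -> u x = 0].

Definition is_weak_pderiv i u g := forall w, test_function w ->
  ip u (pderiv i w) = - ip g w.

Definition wD i u : T -> R :=
  xget (cst 0) [set g | carrier (Lp 2%:E) g /\ is_weak_pderiv i u g].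

Definition H1 : seminormed R (T -> R) := {|
  carrier := [set u | carrier (Lp 2%:E) u /\
    forall i, exists2 g, carrier (Lp 2%:E) g & is_weak_pderiv i u g];
  snorm := fun u => Num.sqrt (snorm (Lp 2%:E) u ^+ 2 +
    \sum_i snorm (Lp 2%:E) (wD i u) ^+ 2) |}.

Definition H10 : set (T -> R) := sn_closure H1 test_function.

Section operator.
Variable a : 'I_n.+1 -> 'I_n.+1 -> T -> R.

Record elliptic_coefficients : Prop := EllipticCoefficients {
  coef_Linfty : forall i j, carrier (Lp +oo%E) (a i j) ;
  coef_sym : forall i j, {ae mu, forall x, Omega x -> a i j x = a j i x} ;
  coef_elliptic : exists2 gamma : R, 0 < gamma &
    {ae mu, forall x, Omega x -> forall xi : 'I_n.+1 -> R,
      gamma * (\sum_i xi i ^+ 2) <= \sum_i \sum_j a i j x * xi i * xi j} }.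

Definition form_D u v : R :=
  \sum_i \sum_j \int[mu]_(x in Omega) (a i j x * wD i u x * wD j v x).

(* The graph of L_D: u is in the domain and L_D u = w. *)
Definition is_LD u w := [/\ H10 u, carrier (Lp 2%:E) w &
  forall v, H10 v -> form_D u v = ip w v].

Record eigenbasis (lam : nat -> R) (phi : nat -> T -> R) : Prop := Eigenbasis {
  eig_gt0 : 0 < lam 0%N ;
  eig_nondecreasing : forall k, lam k <= lam k.+1 ;
  eig_cvg : lam k @[k --> \oo] --> +oo ;
  eig_LD : forall k, is_LD (phi k) (lam k *: phi k) ;
  eig_orthonormal : forall k l, ip (phi k) (phi l) = (k == l)%:R ;
  eig_complete : forall u, carrier (Lp 2%:E) u ->
    snorm (Lp 2%:E) (u - \sum_(k < m) ip u (phi k) *: phi k)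
      @[m --> \oo] --> (0 : R) }.

End operator.

Section fractional.
Variables (lam : nat -> R) (phi : nat -> T -> R).

Definition Hnorm2 (theta : R) u : \bar R :=
  (\sum_(k <oo) (lam k `^ theta * ip u (phi k) ^+ 2)%:E)%E.

Definition Hs (theta : R) : seminormed R (T -> R) := {|
  carrier := [set u | carrier (Lp 2%:E) u /\ (Hnorm2 theta u < +oo)%E];
  snorm := fun u => Num.sqrt (fine (Hnorm2 theta u)) |}.

(* (L_D)^alpha u, the sum of the series in L^2(Omega) *)
Definition LDpow (alpha : R) u : T -> R :=
  xget (cst 0) [set w | carrier (Lp 2%:E) w /\
    snorm (Lp 2%:E) (w - \sum_(k < m) (lam k `^ alpha * ip u (phi k)) *: phi k)
      @[m --> \oo] --> (0 : R)].

End fractional.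

Section nonlinearity.
Variable f : T -> R -> R.

Definition primitive (g : T -> R -> R) x (t : R) : R :=
  \int[lebesgue_measure]_(tau in `[0, `|t|]%classic) g x tau.

Definition F_ := primitive f.

Definition f_inv x : R -> R := 'pinv_(fun=> 0) setT (f x).

Definition F_conj := primitive f_inv.

Record assumption_A : Prop := AssumptionA {
  A_fun : {ae mu, forall x, Omega x ->
    [/\ forall t, f x (- t) = - f x t,
        {homo f x : t t' / t < t'},
        continuous (f x),
        f x 0 = 0 &
        f x t @[t --> +oo] --> +oo]} ;
  A_meas : forall t, measurable_fun Omega (f ^~ t) ;
  A_F : exists2 c1 : R, 0 < c1 <= 1 &
    {ae mu, forall x, Omega x ->
      forall t, c1 * (t * f x t) <= F_ x t <= t * f x t} ;
  A_Fconj : exists2 c2 : R, 0 < c2 <= 1 &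
    {ae mu, forall x, Omega x ->
      forall t, c2 * (t * f_inv x t) <= F_conj x t <= t * f_inv x t} }.

Definition growth_condition := exists2 c : R, 0 < c <= 1 &
  {ae mu, forall x, Omega x ->
    forall xi eta, c * `|f x (xi - eta)| <= `|f x xi - f x eta|}.

Definition L_F : seminormed R (T -> R) := {|
  carrier := [set u | measurable_fun Omega u /\
                      mu.-integrable Omega (fun x => (F_ x (u x))%:E)];
  snorm := fun u => inf [set k : R | 0 < k /\
    (\int[mu]_(x in Omega) (F_ x (u x / k))%:E <= 1)%E] |}.

Definition V_0 (lam : nat -> R) (phi : nat -> T -> R) (s : R) :
    seminormed R (T -> R) := {|
  carrier := carrier (Hs lam phi s) `&` carrier L_F;
  snorm := fun u => snorm (Hs lam phi s) u + snorm L_F u |}.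

Definition op_A_F (lam : nat -> R) (phi : nat -> T -> R) (s : R) u v : R :=
  ip (LDpow lam phi (s / 2) u) (LDpow lam phi (s / 2) v) +
  \int[mu]_(x in Omega) (f x (u x) * v x).

End nonlinearity.

End domain.

(* q is an admissible value of 2^* in dimension N; none when N = 1, s > 1/2. *)
Definition critical_exponent (R : realType) (N : nat) (s q : R) : Prop :=
  ((2 <= N)%N \/ N = 1%N /\ s < 1 / 2) /\ q = 2 * N%:R / (N%:R - 2 * s) \/
  [/\ N = 1%N, s = 1 / 2 & 1 <= q].

(* Main.v *)
(* The form of A_F splits as a(u,v) + b(u,v) with a(u,u) = ||u||_{H^s}^2 and
   b(u,v) = int f(x,u) v. Writing rho(u) = int F(x,u), monotonicity of f gives
   injectivity, while under the growth condition
     ||u1-u2||_{H^s}^2 + c rho(u1-u2) <= ||A_F u1 - A_F u2||_* ||u1-u2||_{V_0}.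
   The lower bound in (A) for F gives f(x,t) <= C f(x,theta t) with theta < 1,
   and the one for its conjugate gives f(x,kappa t) <= theta' f(x,t) with
   kappa, theta' < 1 (split the integral at theta t); hence rho has the Delta_2
   property and grows superlinearly. Superlinearity turns the estimate (and its
   analogue with u2 = 0) into a bound on ||u||_{V_0}, so the inverse is bounded,
   and with Delta_2 it is uniformly continuous.

   For compactness it then suffices that bounded subsets of L^r are totally
   bounded in the dual of V_0: truncate z at height M (the tail is small in
   L^q', q' conjugate to the Sobolev exponent, because r > q'); the truncation
   is bounded in L^2, where the modes beyond m contribute at most a multiple of
   lambda_m^{-s/2} to the pairing, and the first m coefficients range in a
   bounded set. The limit of an ultrafilter
   along L^r in the dual gives cluster points, so completeness of V_0 is not
   required; the Luxemburg functional is only used as a quasinorm. *)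
Require Import Defs.
From mathcomp Require Import all_boot all_order all_algebra.
From mathcomp Require Import all_classical all_reals all_analysis.
From mathcomp Require Import measurable_realfun ess_sup_inf ring lra.
Set Implicit Arguments.
Unset Strict Implicit.
Unset Printing Implicit Defensive.
Import Order.TTheory GRing.Theory Num.Theory.
Import numFieldTopology.Exports numFieldNormedType.Exports.
Local Open Scope classical_set_scope.
Local Open Scope ring_scope.

(** * Lebesgue measurable sets of [euclid] *)

(** The geometry of Euclidean space enters through three facts: Lebesgue measure is complete, open
    sets are measurable, bounded sets have finite measure. The analysis is then done over an
    abstract measure space. Completeness matters because (A) holds for a.e. x, so that x ->
    f(x,u(x)) and x -> F(x,u(x)) are a.e. limits of measurable functions, and because L^2 limits are
    built pointwise almost everywhere. Scaling inequalities for F(x, .), with constants common to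
    a.e. x, take the place of convexity: they pass directly from integrands to the modular. A
    quasinorm suffices on V_0 since functionals are compared on the unit ball by homogeneity alone;
    the triangle inequality is called on in the target space, when a cluster point is compared with
    points of the filter. The function (L_D)^(s/2) u is a choice among a.e. equal functions and
    depends on u linearly only up to null sets, so the form is handled through eigenfunction
    coefficients. *)

Section lebesgue_facts.
Context (R : realType) (n : nat).
Local Notation T := (euclid R n).
Local Notation mu := (leb R n).

Lemma leb_complete : measure_is_complete mu.
Proof. exact: (@measure_is_complete_caratheodory R _ (@lebesgue_outer R n : {outer_measure set 'rV[R]_n.+1 -> \bar R})). Qed.

Lemma box_volume_ge0 (ab : T * T) : (0 <= box_volume ab)%E.
Proof. by rewrite lee_fin prodr_ge0// => i _; rewrite le_max lexx. Qed.

(** Caratheodory's criterion: the hyperplane x_i = c cuts each box of a cover of X into two boxes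
    whose volumes add up, and the pieces cover the two parts of X. Boxes are open below and closed
    above, so both pieces are again boxes of this kind. *)
Lemma measurable_halfspace (i : 'I_n.+1) (c : R) :
  measurable [set x : T | x 0 i <= c].
Proof.
apply: (@le_caratheodory_measurable R _ (@lebesgue_outer R n : {outer_measure set 'rV[R]_n.+1 -> \bar R})) => X.
apply: le_ereal_inf_tmp => _ [B XB <-].
pose B1 k : T * T := ((B k).1, \row_j if j == i then Num.min ((B k).2 0 j) c else (B k).2 0 j).
pose B2 k : T * T := (\row_j (if j == i then Num.max ((B k).1 0 j) c else (B k).1 0 j), (B k).2).
have vol k : (box_volume (B k) = box_volume (B1 k) + box_volume (B2 k))%E.
  rewrite /box_volume -EFinD; congr EFin.
  have D (ab : T * T) : \prod_(j < n.+1) Num.max 0 (ab.2 0 j - ab.1 0 j) =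
      Num.max 0 (ab.2 0 i - ab.1 0 i) *
      \prod_(j < n.+1 | j != i) Num.max 0 (ab.2 0 j - ab.1 0 j).
    by rewrite (bigD1 i).
  rewrite !D /= !mxE eqxx.
  rewrite (eq_bigr (fun j => Num.max 0 ((B k).2 0 j - (B k).1 0 j))
    (F1 := fun j => Num.max 0 ((\row_l _) 0 j - _))); last first.
    by move=> j /negbTE ji; rewrite !mxE ji.
  rewrite (eq_bigr (fun j => Num.max 0 ((B k).2 0 j - (B k).1 0 j))
    (F1 := fun j => Num.max 0 (_ - (\row_l _) 0 j))); last first.
    by move=> j /negbTE ji; rewrite !mxE ji.
  rewrite -mulrDl; congr (_ * _).
  move: ((B k).1 0 i) ((B k).2 0 i) => a b.
  by rewrite /Num.max /Num.min; repeat case: ifPn; rewrite -?leNgt; lra.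
rewrite (eq_eseriesr (g := fun k => box_volume (B1 k) + box_volume (B2 k))%E)//.
rewrite nneseriesD; [|by move=> *; exact: box_volume_ge0..].
apply: leeD; apply: ereal_inf_lbound.
- exists B1 => //= x [/XB [k _ xk] /= xc]; exists k => // j; rewrite /= !mxE.
  by case: ifPn => [/eqP ->|_]; [rewrite le_min xc andbT; exact: xk | exact: xk].
- exists B2 => //= x [/XB [k _ xk] /= /negP]; rewrite -ltNge => xc.
  exists k => // j; rewrite /= !mxE.
  by case: ifPn => [/eqP ->|_]; [rewrite gt_max xc andbT; exact: xk | exact: xk].
Qed.

Lemma measurable_box (ab : T * T) : measurable (box ab : set T).
Proof.
rewrite (_ : box ab = \bigcap_(i in [set: 'I_n.+1])
   ([set x : T | x 0 i <= ab.2 0 i] `\` [set x : T | x 0 i <= ab.1 0 i])).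
  apply: fin_bigcap_measurable => // i _; apply: measurableD; exact: measurable_halfspace.
apply/seteqP; split => x /=.
  move=> xab i _ /=; have /andP[h1 h2] := xab i.
  by split => //; apply/negP; rewrite -ltNge.
move=> xab i; have /= [h1 /negP] := xab i I; rewrite -ltNge => h2.
by rewrite h1 h2.
Qed.

(** An open set is the union of the boxes with rational corners contained in it, a countable
    family. *)
Lemma measurable_open (A : set T) : open A -> measurable A.
Proof.
move=> oA.
pose b (q : 'rV[rat]_n.+1 * 'rV[rat]_n.+1) : T * T :=
  (map_mx (ratr : rat -> R) q.1, map_mx (ratr : rat -> R) q.2).
rewrite (_ : A = \bigcup_(q in [set: 'rV[rat]_n.+1 * 'rV[rat]_n.+1])
    (if `[< box (b q) `<=` A >] then box (b q) else set0)).
  apply: countable_bigcupT_measurable => // q.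
  by case: ifPn => // _; exact: measurable_box.
apply/seteqP; split => x /=; last first.
  by move=> [q _]; case: ifPn => // /asboolP; exact.
move=> Ax; have /nbhs_ballP [e /= e0 xeA] : nbhs x A by apply: open_nbhs_nbhs.
have lo i : {q : rat | x 0 i - e < ratr q < x 0 i}.
  by apply: cid; have := @rat_in_itvoo R (x 0 i - e) (x 0 i); rewrite ltrBlDr ltrDl => /(_ e0) [q]; rewrite in_itv/=; exists q.
have hi i : {q : rat | x 0 i < ratr q < x 0 i + e}.
  by apply: cid; have := @rat_in_itvoo R (x 0 i) (x 0 i + e); rewrite ltrDl => /(_ e0) [q]; rewrite in_itv/=; exists q.
pose q : 'rV[rat]_n.+1 * 'rV[rat]_n.+1 := (\row_i sval (lo i), \row_i sval (hi i)).
exists q => //; rewrite asboolT.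
  by move=> i; rewrite !mxE /=; case: (lo i) (hi i) => /= l /andP[_ ->] [/= h /andP[/ltW -> _]].
move=> y yq; apply: xeA; split => // i j; rewrite (ord1 i).
have := yq j; rewrite !mxE /= /ball_; case: (lo j) (hi j) => /= l /andP[l1 l2] [/= h /andP[h1 h2]].
move=> /andP[a1 a2]; rewrite /ball/= ltr_norml.
by apply/andP; split; lra.
Qed.

Lemma leb_bounded_set (A : set T) : bounded_set A -> (mu A < +oo)%E.
Proof.
move=> [M [_ /(_ (M + 1))]]; rewrite ltrDl ltr01 => /(_ isT) AM.
(* One large box, then empty boxes of volume 0. Coordinates are at most |M| + 1 in absolute value;
   the extra 1 is there because a box excludes its lower faces. *)
pose B (k : nat) : T * T := if k == 0%N then (const_mx (- (`|M| + 2)), const_mx (`|M| + 2)) else (0, 0).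
apply: (@le_lt_trans _ _ (\sum_(k <oo) box_volume (B k))%E).
  apply: ereal_inf_lbound; exists B => //= x Ax; exists 0%N => // i; rewrite /= !mxE.
  have : `|x 0 i| <= `|M| + 1.
    have := AM _ Ax; rewrite /= {1}/Num.norm/= mx_normrE => h.
    apply: (@le_trans _ _ (\big[Num.max/0]_ij `|x ij.1 ij.2|)).
      by have := le_bigmax 0 (fun ij : 'I_1 * 'I_n.+1 => `|x ij.1 ij.2|) (0, i).
    by rewrite (le_trans h)// lerD2r ler_norm.
  by rewrite ler_norml => /andP[? ?]; apply/andP; split; lra.
rewrite (nneseriesD1 (n := 0%N))//; last by move=> *; exact: box_volume_ge0.
rewrite eseries0 ?adde0 ?ltry// => k _ /= k0.
rewrite /box_volume /B (negbTE k0) big_ord_recl.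
by rewrite mxE subr0 maxxx mul0r.
Qed.

End lebesgue_facts.

(** * Monotone functions and their primitives *)

Section monotone_primitive.
Context (R : realType) (g : R -> R).
Hypothesis g_nd : {homo g : x y / x <= y}.
Local Notation I t := (\int[lebesgue_measure]_(tau in `[0, t]%classic) g tau).

Lemma nondecreasing_integrable_itv (a b : R) :
  lebesgue_measure.-integrable `[a, b]%classic (EFin \o g).
Proof.
apply: measurable_bounded_integrable => //=.
- by rewrite lebesgue_measure_itv/=; case: ifPn => // _; rewrite -EFinB ltry.
- by apply: nondecreasing_measurable => // x y _ _; exact: g_nd.
- exists (Num.max `|g a| `|g b|); split; first by rewrite num_real.
  move=> M ltM x /=; rewrite in_itv/= => /andP[ax xb].
  have := g_nd ax; have := g_nd xb.
  move: ltM; rewrite gt_max => /andP[]; rewrite !ltr_norml ler_norml.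
  by move=> /andP[? ?] /andP[? ?] ? ?; apply/andP; split; lra.
Qed.

Lemma monotone_primitive_bounds (a b : R) : 0 <= a -> a <= b ->
  g a * (b - a) <= I b - I a <= g b * (b - a).
Proof.
move=> a0 ab.
rewrite (@Rintegral_itvB _ g (BLeft 0) (BRight b) a) ?bnd_simp//; last first.
  exact: nondecreasing_integrable_itv.
have mab : fine (lebesgue_measure (`]a, b]%classic : set R)) = b - a.
  rewrite lebesgue_measure_itv/= lte_fin; case: ifPn => //= h.
  by rewrite (_ : b = a) ?subrr//; apply/eqP; rewrite eq_le ab leNgt h.
have iab : lebesgue_measure.-integrable `]a, b]%classic (EFin \o g).
  apply: integrableS (nondecreasing_integrable_itv a b) => //.
  exact: subset_itv_oc_cc.
have icst (c : R) : lebesgue_measure.-integrable (`]a, b]%classic : set R) (EFin \o cst c).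
  apply: measurable_bounded_integrable => //=.
    by rewrite lebesgue_measure_itv/=; case: ifPn => // _; rewrite -EFinB ltry.
  exists `|c|; split; first by rewrite num_real.
  by move=> M /ltW ? x _.
rewrite -mab -!Rintegral_cst//.
apply/andP; split; (apply: le_Rintegral; [by []|exact: icst || exact: iab|exact: icst || exact: iab|]).
- by move=> x /=; rewrite in_itv/= => /andP[/ltW ? _]; exact: g_nd.
- by move=> x /=; rewrite in_itv/= => /andP[_ ?]; exact: g_nd.
Qed.

Lemma monotone_primitive_split (y th : R) : 0 <= y -> 0 <= th <= 1 ->
  I y <= th * y * g (th * y) + (1 - th) * y * g y.
Proof.
move=> y0 /andP[th0 th1].
have I0 : I 0 = 0 by rewrite set_itv1 Rintegral_set1.
have ty0 : 0 <= th * y by rewrite mulr_ge0.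
have tyy : th * y <= y by rewrite ler_piMl.
have /andP[_] := monotone_primitive_bounds ty0 tyy.
have /andP[_] := monotone_primitive_bounds (lexx 0) ty0.
by rewrite I0 !subr0 => ? ?; lra.
Qed.

(** Splitting at (1 - c/2) t leaves an interval of length (c/2) t, on which the integral is at most
    (c/2) t g(t), half of the assumed lower bound c t g(t); the other half must come from the value
    at the cut. Applied below both to f(x, .) and to its inverse. *)
Lemma monotone_doubling (c : R) : 0 < c <= 1 ->
  (forall t, 0 <= t -> 0 <= g t) ->
  (forall t, 0 <= t -> c * (t * g t) <= I t) ->
  forall t, 0 <= t -> c / 2 * g t <= g ((1 - c / 2) * t).
Proof.
move=> /andP[c0 c1] gp H t; rewrite le_eqVlt => /predU1P[<-|t0].
  rewrite mulr0; have := gp 0 (lexx _) => ?; nra.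
have th : 0 <= 1 - c / 2 <= 1 by apply/andP; split; lra.
have := monotone_primitive_split (ltW t0) th.
have /(_ (ltW t0)) := H t.
have : g ((1 - c / 2) * t) >= 0 by apply: gp; rewrite mulr_ge0//; lra.
move: (g ((1 - c / 2) * t)) (g t) (I t) => A B C A0 h1 h2.
rewrite -(ler_pM2l t0).
have : 0 <= t * A * (c / 2) by rewrite !mulr_ge0//; lra.
nra.
Qed.

(** Telescoped [monotone_primitive_bounds]: since g 0 = 0, the left and right sums differ by the
    last right-hand term alone. It exhibits F(x, u(x)) as a limit of finite sums of values of f,
    whence its measurability. *)
Lemma riemann_sum_bound (t : R) (m : nat) : 0 <= t -> g 0 = 0 ->
  I t - t / m.+1%:R * g t <=
  \sum_(i < m.+1) t / m.+1%:R * g (t / m.+1%:R * i%:R) <= I t.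
Proof.
move=> t0 g0; set h := t / m.+1%:R.
have h0 : 0 <= h by rewrite divr_ge0.
have I0 : I 0 = 0 by rewrite set_itv1 Rintegral_set1.
suff H k : \sum_(i < k) h * g (h * i%:R) <= I (h * k%:R) <=
    \sum_(i < k) h * g (h * i%:R) + h * g (h * k%:R).
  have := H m.+1; rewrite (_ : h * m.+1%:R = t); last by rewrite /h divfK.
  by move=> /andP[-> ?]; rewrite andbT lerBlDr.
elim: k => [|k /andP[IH1 IH2]]; first by rewrite big_ord0 !mulr0 I0 g0 mulr0 addr0 lexx.
have hk : 0 <= h * k%:R by rewrite mulr_ge0.
have hk1 : h * k%:R <= h * k.+1%:R by rewrite ler_wpM2l// ler_nat.
have /andP[] := monotone_primitive_bounds hk hk1.
rewrite (_ : h * k.+1%:R - h * k%:R = h); last by rewrite -mulrBr -natrB ?subSnn ?mulr1.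
by rewrite big_ord_recr/= => b1 b2; apply/andP; split; lra.
Qed.

End monotone_primitive.

(** * Growth estimates for f(x, .) at a fixed point x *)

Section pointwise.
Context (R : realType) (f : R -> R).
Hypothesis f_odd : forall t, f (- t) = - f t.
Hypothesis f_incr : {homo f : t t' / t < t'}.
Hypothesis f_cont : continuous f.
Hypothesis f00 : f 0 = 0.
Hypothesis f_pinfty : f t @[t --> +oo] --> +oo.
Local Notation I g t := (\int[lebesgue_measure]_(tau in `[0, t]%classic) g tau).
Local Notation F t := (I f `|t|).
Local Notation h := ('pinv_(fun=> 0) setT f).

Let f_nd : {homo f : t t' / t <= t'}.
Proof. exact: ltW_homo. Qed.

Let f_inj : injective f.
Proof. by move=> x y e; case: (ltgtP x y) => // /f_incr; rewrite e ltxx. Qed.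

(** The intermediate value theorem on the half-line, then oddness. The partial inverse [h] is known
    only on the range of [f], so being onto is what makes every argument of [h] usable. *)
Lemma odd_increasing_surj y : exists t, f t = y.
Proof.
have pos z : 0 <= z -> exists t, f t = z.
  move=> z0; have /cvgryPge /(_ z) [M [_ /(_ (`|M| + 1))]] := f_pinfty.
  rewrite (le_lt_trans (ler_norm _)) ?ltrDl// => /(_ isT) fM.
  have [] := @IVT R f 0 (`|M| + 1) z.
  - by rewrite addr_ge0.
  - exact: continuous_subspaceT.
  - have : f 0 <= f (`|M| + 1) by apply: f_nd; rewrite addr_ge0.
    by rewrite f00 => fM0; rewrite min_l// max_r// z0 fM.
  - by move=> c _ <-; exists c.
have [/pos//|/ltW] := leP 0 y.
by rewrite -oppr_ge0 => /pos [t ft]; exists (- t); rewrite f_odd ft opprK.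
Qed.

Let hK t : h (f t) = t.
Proof. by rewrite pinvKV ?inE// => ? ? _ _; exact: f_inj. Qed.

Let h_nd : {homo h : t t' / t <= t'}.
Proof.
move=> y y'; have [t <-] := odd_increasing_surj y; have [t' <-] := odd_increasing_surj y'.
rewrite !hK; apply: contraTT; rewrite -!ltNge; exact: f_incr.
Qed.

Lemma increasing_ge0 (t : R) : 0 <= t -> 0 <= f t.
Proof. by move=> t0; rewrite -f00; exact: f_nd. Qed.

Lemma normr_odd (t : R) : `|f t| = f `|t|.
Proof.
have [t0|t0] := leP 0 t; first by rewrite ger0_norm ?increasing_ge0// ger0_norm.
rewrite (ltr0_norm t0) f_odd ltr0_norm// -oppr_gt0 -f_odd -f00 f_incr//.
by rewrite oppr_gt0.
Qed.

Lemma mulr_odd (t : R) : t * f t = `|t| * f `|t|.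
Proof.
have [t0|t0] := leP 0 t; first by rewrite ger0_norm.
by rewrite ltr0_norm// f_odd mulrNN.
Qed.

Section bounds.
Variables c1 c2 : R.
Hypotheses (c1P : 0 < c1 <= 1) (c2P : 0 < c2 <= 1).
Hypothesis F_bounds : forall t, c1 * (t * f t) <= F t <= t * f t.
Hypothesis Fconj_bounds : forall t, c2 * (t * h t) <= I h `|t| <= t * h t.

Lemma doubling_f (t : R) : 0 <= t -> c1 / 2 * f t <= f ((1 - c1 / 2) * t).
Proof.
apply: monotone_doubling => //; first exact: increasing_ge0.
by move=> u u0; have /andP[] := F_bounds u; rewrite ger0_norm.
Qed.

(** The doubling inequality of [h], read at the value f(t), says (c2/2) t <= h((1 - c2/2) f(t));
    applying f inverts it. *)
Lemma contraction_f (t : R) : 0 <= t -> f (c2 / 2 * t) <= (1 - c2 / 2) * f t.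
Proof.
move=> t0; have h0 : h 0 = 0 by have := hK 0; rewrite f00.
have : c2 / 2 * h (f t) <= h ((1 - c2 / 2) * f t).
  apply: monotone_doubling => //; last exact: increasing_ge0.
  - by move=> u u0; have := h_nd u0; rewrite h0.
  - by move=> u u0; have /andP[] := Fconj_bounds u; rewrite ger0_norm.
rewrite hK; have [t' <-] := odd_increasing_surj ((1 - c2 / 2) * f t).
by rewrite hK; exact: f_nd.
Qed.

Lemma doubling_iter j (t : R) : 0 <= t ->
  (c1 / 2) ^+ j * f t <= f ((1 - c1 / 2) ^+ j * t).
Proof.
move=> t0; have /andP[c10 c11] := c1P.
elim: j => [|j IH]; first by rewrite !expr0 !mul1r.
have u0 : 0 <= (1 - c1 / 2) ^+ j * t by rewrite mulr_ge0// exprn_ge0//; lra.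
rewrite !exprS -(mulrA (c1 / 2)) -(mulrA (1 - c1 / 2)).
apply: le_trans (doubling_f u0).
by apply: ler_wpM2l; [lra|exact: IH].
Qed.

Lemma contraction_iter j (t : R) : 0 <= t ->
  f ((c2 / 2) ^+ j * t) <= (1 - c2 / 2) ^+ j * f t.
Proof.
move=> t0; have /andP[c10 c11] := c2P.
elim: j => [|j IH]; first by rewrite !expr0 !mul1r.
have u0 : 0 <= (c2 / 2) ^+ j * t by rewrite mulr_ge0// exprn_ge0//; lra.
rewrite !exprS -(mulrA (c2 / 2)) -(mulrA (1 - c2 / 2)).
apply: (le_trans (contraction_f u0)).
by apply: ler_wpM2l; [lra|exact: IH].
Qed.

Lemma F_ge0 (t : R) : 0 <= F t.
Proof. by apply: Rintegral_ge0 => x /=; rewrite in_itv/= => /andP[/increasing_ge0]. Qed.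

Lemma F_homo (t t' : R) : `|t| <= `|t'| -> F t <= F t'.
Proof.
move=> tt'; have /andP[+ _] := monotone_primitive_bounds f_nd (normr_ge0 t) tt'.
have : 0 <= f `|t| * (`|t'| - `|t|).
  by rewrite mulr_ge0 ?subr_ge0// increasing_ge0.
by move=> h1 h2; lra.
Qed.

(** After j doublings the argument lam |t| has shrunk below |t|. The bounds F <= t f and c1 t f <= F
    convert between F and f, at the cost of the factors lam and 1/c1. *)
Lemma F_dilate j (lam t : R) : 0 <= lam -> (1 - c1 / 2) ^+ j * lam <= 1 ->
  F (lam * t) <= lam * (c1 / 2) ^- j / c1 * F t.
Proof.
move=> lam0 jlam; have /andP[c10 c11] := c1P.
have /andP[_ h1] := F_bounds (lam * t).
have /andP[h2 _] := F_bounds t.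
have lt0 : 0 <= lam * `|t| by rewrite mulr_ge0.
have := doubling_iter j lt0.
have : f ((1 - c1 / 2) ^+ j * (lam * `|t|)) <= f `|t|.
  by apply: f_nd; rewrite mulrA ler_piMl.
move=> h3 h4.
have cj : 0 < (c1 / 2) ^+ j by rewrite exprn_gt0//; lra.
have h5 : f (lam * `|t|) <= (c1 / 2) ^- j * f `|t|.
  by rewrite ler_pdivlMl//; exact: le_trans h4 h3.
apply: (le_trans h1).
rewrite mulr_odd normrM (ger0_norm lam0).
apply: (@le_trans _ _ (lam * `|t| * ((c1 / 2) ^- j * f `|t|))).
  exact: ler_wpM2l.
rewrite (_ : _ * _ = lam * (c1 / 2) ^- j / c1 * (c1 * (`|t| * f `|t|))); last first.
  by field; rewrite lt0r_neq0//=; rewrite gt_eqF.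
apply: ler_wpM2l; first by rewrite !mulr_ge0 ?invr_ge0// ltW.
by rewrite -mulr_odd.
Qed.

(** Beyond the factor (c2/2)^j of linear scaling there is a gain (1 - c2/2)^j, as small as desired:
    this is superlinearity. *)
Lemma F_contract j (t : R) :
  F ((c2 / 2) ^+ j * t) <= (1 - c2 / 2) ^+ j / c1 * (c2 / 2) ^+ j * F t.
Proof.
have /andP[c10 c11] := c1P; have /andP[c20 c21] := c2P.
have k0 : 0 <= (c2 / 2) ^+ j by rewrite exprn_ge0//; lra.
have th0 : 0 <= (1 - c2 / 2) ^+ j by rewrite exprn_ge0//; lra.
have /andP[_ h1] := F_bounds ((c2 / 2) ^+ j * t).
have /andP[h2 _] := F_bounds t.
apply: (le_trans h1).
rewrite mulr_odd normrM (ger0_norm k0).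
have h3 := contraction_iter j (normr_ge0 t).
apply: (@le_trans _ _ ((c2 / 2) ^+ j * `|t| * ((1 - c2 / 2) ^+ j * f `|t|))).
  by apply: ler_wpM2l => //; rewrite mulr_ge0.
rewrite (_ : (c2 / 2) ^+ j * `|t| * ((1 - c2 / 2) ^+ j * f `|t|) = (1 - c2 / 2) ^+ j / c1 * (c2 / 2) ^+ j * (c1 * (`|t| * f `|t|))); last first.
  by move: ((c2 / 2) ^+ j) ((1 - c2 / 2) ^+ j) => A B; field; rewrite gt_eqF.
apply: ler_wpM2l; first by rewrite !mulr_ge0 ?invr_ge0// ltW.
by rewrite -mulr_odd.
Qed.

(** Up to the constant c1, the inequality F(t/r) <= F(t)/r of a convex function vanishing at 0; here
    it comes from the monotonicity of f. *)
Lemma F_shrink (r t : R) : 1 <= r -> F (t / r) <= (c1 * r)^-1 * F t.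
Proof.
move=> r1; have /andP[c10 c11] := c1P.
have r0 : 0 < r by lra.
have /andP[_ h1] := F_bounds (t / r).
have /andP[h2 _] := F_bounds t.
apply: (le_trans h1).
rewrite mulr_odd normrM normfV (gtr0_norm r0).
apply: (@le_trans _ _ (`|t| / r * f `|t|)).
  apply: ler_wpM2l; first by rewrite divr_ge0// ltW.
  by apply: f_nd; rewrite ler_pdivrMr// ler_peMr.
rewrite (_ : `|t| / r * f `|t| = (c1 * r)^-1 * (c1 * (`|t| * f `|t|))); last first.
  by field; rewrite !gt_eqF.
apply: ler_wpM2l; first by rewrite invr_ge0 ltW// mulr_gt0.
by rewrite -mulr_odd.
Qed.

(** A Young inequality without the conjugate function: if |t| >= |v| then |f(t) v| <= t f(t),
    otherwise |f(t) v| <= v f(v). *)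
Lemma f_mul_bound (t v : R) : `|f t * v| <= c1^-1 * (F t + F v).
Proof.
have /andP[c10 c11] := c1P.
have /andP[h1 _] := F_bounds t; have /andP[h2 _] := F_bounds v.
rewrite normrM normr_odd.
apply: (@le_trans _ _ (t * f t + v * f v)); last first.
  by rewrite -(ler_pM2l c10) mulrA divff ?gt_eqF// mul1r mulrDr lerD.
rewrite (mulr_odd t) (mulr_odd v).
have ft := increasing_ge0 (normr_ge0 t); have fv := increasing_ge0 (normr_ge0 v).
have [vt|/ltW tv] := leP `|v| `|t|.
  apply: (@le_trans _ _ (`|t| * f `|t|)); last by rewrite lerDl mulr_ge0.
  by rewrite mulrC ler_wpM2r.
apply: (@le_trans _ _ (`|v| * f `|v|)); last by rewrite lerDr mulr_ge0.
by rewrite mulrC ler_wpM2l// f_nd.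
Qed.

End bounds.

Lemma f_monotone xi eta : 0 <= (f xi - f eta) * (xi - eta).
Proof.
have [le|/ltW le] := leP xi eta.
  by rewrite mulr_le0// subr_le0// f_nd.
by rewrite mulr_ge0// subr_ge0// f_nd.
Qed.

Lemma f_monotone_growth c xi eta :
  c * `|f (xi - eta)| <= `|f xi - f eta| ->
  c * ((xi - eta) * f (xi - eta)) <= (f xi - f eta) * (xi - eta).
Proof.
move=> H; rewrite -[leRHS]ger0_norm ?f_monotone// normrM.
have -> : (xi - eta) * f (xi - eta) = `|f (xi - eta)| * `|xi - eta|.
  by rewrite mulr_odd normr_odd mulrC.
by rewrite mulrA ler_wpM2r.
Qed.

End pointwise.

(** * Square integrable functions, Riesz-Fischer *)

(** The sequences v_j - 2S/2^j and v_j + 2S/2^j are monotone because the admissible step S/2^j is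
    exactly the decrease of 2S/2^j; they enclose the limit and give the rate. *)
Lemma geometric_cauchy (R : realType) (v : R^nat) (S : R) :
  (forall j, `|v j.+1 - v j| <= S * 2^-1 ^+ j) ->
  exists2 l, v @ \oo --> l & forall j, `|l - v j| <= 2 * S * 2^-1 ^+ j.
Proof.
move=> vS.
have step j : S * 2^-1 ^+ j = 2 * S * 2^-1 ^+ j - 2 * S * 2^-1 ^+ j.+1.
  by rewrite exprS; field.
pose w j := v j - 2 * S * 2^-1 ^+ j; pose z j := v j + 2 * S * 2^-1 ^+ j.
have nd_w : nondecreasing_seq w.
  by apply/nondecreasing_seqP => j; have := vS j; rewrite step ler_norml /w => /andP[? ?]; lra.
have ni_z : nonincreasing_seq z.
  by apply/nonincreasing_seqP => j; have := vS j; rewrite step ler_norml /z => /andP[? ?]; lra.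
have S0 : 0 <= S by have := vS 0%N; rewrite expr0 mulr1; exact: le_trans.
have wz j : w j <= z j.
  have : 0 <= 2 * S * 2^-1 ^+ j by rewrite !mulr_ge0// exprn_ge0.
  by rewrite /w /z => ?; lra.
have cw : cvgn w.
  apply: nondecreasing_is_cvgn => //; exists (z 0%N) => _ [j _ <-].
  by apply: (le_trans (wz j)); exact: ni_z.
have g0 : (fun j => 2 * S * 2^-1 ^+ j) @ \oo --> (0 : R).
  by apply: cvg_geometric; rewrite gtr0_norm ?invr_gt0// invf_lt1 ?ltr1n.
have vl : v @ \oo --> limn w.
  rewrite (_ : v = w \+ (fun j => 2 * S * 2^-1 ^+ j)).
    by rewrite -[limn w]addr0; exact: cvgD.
  by apply/funext => j; rewrite /w /=; ring.
have zl : z @ \oo --> limn w by rewrite -[limn w]addr0; exact: cvgD.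
exists (limn w) => // j; rewrite ler_norml; apply/andP; split.
  by have := nondecreasing_cvgn_le nd_w cw j; rewrite /w => ?; lra.
have := nonincreasing_cvgn_ge ni_z (cvgP _ zl) j.
by rewrite (cvg_lim _ zl)// /z => ?; lra.
Qed.

Section ae_integrals.
Context d (T : measurableType d) (R : realType).
Variables (mu : {measure set T -> \bar R}) (D : set T).
Hypothesis mD : measurable D.
Hypothesis mu_complete : measure_is_complete mu.
Implicit Types u v w g h : T -> R.
Local Notation intble u := (mu.-integrable D (EFin \o u)).
Local Notation "'int' u" := (\int[mu]_(x in D) u x) (at level 36).

(** The upper limit of the h_m is measurable and equals g almost everywhere; completeness of the
    measure carries measurability over. *)
Lemma ae_measurable_cvg (h : nat -> T -> R) g :
  (forall m, measurable_fun D (h m)) ->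
  {ae mu, forall x, D x -> h m x @[m --> \oo] --> g x} -> measurable_fun D g.
Proof.
move=> mh hg; apply/measurable_EFinP.
apply: (@ae_measurable_fun _ _ _ mu mu_complete _
   (fun x => limn_esup (fun m => (h m x)%:E))).
  apply: filterS hg => x /[apply] hx.
  have hx' : (h m x)%:E @[m --> \oo] --> (g x)%:E.
    by apply: cvg_EFin => //; exact: nearW.
  by rewrite limn_esup_lim; exact/cvg_lim/cvg_esups.
by apply: measurable_fun_limn_esup => m; apply/measurable_EFinP.
Qed.

Lemma ae_le_integrable g h : measurable_fun D g -> intble h ->
  {ae mu, forall x, D x -> `|g x| <= h x} -> intble g.
Proof.
move=> mg /integrableP[/measurable_EFinP mh ih] gh.
apply/integrableP; split; first exact/measurable_EFinP.
apply: le_lt_trans ih; apply: ae_ge0_le_integral => //.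
- by apply/measurable_EFinP; exact: measurableT_comp.
- by apply/measurable_EFinP; exact: measurableT_comp.
- by apply: filterS gh => x /[apply] gx; rewrite lee_fin (le_trans gx)// ler_norm.
Qed.

Lemma intble_eq u v : (forall x, u x = v x) -> intble u -> intble v.
Proof. by move=> uv; rewrite (_ : u = v)//; exact/funext. Qed.

Lemma intbleZ (k : R) u : intble u -> intble (fun x => k * u x).
Proof.
move=> iu; have := integrableZl mD k iu.
by apply: eq_integrable => // x _ /=; rewrite EFinM.
Qed.

Lemma intbleD u v : intble u -> intble v -> intble (fun x => u x + v x).
Proof. by move=> iu iv; have := integrableD mD iu iv. Qed.

Lemma intbleB u v : intble u -> intble v -> intble (fun x => u x - v x).
Proof. by move=> iu iv; have := integrableB mD iu iv. Qed.

Lemma ae_le_Rintegral g h : intble g -> intble h ->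
  {ae mu, forall x, D x -> g x <= h x} -> int g <= int h.
Proof.
move=> ig ih gh; rewrite -subr_ge0 -RintegralB// -lee_fin fineK; last first.
  exact: (integrable_fin_num (f := EFin \o _) mD (intbleB ih ig)).
have mgh : measurable_fun D (fun x => h x - g x).
  by apply: measurable_funB; apply/measurable_EFinP; apply: (measurable_int mu).
(* Replacing h - g by its positive part changes it on a null set and makes it nonnegative
   everywhere. *)
rewrite [leRHS](ae_eq_integral (fun x => (Num.max 0 (h x - g x))%:E))//.
- by apply: integral_ge0 => x _; rewrite lee_fin le_max lexx.
- exact/measurable_EFinP.
- by apply/measurable_EFinP/measurable_maxr.
- apply: filterS gh => x /[apply] gx; congr EFin.
  by rewrite max_r// subr_ge0.
Qed.

Lemma Rintegral_EFin u : intble u -> (\int[mu]_(x in D) (u x)%:E = (int u)%:E)%E.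
Proof. by move=> iu; rewrite fineK//; exact: (integrable_fin_num mD iu). Qed.

Lemma ae_eq_Rintegral u v : intble u -> measurable_fun D v ->
  {ae mu, forall x, D x -> u x = v x} -> intble v /\ int u = int v.
Proof.
move=> iu mv uv.
have iv : intble v.
  apply: (@ae_le_integrable _ (fun x => `|u x|)) => //; first exact: integrable_norm.
  by apply: filterS uv => x /[apply] ->.
by split => //; apply/eqP; rewrite eq_le !ae_le_Rintegral//;
  apply: filterS uv => x /[apply] ->.
Qed.

Lemma intble_lin (k : R) u v : intble u -> intble v -> intble (fun x => k * u x + v x).
Proof.
move=> iu iv; have := integrableD mD (integrableZl mD k iu) iv.
by apply: eq_integrable => // x _ /=; rewrite EFinD EFinM.
Qed.

Lemma Rintegral_lin (k : R) u v : intble u -> intble v ->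
  int (fun x => k * u x + v x) = k * int u + int v.
Proof.
move=> iu iv; rewrite RintegralD// ?RintegralZl//.
have := integrableZl mD k iu.
by apply: eq_integrable => // x _ /=; rewrite EFinM.
Qed.

Lemma intble_lty u : measurable_fun D u -> (forall x, 0 <= u x) ->
  (\int[mu]_(x in D) (u x)%:E < +oo)%E -> intble u.
Proof.
move=> mu' u0 ilt; apply/integrableP; split; first exact/measurable_EFinP.
by under eq_integral => x _ do rewrite gee0_abs ?lee_fin//.
Qed.

(** * The inner product of L^2 and the completeness of L^2 *)

Section L2.

Definition sq_integrable u := measurable_fun D u /\ intble (fun x => u x ^+ 2).
Local Notation L2 := sq_integrable.
Definition dotp u v : R := \int[mu]_(x in D) (u x * v x).
Local Notation ip := dotp.

Lemma ip_integrable u v : L2 u -> L2 v -> intble (fun x => u x * v x).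
Proof.
move=> [mu' iu] [mv iv].
apply: (@ae_le_integrable _ (fun x => u x ^+ 2 + v x ^+ 2)).
- exact: measurable_funM.
- exact: intbleD.
- apply: aeW => x _; rewrite ler_norml.
  have := sqr_ge0 (u x + v x); have := sqr_ge0 (u x - v x).
  have := sqr_ge0 (u x); have := sqr_ge0 (v x); rewrite sqrrB sqrrD !mulr2n.
  move: (u x) (v x) => a b; rewrite !expr2.
  move: (a * a) (b * b) (a * b) => A B C *; apply/andP; split; lra.
Qed.

Lemma L2_lin (k : R) u v : L2 u -> L2 v -> L2 (fun x => k * u x + v x).
Proof.
move=> [mu' iu] [mv iv]; split.
  by apply: measurable_funD => //; exact: measurable_funM.
apply: (@ae_le_integrable _ (fun x => (2 * k ^+ 2) * u x ^+ 2 + 2 * v x ^+ 2)).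
- by apply: measurable_funX; apply: measurable_funD => //; exact: measurable_funM.
- by apply: intble_lin => //; exact: intbleZ.
- apply: aeW => x _; rewrite ger0_norm ?sqr_ge0// -subr_ge0.
  by rewrite (_ : _ - _ = (k * u x - v x) ^+ 2) ?sqr_ge0//; ring.
Qed.

Lemma ip_lin (k : R) u v w : L2 u -> L2 v -> L2 w ->
  ip (fun x => k * u x + v x) w = k * ip u w + ip v w.
Proof.
move=> Lu Lv Lw; rewrite /dotp -Rintegral_lin; [|exact: ip_integrable..].
by apply: eq_Rintegral => x _ /=; rewrite mulrDl mulrA.
Qed.

Lemma ip_sym u v : ip u v = ip v u.
Proof. by apply: eq_Rintegral => x _; rewrite mulrC. Qed.

Lemma ip_linr (k : R) u v w : L2 u -> L2 v -> L2 w ->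
  ip w (fun x => k * u x + v x) = k * ip w u + ip w v.
Proof. by move=> *; rewrite ip_sym ip_lin// !(ip_sym w). Qed.

Lemma ip_ge0 u : 0 <= ip u u.
Proof. by apply: Rintegral_ge0 => x _; rewrite -expr2 sqr_ge0. Qed.

Lemma ip_cauchy u v : L2 u -> L2 v -> ip u v ^+ 2 <= ip u u * ip v v.
Proof.
move=> Lu Lv.
have key k : 0 <= k ^+ 2 * ip u u + 2 * k * ip u v + ip v v.
  have := ip_ge0 (fun x => k * u x + v x).
  rewrite ip_lin//; last exact: L2_lin.
  by rewrite !ip_linr// (ip_sym v u) => ?; lra.
have [u0|u0] := eqVneq (ip u u) 0.
  have [->|uv0] := eqVneq (ip u v) 0; first by rewrite expr0n/= mulr_ge0// ip_ge0.
  (* With ip u u = 0 the quadratic [key] is affine in k, and this k gives it the value -1. *)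
  have := key (- (ip v v + 1) / (2 * ip u v)); rewrite u0.
  rewrite (_ : _ + _ = - 1); last by field.
  by rewrite oppr_ge0 ler10.
have up : 0 < ip u u by rewrite lt_neqAle eq_sym u0 ip_ge0.
(* The minimiser of the quadratic. *)
have := key (- ip u v / ip u u).
rewrite (_ : _ + _ = (ip u u * ip v v - ip u v ^+ 2) / ip u u); last by field.
by rewrite pmulr_lge0 ?invr_gt0// subr_ge0.
Qed.

Lemma ip_cauchy_sqrt u v : L2 u -> L2 v ->
  `|ip u v| <= Num.sqrt (ip u u) * Num.sqrt (ip v v).
Proof.
move=> Lu Lv; rewrite -sqrtrM ?ip_ge0// -sqrtr_sqr ler_wsqrtr//.
exact: ip_cauchy.
Qed.

Lemma ip_add_le u v : L2 u -> L2 v ->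
  ip (fun x => u x + v x) (fun x => u x + v x) <= 2 * ip u u + 2 * ip v v.
Proof.
move=> Lu Lv.
have e : (fun x => u x + v x) = (fun x => 1 * u x + v x).
  by apply/funext => x; rewrite mul1r.
have := ip_ge0 (fun x => (-1) * u x + v x).
rewrite e !ip_lin ?ip_linr//; try exact: L2_lin.
by rewrite (ip_sym v u) => ?; lra.
Qed.

Lemma ip_eq0 u : L2 u -> ip u u = 0 -> {ae mu, forall x, D x -> u x = 0}.
Proof.
move=> Lu u0.
have : (\int[mu]_(x in D) `|(u x * u x)%:E| = 0)%E.
  under eq_integral => x _ do rewrite gee0_abs ?lee_fin -?expr2 ?sqr_ge0//.
  under eq_integral => x _ do rewrite expr2.
  by rewrite Rintegral_EFin; [rewrite -[X in X%:E]/(ip u u) u0|exact: ip_integrable].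
move/ae_eq_integral_abs => /(_ mD).
have muu : measurable_fun D (EFin \o (fun x => u x * u x)).
  by apply/measurable_EFinP; case: Lu => *; exact: measurable_funM.
move=> /(_ muu); apply: filterS => x /[apply] -[/eqP].
by rewrite mulf_eq0 orbb => /eqP.
Qed.

(** The weighted squares 4^j (v_(j+1) - v_j)^2 have integrals at most 2^-j, so their sum G is
    integrable and finite almost everywhere. There |v_(j+1) - v_j| <= sqrt(G) 2^-j, which gives
    pointwise convergence with |w - v_j|^2 <= 4 G 4^-j, and integrating this bound yields L^2
    convergence. *)
Lemma riesz_fischer_fast (v : nat -> T -> R) :
  (forall j, L2 (v j)) ->
  (forall j, ip (fun x => v j.+1 x - v j x) (fun x => v j.+1 x - v j x) <= (8^-1) ^+ j) ->
  exists2 w, L2 w & exists C : R, forall j,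
    ip (fun x => w x - v j x) (fun x => w x - v j x) <= C * (4^-1) ^+ j.
Proof.
move=> Lv vfast.
have Ldiff i j : L2 (fun x => v i x - v j x).
  have := L2_lin (-1) (Lv j) (Lv i).
  by rewrite (_ : (fun x => -1 * _ + _) = (fun x => v i x - v j x))//; apply/funext => x; ring.
pose h j x := 4 ^+ j * (v j.+1 x - v j x) ^+ 2.
have h0 j x : 0 <= h j x by rewrite mulr_ge0 ?sqr_ge0// exprn_ge0.
have mh j : measurable_fun D (EFin \o h j).
  apply/measurable_EFinP; apply: measurable_funM => //.
  by apply: measurable_funX; case: (Ldiff j.+1 j).
have ih j : (\int[mu]_(x in D) (h j x)%:E <= (2^-1 ^+ j)%:E)%E.
  rewrite Rintegral_EFin; last by apply: intbleZ; case: (Ldiff j.+1 j).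
  rewrite lee_fin RintegralZl//; last by case: (Ldiff j.+1 j).
  apply: (@le_trans _ _ (4 ^+ j * (8^-1) ^+ j)).
    rewrite ler_wpM2l// ?exprn_ge0//; apply: le_trans (vfast j).
    by rewrite le_eqVlt; apply/orP; left; apply/eqP/eq_Rintegral => x _; rewrite expr2.
  by rewrite -exprMn (_ : 4 * 8^-1 = 2^-1)//; field.
pose G x := (\sum_(j <oo) (h j x)%:E)%E.
have mG : measurable_fun D G.
  have hE j x (_ : D x) (_ : xpredT j) : (0 <= (h j x)%:E)%E by rewrite lee_fin.
  exact: (@ge0_emeasurable_sum _ _ _ D (fun j x => (h j x)%:E) xpredT hE (fun j _ => mh j)).
have G0 x : (0 <= G x)%E by apply: nneseries_ge0 => j _ _; rewrite lee_fin.
have iG : (\int[mu]_(x in D) G x <= 2%:E)%E.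
  rewrite integral_nneseries//; last by move=> j x _; rewrite lee_fin.
  apply: lime_le; first by apply: is_cvg_nneseries => j _ _; apply: integral_ge0 => x _; rewrite lee_fin.
  apply: nearW => k.
  apply: (@le_trans _ _ (\sum_(0 <= j < k) (2^-1 ^+ j)%:E)%E); first exact: lee_sum.
  rewrite sumEFin lee_fin.
  have -> : \sum_(0 <= j < k) 2^-1 ^+ j = 2 - 2 * 2^-1 ^+ k :> R.
    elim: k => [|k IH]; first by rewrite big_nil expr0; ring.
    by rewrite big_nat_recr//= IH exprS; field.
  by rewrite gerBl mulr_ge0// exprn_ge0.
have intG : mu.-integrable D G.
  apply/integrableP; split => //; under eq_integral => x _ do rewrite gee0_abs//.
  by rewrite (le_lt_trans iG)// ltry.
pose g x := fine (G x).
have mg : measurable_fun D g by exact: (measurableT_comp (@fine_measurable R _ measurableT) mG).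
have ig : intble g.
  apply/integrableP; split.
    exact/measurable_EFinP.
  apply: le_lt_trans (integrable_lty mD intG).
  apply: ge0_le_integral => //.
  - by apply/measurable_EFinP; apply: measurableT_comp.
  - move=> x _; rewrite /= ger0_norm ?fine_ge0// /g.
    by have := G0 x; case: (G x) => //= _; rewrite leey.
have aeG : {ae mu, forall x, D x -> forall j, h j x <= g x}.
  apply: filterS (integrable_ae mD intG) => x /[apply] Gfin j.
  rewrite -lee_fin /g fineK//.
  have hE i (_ : (0 <= i)%N) (_ : xpredT i) : (0 <= (h i x)%:E)%E by rewrite lee_fin.
  apply: le_trans (@nneseries_lim_ge R (fun j => (h j x)%:E) xpredT 0%N j.+1 hE).
  by rewrite big_nat_recr//= leeDr// sume_ge0// => i _; rewrite lee_fin.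
have g0 x : 0 <= g x by rewrite fine_ge0.
have aelim : {ae mu, forall x, D x ->
    v j x @[j --> \oo] --> limn (fun j => v j x) /\
    forall j, (limn (fun j => v j x) - v j x) ^+ 2 <= 4 * g x * 4^-1 ^+ j}.
  apply: filterS aeG => x /[apply] hg.
  have := @geometric_cauchy R (fun j => v j x) (Num.sqrt (g x)).
  case.
    move=> j; rewrite -(ler_pXn2r (n := 2))// ?nnegrE ?mulr_ge0 ?sqrtr_ge0 ?exprn_ge0//.
    rewrite real_normK ?num_real// exprMn sqr_sqrtr// -exprM mulnC exprM.
    rewrite -[_ ^+ 2]mulr1 -(ler_pM2l (x := 4 ^+ j)) ?exprn_gt0//.
    have -> : 4 ^+ j * (g x * (2^-1 ^+ 2) ^+ j) = g x.
      by rewrite mulrCA -exprMn (_ : 4 * _ = 1) ?expr1n ?mulr1//; field.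
    by rewrite mulr1; exact: hg.
  move=> l vl Hl; rewrite (cvg_lim _ vl)//; split => // j.
  have := Hl j; rewrite -(ler_pXn2r (n := 2))// ?nnegrE ?mulr_ge0 ?sqrtr_ge0 ?exprn_ge0//.
  rewrite real_normK ?num_real// !exprMn sqr_sqrtr// -exprM mulnC exprM.
  by rewrite (_ : 2 ^+ 2 = 4); [rewrite (_ : 2^-1 ^+ 2 = 4^-1)//; field|ring].
pose w x := limn (fun j => v j x).
have mw : measurable_fun D w.
  apply: (@ae_measurable_cvg v); first by move=> j; case: (Lv j).
  by apply: filterS aelim => x /[apply] -[].
have Lwv j : L2 (fun x => w x - v j x) /\
    ip (fun x => w x - v j x) (fun x => w x - v j x) <= 4 * int g * 4^-1 ^+ j.
  have mwv : measurable_fun D (fun x => w x - v j x).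
    by apply: measurable_funB => //; case: (Lv j).
  have igj : intble (fun x => (4 * 4^-1 ^+ j) * g x) by exact: intbleZ.
  have iwv : intble (fun x => (w x - v j x) ^+ 2).
    apply: (ae_le_integrable _ igj); first exact: measurable_funX.
    apply: filterS aelim => x /[apply] -[_ /(_ j)].
    by rewrite ger0_norm ?sqr_ge0// mulrAC.
  split => //.
  rewrite [leRHS](_ : _ = 4 * 4^-1 ^+ j * int g); last by rewrite mulrAC.
  rewrite -RintegralZl//; apply: ae_le_Rintegral => //.
  apply: filterS aelim => x /[apply] -[_ /(_ j)].
  by rewrite -expr2 mulrAC.
exists w; last by exists (4 * int g) => j; exact: (Lwv j).2.
have := L2_lin 1 (Lwv 0%N).1 (Lv 0%N).
by rewrite (_ : (fun x => _) = w)//; apply/funext => x; ring.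
Qed.

Lemma riesz_fischer (s : nat -> T -> R) :
  (forall j, L2 (s j)) ->
  (forall e, 0 < e -> exists M, forall m m', (M <= m)%N -> (M <= m')%N ->
    ip (fun x => s m x - s m' x) (fun x => s m x - s m' x) <= e) ->
  exists2 w, L2 w & forall e, 0 < e -> exists M, forall m, (M <= m)%N ->
    ip (fun x => w x - s m x) (fun x => w x - s m x) <= e.
Proof.
move=> Ls cs.
have /choice [m mP] : forall j : nat, exists M, forall m m', (M <= m)%N -> (M <= m')%N ->
    ip (fun x => s m x - s m' x) (fun x => s m x - s m' x) <= 8^-1 ^+ j.
  by move=> j; apply: cs; rewrite exprn_gt0.
(* Partial sums of the m_i make the indices nondecreasing and at least m_j; the added j makes them
   tend to infinity. *)
pose M j := (\sum_(i < j.+1) m i + j)%N.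
have mM j : (m j <= M j)%N by rewrite /M big_ord_recr/= -addnA addnC -addnA leq_addr.
have MS j : (M j <= M j.+1)%N by rewrite [in leqRHS]/M big_ord_recr/= leq_add// leq_addr.
have [w Lw [C wC]] := @riesz_fischer_fast (fun j => s (M j)) (fun j => Ls _)
   (fun j => mP j _ _ (leq_trans (mM j) (MS j)) (mM j)).
exists w => // e e0.
(* [ip_add_le] doubles both squared distances, hence the quarter. *)
have [N0 HN0] := cs (e / 4) ltac:(by rewrite divr_gt0).
have g0 : (fun j => C * 4^-1 ^+ j) @ \oo --> (0 : R).
  by apply: cvg_geometric; rewrite gtr0_norm ?invr_gt0// invf_lt1 ?ltr1n.
have /cvgrPdist_le /(_ (e / 4)) := g0.
rewrite divr_gt0// => /(_ isT) [j0 _ Hj0].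
exists N0 => k Nk; pose j := maxn j0 N0.
have jN : ip (fun x => s (M j) x - s k x) (fun x => s (M j) x - s k x) <= e / 4.
  by apply: HN0 => //; rewrite (leq_trans (leq_maxr j0 _))// leq_addl.
have e1 : (fun x => w x - s k x) = (fun x => (w x - s (M j) x) + (s (M j) x - s k x)).
  by apply/funext => x; ring.
have Ld u v : L2 u -> L2 v -> L2 (fun x => u x - v x).
  move=> Lu Lv; have := L2_lin (-1) Lv Lu.
  by rewrite (_ : (fun x => -1 * _ + _) = (fun x => u x - v x))//; apply/funext => x; ring.
rewrite e1 (le_trans (ip_add_le (Ld _ _ Lw (Ls _)) (Ld _ _ (Ls _) (Ls _))))//.
have := wC j; have := Hj0 j (leq_maxl _ _); rewrite /= sub0r normrN ler_norml => /andP[_ h1 h2].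
by lra.
Qed.

End L2.
End ae_integrals.

(** * Lebesgue spaces on a set of finite measure *)

Section Lp_facts.
Context d (T : measurableType d) (R : realType).
Variables (mu : {measure set T -> \bar R}) (Omega : set T).
Hypothesis mO : measurable Omega.
Hypothesis fO : (mu Omega < +oo)%E.
Implicit Types (u v w z : T -> R).
Local Notation intble u := (mu.-integrable Omega (EFin \o u)).
Local Notation "'int' u" := (\int[mu]_(x in Omega) u x) (at level 36).

(* [gLp], and below [gHnorm2], [gHs], [gLDpow] and [gLF], are the definitions
   of the statement over an arbitrary measure space, convertible to them on
   [euclid]. *)
Definition gLp (p : \bar R) : seminormed R (T -> R) := {|
  carrier := [set u | measurable_fun Omega u /\
                      ('N[mu]_p[EFin \o (u \_ Omega)] < +oo)%E];
  snorm := fun u => fine 'N[mu]_p[EFin \o (u \_ Omega)]%E |}.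

Lemma intble_cst (c : R) : intble (cst c).
Proof.
apply: measurable_bounded_integrable => //.
by exists `|c|; split; [rewrite num_real|move=> M /ltW ? x _].
Qed.

Lemma Rint_cst (c : R) : int (cst c) = c * fine (mu Omega).
Proof. exact: Rintegral_cst. Qed.

Lemma LnormE (p : R) u : 0 < p ->
  ('N[mu]_p%:E[EFin \o (u \_ Omega)] =
   (\int[mu]_(x in Omega) (`|u x| `^ p)%:E) `^ p^-1)%E.
Proof.
move=> p0; rewrite Lnorm.unlock [in RHS]integral_mkcond.
apply: (congr1 (fun t => poweR t p^-1)); apply: eq_integral => x _.
rewrite /= /patch; case: ifPn => //= _.
by rewrite normr0 powR0// gt_eqF.
Qed.

Lemma measurable_norm_powR (p : R) u : measurable_fun Omega u ->
  measurable_fun Omega (fun x => `|u x| `^ p).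
Proof.
move=> mu'; apply: (measurableT_comp (measurable_powR _)).
exact: measurableT_comp.
Qed.

Lemma Lp_carrierP (p : R) u : 0 < p -> carrier (gLp p%:E) u <->
  measurable_fun Omega u /\ intble (fun x => `|u x| `^ p).
Proof.
move=> p0; rewrite /= LnormE//; split => -[mu' H]; split => //.
  apply: intble_lty.
  - exact: measurable_norm_powR.
  - move=> x; exact: powR_ge0.
  move: H => /(poweR_lty p).
  rewrite -poweRrM mulVf ?gt_eqF// poweRe1//.
  by apply: integral_ge0 => x _; rewrite lee_fin powR_ge0.
by apply: poweR_lty; exact: (integrable_lty mO H).
Qed.

Lemma Lp_snormE (p : R) u : 0 < p -> carrier (gLp p%:E) u ->
  snorm (gLp p%:E) u = (int (fun x => `|u x| `^ p)) `^ p^-1.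
Proof.
move=> p0 Lu; have [_ iu] := (Lp_carrierP u p0).1 Lu.
by rewrite /= LnormE// Rintegral_EFin.
Qed.

Lemma Lp_snorm_ge0 (p : \bar R) u : 0 <= snorm (gLp p) u.
Proof. by rewrite fine_ge0//; exact: Lnorm_ge0. Qed.

Lemma Lp_snorm_powR (p : R) u : 0 < p -> carrier (gLp p%:E) u ->
  snorm (gLp p%:E) u `^ p = int (fun x => `|u x| `^ p).
Proof.
move=> p0 Lu; rewrite Lp_snormE// -powRrM mulVf ?gt_eqF// powRr1//.
by apply: Rintegral_ge0 => x _; exact: powR_ge0.
Qed.

Lemma Lp_snorm_le (p k : R) u : 0 < p -> 0 <= k -> carrier (gLp p%:E) u ->
  (snorm (gLp p%:E) u <= k <-> int (fun x => `|u x| `^ p) <= k `^ p).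
Proof.
move=> p0 k0 Lu; rewrite -Lp_snorm_powR//; split => [h|].
  by apply: ge0_ler_powR; rewrite ?nnegrE ?Lp_snorm_ge0// ltW.
apply: contraTT; rewrite -!ltNge => h.
by apply: gt0_ltr_powR; rewrite ?nnegrE ?Lp_snorm_ge0.
Qed.

Lemma L2_carrierP u : carrier (gLp 2%:E) u <-> sq_integrable mu Omega u.
Proof.
have e : (fun x => `|u x| `^ 2) = (fun x => u x ^+ 2).
  by apply/funext => x; rewrite powR_mulrn// real_normK// num_real.
by rewrite Lp_carrierP// e.
Qed.

Lemma L2_snormE u : carrier (gLp 2%:E) u ->
  snorm (gLp 2%:E) u = Num.sqrt (dotp mu Omega u u).
Proof.
move=> Lu; rewrite Lp_snormE// powR12_sqrt; last first.
  by apply: Rintegral_ge0 => x _; exact: powR_ge0.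
congr Num.sqrt; apply: eq_Rintegral => x _.
by rewrite powR_mulrn// real_normK ?num_real// expr2.
Qed.

Lemma Loo_ae_bounded (k : R) u : carrier (gLp +oo%E) u ->
  snorm (gLp +oo%E) u <= k -> {ae mu, forall x, Omega x -> `|u x| <= k}.
Proof.
move=> [mu' ufin] /= uk.
(* The L^oo norm is given by the essential supremum only when the space has positive measure; on a
   null space everything holds almost everywhere. *)
have [m0|m0] := boolP (0 < mu [set: T])%E; last first.
  have Tneg : mu.-negligible [set: T].
    exists [set: T]; split => //; apply/eqP; rewrite eq_le measure_ge0 andbT.
    by rewrite leNgt.
  exact: negligibleS Tneg.
have : ('N[mu]_+oo[EFin \o (u \_ Omega)] <= k%:E)%E.
  move: uk ufin (Lnorm_ge0 mu +oo%E (EFin \o (u \_ Omega))).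
  by case: ('N[mu]_+oo[_])%E.
rewrite Lnorm.unlock m0 => /ess_supP; apply: filterS => x /= + Ox.
by rewrite /patch mem_set// lee_fin.
Qed.

(** For finite r, the elementary bound t^p <= t^r + 1 at t = |u|/k. Here k bounds the norm and has
    to be positive; [Lp_embed] recovers the norm itself by letting k decrease to it. *)
Lemma Lp_embed_pow (p k : R) (r : \bar R) u : 0 < p -> (p%:E <= r)%E -> 0 < k ->
  carrier (gLp r) u -> snorm (gLp r) u <= k ->
  intble (fun x => `|u x| `^ p) /\
  int (fun x => `|u x| `^ p) <= k `^ p * (fine (mu Omega) + 1).
Proof.
move=> p0; case: r => [r|_|//]; last first.
  move=> k0 Lu /(Loo_ae_bounded Lu) uk; have [mu' _] := Lu.
  have uk' : {ae mu, forall x, Omega x -> `|u x| `^ p <= k `^ p}.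
    apply: filterS uk => x /[apply] h.
    by apply: ge0_ler_powR; rewrite ?nnegrE// ltW.
  have iu : intble (fun x => `|u x| `^ p).
    apply: (ae_le_integrable mO (measurable_norm_powR p mu') (intble_cst (k `^ p))).
    by apply: filterS uk' => x /[apply] h; rewrite ger0_norm ?powR_ge0.
  split=> //; apply: (le_trans (ae_le_Rintegral mO iu (intble_cst (k `^ p)) uk')).
  by rewrite Rint_cst mulrDr mulr1 lerDl powR_ge0.
rewrite lee_fin => pr k0 Lu uk; have r0 : 0 < r := lt_le_trans p0 pr.
have [mu' iu] := (Lp_carrierP u r0).1 Lu.
have {}uk := (Lp_snorm_le r0 (ltW k0) Lu).1 uk.
have key x : `|u x| `^ p <= k `^ p * (k `^ r)^-1 * `|u x| `^ r + k `^ p.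
  have -> : k `^ p * (k `^ r)^-1 * `|u x| `^ r + k `^ p =
      k `^ p * ((`|u x| / k) `^ r + 1).
    rewrite powRM ?invr_ge0 ?(ltW k0)//.
    have -> : k^-1 `^ r = (k `^ r)^-1.
      by rewrite -powR_inv1 ?(ltW k0)// -powRrM mulN1r powRN.
    by ring.
  have -> : `|u x| `^ p = k `^ p * (`|u x| / k) `^ p.
    by rewrite -powRM ?(ltW k0) ?divr_ge0 ?(ltW k0)// mulrC divfK// gt_eqF.
  rewrite ler_wpM2l ?powR_ge0//.
  have [h|h] := leP (`|u x| / k) 1.
    rewrite (@le_trans _ _ 1)// ?lerDr ?powR_ge0//.
    apply: (@le_trans _ _ (1 `^ p)); last by rewrite powR1.
    by apply: ge0_ler_powR; rewrite ?nnegrE ?divr_ge0 ?(ltW k0) ?(ltW p0).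
  by rewrite (@le_trans _ _ ((`|u x| / k) `^ r))// ?lerDl// ler_powR// ltW.
have ig : intble (fun x => k `^ p * (k `^ r)^-1 * `|u x| `^ r + cst (k `^ p) x).
  by apply: intble_lin => //; exact: intble_cst.
have iup : intble (fun x => `|u x| `^ p).
  apply: (ae_le_integrable mO (measurable_norm_powR p mu') ig).
  by apply: aeW => x _; rewrite ger0_norm ?powR_ge0// key.
split=> //; apply: (@le_trans _ _ (int (fun x => k `^ p * (k `^ r)^-1 * `|u x| `^ r + cst (k `^ p) x))).
  by apply: le_Rintegral => // x _; exact: key.
rewrite Rintegral_lin//; last exact: intble_cst.
rewrite Rint_cst mulrDr mulr1 addrC lerD2l -mulrA ler_piMr ?powR_ge0//.
by rewrite ler_pdivrMl ?mulr1// powR_gt0.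
Qed.

Lemma Lp_embed (p : R) (r : \bar R) : 0 < p -> (p%:E <= r)%E ->
  exists2 C : R, 0 < C & forall u, carrier (gLp r) u ->
    carrier (gLp p%:E) u /\
    snorm (gLp p%:E) u <= C * snorm (gLp r) u.
Proof.
move=> p0 pr; pose C := (fine (mu Omega) + 1) `^ p^-1.
have M0 : 0 < fine (mu Omega) + 1 by rewrite ltr_wpDl// fine_ge0.
have C0 : 0 < C by rewrite powR_gt0.
exists C => // u Lu; have [mu' _] := Lu.
have Lpk k : 0 < k -> snorm (gLp r) u <= k ->
    carrier (gLp p%:E) u /\ snorm (gLp p%:E) u <= C * k.
  move=> k0 uk; have [iu ub] := Lp_embed_pow p0 pr k0 Lu uk.
  have Lpu : carrier (gLp p%:E) u by apply/Lp_carrierP.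
  split => //; apply/Lp_snorm_le => //; first by rewrite mulr_ge0// ltW.
  rewrite powRM ?(ltW C0) ?(ltW k0)// -powRrM mulVf ?gt_eqF// powRr1 ?(ltW M0)//.
  by rewrite mulrC.
split.
  have k1 : 0 < snorm (gLp r) u + 1 by rewrite ltr_wpDl// Lp_snorm_ge0.
  have k2 : snorm (gLp r) u <= snorm (gLp r) u + 1 by rewrite lerDl.
  by have [] := Lpk _ k1 k2.
apply/ler_addgt0Pl => e e0.
have eC : 0 < e / C by rewrite divr_gt0.
have k1 : 0 < snorm (gLp r) u + e / C by rewrite ltr_wpDl// Lp_snorm_ge0.
have k2 : snorm (gLp r) u <= snorm (gLp r) u + e / C by rewrite lerDl ltW.
have [_] := Lpk _ k1 k2.
by rewrite mulrDr [C * (_ / _)]mulrC divfK ?gt_eqF// addrC.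
Qed.

Lemma Lp_hoelder (p q : R) u v : 0 < p -> 0 < q -> p^-1 + q^-1 = 1 ->
  carrier (gLp p%:E) u -> carrier (gLp q%:E) v ->
  intble (fun x => u x * v x) /\
  `|dotp mu Omega u v| <= snorm (gLp p%:E) u * snorm (gLp q%:E) v.
Proof.
move=> p0 q0 pq [mu' Lu] [mv Lv].
have mRu : measurable_fun setT (u \_ Omega) by apply/(measurable_restrictT _ mO).1.
have mRv : measurable_fun setT (v \_ Omega) by apply/(measurable_restrictT _ mO).1.
have := hoelder mu mRu mRv p0 q0 pq.
have -> : ('N[mu]_1[EFin \o (u \_ Omega \* v \_ Omega)%R] =
    \int[mu]_(x in Omega) (`|u x * v x|)%:E)%E.
  rewrite Lnorm1 [RHS]integral_mkcond; apply: eq_integral => x _.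
  by rewrite /= /patch; case: ifPn => //= _; rewrite mul0r normr0.
have fin w t : ('N[mu]_t[EFin \o (w \_ Omega)] < +oo)%E ->
    ('N[mu]_t[EFin \o (w \_ Omega)] = (fine 'N[mu]_t[EFin \o (w \_ Omega)])%:E)%E.
  by move=> h; rewrite fineK// ge0_fin_numE// Lnorm_ge0.
rewrite (fin _ _ Lu) (fin _ _ Lv) -EFinM => H.
have iuv : intble (fun x => u x * v x).
  apply/integrableP; split; first exact/measurable_EFinP/measurable_funM.
  by apply: le_lt_trans H _; rewrite ltry.
split => //; apply: (le_trans (le_normr_Rintegral mO iuv)).
rewrite -lee_fin -Rintegral_EFin//; exact: integrable_norm.
Qed.

Lemma Lp_add (p : \bar R) u v : (1 <= p)%E ->
  carrier (gLp p) u -> carrier (gLp p) v ->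
  carrier (gLp p) (u + v) /\
  snorm (gLp p) (u + v) <= snorm (gLp p) u + snorm (gLp p) v.
Proof.
move=> p1 [mu' Lu] [mv Lv].
have mRu : measurable_fun setT (u \_ Omega) by apply/(measurable_restrictT _ mO).1.
have mRv : measurable_fun setT (v \_ Omega) by apply/(measurable_restrictT _ mO).1.
have := eminkowski mu mRu mRv p1.
rewrite (_ : (u \_ Omega \+ v \_ Omega)%R = (u + v) \_ Omega); last first.
  by apply/funext => x; rewrite /= /patch; case: ifPn => //; rewrite addr0.
move=> H.
have Luv : ('N[mu]_p[EFin \o ((u + v)%R \_ Omega)] < +oo)%E.
  by apply: le_lt_trans H _; exact: lte_add_pinfty.
split; first by split => //; exact: measurable_funD.
rewrite -lee_fin EFinD /= !fineK// ge0_fin_numE ?Lnorm_ge0//.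
Qed.

Lemma Lp_opp (p : \bar R) u : carrier (gLp p) u ->
  carrier (gLp p) (- u) /\ snorm (gLp p) (- u) = snorm (gLp p) u.
Proof.
move=> [mu' Lu].
have e : ('N[mu]_p[EFin \o ((- u)%R \_ Omega)] = 'N[mu]_p[EFin \o (u \_ Omega)])%E.
  rewrite -oppe_Lnorm; apply: eq_Lnorm => x /=.
  by rewrite /patch; case: ifPn => _ /=; rewrite ?oppr0 ?opprK.
by split; [split; [exact: measurable_funN|rewrite e]|rewrite /= e].
Qed.

(** Large values are replaced by 0 rather than by M, so that z - truncation M z equals z where |z| >
    M and vanishes elsewhere. *)
Definition truncation (M : R) z : T -> R := fun x => if `|z x| <= M then z x else 0.

Lemma measurable_truncation M z : measurable_fun Omega z ->
  measurable_fun Omega (truncation M z).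
Proof.
move=> mz.
have mb : measurable_fun Omega (fun x => `|z x| <= M).
  by apply: measurable_fun_ler => //; exact: measurableT_comp.
apply: (measurable_fun_if mO mb); last exact: measurable_cst.
apply: measurable_funS mz => //; exact: subIsetl.
Qed.

(** Where |z| > M one has |z|^p <= M^(p - r) |z|^r, so it suffices that M^(r - p) >= k^r / eps; the
    1 added keeps M positive. For r = +oo the tail vanishes almost everywhere as soon as M = k. *)
Lemma truncation_tail (p k eps : R) (r : \bar R) : 0 < p -> (p%:E < r)%E ->
  0 < k -> 0 < eps -> exists2 M : R, 0 < M & forall z,
    carrier (gLp r) z -> snorm (gLp r) z <= k ->
    intble (fun x => `|z x - truncation M z x| `^ p) /\
    int (fun x => `|z x - truncation M z x| `^ p) <= eps.
Proof.
move=> p0; case: r => [r|_|//]; last first.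
  move=> k0 e0; exists k => // z Lz zk; have zk' := Loo_ae_bounded Lz zk.
  have [mz _] := Lz.
  have mt : measurable_fun Omega (fun x => `|z x - truncation k z x| `^ p).
    apply: measurable_norm_powR; apply: measurable_funB => //.
    exact: measurable_truncation.
  have [] := @ae_eq_Rintegral _ _ _ mu Omega mO (cst 0) _ (intble_cst 0) mt.
    apply: filterS zk' => x /[apply] h; rewrite /truncation h subrr normr0 powR0//.
    by rewrite gt_eqF.
  by move=> ? <-; split => //; rewrite Rint_cst mul0r ltW.
rewrite lte_fin => pr k0 e0; have r0 : 0 < r := lt_trans p0 pr.
have rp0 : 0 < r - p by rewrite subr_gt0.
have B0 : 0 < k `^ r / eps + 1 by rewrite ltr_wpDl// divr_ge0 ?powR_ge0// ltW.
pose M := (k `^ r / eps + 1) `^ (r - p)^-1.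
have M0 : 0 < M by rewrite powR_gt0.
have MrE : M `^ (r - p) = k `^ r / eps + 1.
  by rewrite -powRrM mulVf ?gt_eqF// powRr1 ?ltW.
exists M => // z Lz zk; have [mz iz] := (Lp_carrierP z r0).1 Lz.
have {}zk := (Lp_snorm_le r0 (ltW k0) Lz).1 zk.
have mt : measurable_fun Omega (fun x => `|z x - truncation M z x| `^ p).
  apply: measurable_norm_powR; apply: measurable_funB => //.
  exact: measurable_truncation.
have key x : `|z x - truncation M z x| `^ p <= (M `^ (r - p))^-1 * `|z x| `^ r.
  rewrite /truncation; case: ifPn => h.
    by rewrite subrr normr0 powR0 ?gt_eqF// mulr_ge0 ?invr_ge0 ?powR_ge0.
  rewrite subr0 ler_pdivlMl ?powR_gt0//; move: h; rewrite -ltNge => h.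
  have z0 : 0 < `|z x| := lt_trans M0 h.
  have -> : `|z x| `^ r = `|z x| `^ (r - p) * `|z x| `^ p.
    by rewrite -powRD ?subrK// (gt_eqF z0) implybT.
  rewrite ler_wpM2r ?powR_ge0//.
  by apply: ge0_ler_powR; rewrite ?nnegrE// ltW.
have ig : intble (fun x => (M `^ (r - p))^-1 * `|z x| `^ r) by exact: intbleZ.
have it : intble (fun x => `|z x - truncation M z x| `^ p).
  apply: (ae_le_integrable mO mt ig).
  by apply: aeW => x _; rewrite ger0_norm ?powR_ge0// key.
split => //; apply: (le_trans (le_Rintegral mO it ig (fun x _ => key x))).
rewrite RintegralZl// ler_pdivrMl ?powR_gt0// MrE.
apply: (le_trans zk); rewrite mulrDl mul1r divfK ?gt_eqF// lerDl ltW//.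
Qed.

End Lp_facts.

(** * Superposition operators *)

Section superposition.
Context d (T : measurableType d) (R : realType).
Variables (mu : {measure set T -> \bar R}) (Omega : set T).
Hypothesis mu_complete : measure_is_complete mu.
Hypothesis mO : measurable Omega.
Variable f : T -> R -> R.
Hypothesis mf : forall t, measurable_fun Omega (f ^~ t).
Implicit Types (u : T -> R).

(** With u rounded down to a multiple of 1/(m+1), Omega splits into countably many measurable pieces
    on which the argument of f is constant; there [mf] applies. *)
Lemma measurable_superposition_step u (m : nat) : measurable_fun Omega u ->
  measurable_fun Omega
    (fun x => f x ((Num.floor (u x * m.+1%:R))%:~R / m.+1%:R)).
Proof.
move=> mu' _ B mB.
rewrite (_ : Omega `&` _ = \bigcup_(z in [set: int])
  ((Omega `&` u @^-1` `[z%:~R / m.+1%:R, (z + 1)%:~R / m.+1%:R[%classic) `&`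
   (Omega `&` (f ^~ (z%:~R / m.+1%:R)) @^-1` B))); last first.
  have m0 : 0 < m.+1%:R :> R by [].
  apply/seteqP; split => x /=.
    move=> [Ox Bx]; exists (Num.floor (u x * m.+1%:R)) => //; split => //; split => //=.
    by rewrite in_itv/= ler_pdivrMr// ltr_pdivlMr// floor_le_tmp floorD1_gt.
  move=> [z _ [[_]]] /=; rewrite in_itv/= ler_pdivrMr// ltr_pdivlMr// => zu [Ox Bx].
  by split => //; rewrite (_ : Num.floor _ = z)//; exact: floor_def.
apply: countable_bigcupT_measurable => // z; apply: measurableI.
  exact: mu'.
exact: mf.
Qed.

Lemma measurable_superposition u :
  {ae mu, forall x, Omega x -> continuous (f x)} ->
  measurable_fun Omega u -> measurable_fun Omega (fun x => f x (u x)).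
Proof.
move=> cf mu'.
apply: (@ae_measurable_cvg _ _ _ mu Omega mu_complete
   (fun m x => f x ((Num.floor (u x * m.+1%:R))%:~R / m.+1%:R))).
  by move=> m; exact: measurable_superposition_step.
apply: filterS cf => x /[apply] cfx.
apply: (@cvg_comp _ _ _ _ (f x) _ (nbhs (u x))); last exact: cfx.
apply/cvgrPdist_lt => e e0.
near=> m.
have m0 : 0 < m.+1%:R :> R by [].
have h1 : (Num.floor (u x * m.+1%:R))%:~R / m.+1%:R <= u x.
  by rewrite ler_pdivrMr// floor_le_tmp.
have h2 : u x < (Num.floor (u x * m.+1%:R))%:~R / m.+1%:R + m.+1%:R^-1.
  rewrite -[X in _ + X]mul1r -mulrDl ltr_pdivlMr//.
  by have := floorD1_gt (u x * m.+1%:R); rewrite intrD.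
rewrite ger0_norm ?subr_ge0//.
have h3 : m.+1%:R^-1 < e by near: m; exact: near_infty_natSinv_lt (PosNum e0).
by rewrite ltrBlDl; apply: (lt_trans h2); rewrite ltrD2l.
Unshelve. all: by end_near. Qed.

Lemma measurable_primitive_superposition u :
  {ae mu, forall x, Omega x ->
    [/\ {homo f x : t t' / t <= t'}, continuous (f x) & f x 0 = 0]} ->
  measurable_fun Omega u ->
  measurable_fun Omega
    (fun x => \int[lebesgue_measure]_(tau in `[0, `|u x|]%classic) f x tau).
Proof.
move=> nice mu'.
have cf : {ae mu, forall x, Omega x -> continuous (f x)}.
  by apply: filterS nice => x /[apply] -[].
have mnu : measurable_fun Omega (fun x => `|u x|) by exact: measurableT_comp.
apply: (@ae_measurable_cvg _ _ _ mu Omega mu_complete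
   (fun m x => \sum_(i < m.+1) `|u x| / m.+1%:R * f x (`|u x| / m.+1%:R * i%:R))).
  move=> m; apply: measurable_sum => i.
  have mum : measurable_fun Omega (fun x => `|u x| / m.+1%:R).
    by apply: measurable_funM => //; exact: measurable_cst.
  apply: measurable_funM => //; apply: measurable_superposition => //.
  by apply: measurable_funM => //; exact: measurable_cst.
apply: filterS nice => x /[apply] -[fnd _ f0].
apply/cvgrPdist_le => e e0; near=> m.
have /andP[h1 h2] := riemann_sum_bound fnd m (normr_ge0 (u x)) f0.
rewrite ger0_norm ?subr_ge0//.
have : `|u x| / m.+1%:R * f x `|u x| <= e.
  rewrite mulrAC ler_pdivrMr// -ler_pdivrMl// mulrC.
  near: m; exists (Num.truncn (`|u x| * f x `|u x| / e)).+1 => // m /= hm.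
  have := ltW (truncnS_gt (`|u x| * f x `|u x| / e)).
  by move/le_trans; apply; rewrite ler_nat leqW.
by move=> h; rewrite lerBlDl; apply: (le_trans _ (lerD (lexx _) h)); rewrite -lerBlDr.
Unshelve. all: by end_near. Qed.

End superposition.

(** * Orlicz functions and the Luxemburg functional *)

(** The pointwise facts about f(x, .) and F(x, .) that are integrated below. [orlicz_dilate] is
    Delta_2, [orlicz_contract] is superlinear growth, [orlicz_shrink] stands in for convexity and
    [orlicz_pairing] for Young's inequality. *)
Record orlicz_pair (R : realType) (c1 c2 : R) (f F : R -> R) : Prop := {
  orlicz_ge0 : forall t, 0 <= F t ;
  orlicz_homo : forall t t', `|t| <= `|t'| -> F t <= F t' ;
  orlicz_dilate : forall j lam t, 0 <= lam -> (1 - c1 / 2) ^+ j * lam <= 1 ->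
    F (lam * t) <= lam * (c1 / 2) ^- j / c1 * F t ;
  orlicz_contract : forall j t, F ((c2 / 2) ^+ j * t) <=
    (1 - c2 / 2) ^+ j / c1 * (c2 / 2) ^+ j * F t ;
  orlicz_shrink : forall r t, 1 <= r -> F (t / r) <= (c1 * r)^-1 * F t ;
  orlicz_pairing : forall t v, `|f t * v| <= c1^-1 * (F t + F v) ;
  orlicz_le : forall t, F t <= f t * t }.

Section luxemburg.
Context d (T : measurableType d) (R : realType).
Variables (mu : {measure set T -> \bar R}) (Omega : set T).
Hypothesis mO : measurable Omega.
Variables (f F : T -> R -> R) (c1 c2 : R).
Hypotheses (c1P : 0 < c1 <= 1) (c2P : 0 < c2 <= 1).
Hypothesis fF : {ae mu, forall x, Omega x -> orlicz_pair c1 c2 (f x) (F x)}.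
Hypothesis F_even : forall x t, F x (- t) = F x t.
Hypothesis mf : forall u, measurable_fun Omega u ->
  measurable_fun Omega (fun x => f x (u x)).
Hypothesis mF : forall u, measurable_fun Omega u ->
  measurable_fun Omega (fun x => F x (u x)).
Implicit Types (u v w : T -> R).
Local Notation intble u := (mu.-integrable Omega (EFin \o u)).
Local Notation "'int' u" := (\int[mu]_(x in Omega) u x) (at level 36).

Definition gLF : seminormed R (T -> R) := {|
  carrier := [set u | measurable_fun Omega u /\
                      mu.-integrable Omega (fun x => (F x (u x))%:E)];
  snorm := fun u => inf [set k : R | 0 < k /\
    (\int[mu]_(x in Omega) (F x (u x / k))%:E <= 1)%E] |}.

Local Notation LF := (carrier gLF).
Definition modular u : R := int (fun x => F x (u x)).
Local Notation rho := modular.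

Lemma LF_intble u : LF u -> intble (fun x => F x (u x)).
Proof. by case. Qed.

Lemma modular_ge0 u : LF u -> 0 <= rho u.
Proof.
move=> Lu; have i0 : intble (fun x => 0 * F x (u x)) by apply: intbleZ => //; exact: LF_intble.
have -> : 0 = int (fun x => 0 * F x (u x)).
  by rewrite RintegralZl ?mul0r//; exact: LF_intble.
apply: ae_le_Rintegral => //; first exact: LF_intble.
by apply: filterS fF => x /[apply] H; rewrite mul0r; exact: (orlicz_ge0 H).
Qed.

Lemma modular_le (k : R) u v : measurable_fun Omega u -> LF v ->
  {ae mu, forall x, Omega x -> F x (u x) <= k * F x (v x)} ->
  LF u /\ rho u <= k * rho v.
Proof.
move=> mu' Lv uv.
have iv : intble (fun x => k * F x (v x)) by apply: intbleZ => //; exact: LF_intble.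
have iu : intble (fun x => F x (u x)).
  apply: (ae_le_integrable mO (mF mu') iv).
  apply: filterS2 fF uv => x H' + Ox => /(_ Ox); have H := H' Ox.
  by rewrite ger0_norm//; exact: (orlicz_ge0 H).
split; first by split.
by rewrite -RintegralZl; [exact: ae_le_Rintegral|exact: mO|exact: LF_intble].
Qed.

Lemma measurable_scale (k : R) u : measurable_fun Omega u ->
  measurable_fun Omega (fun x => k * u x).
Proof. by move=> mu'; apply: measurable_funM => //; exact: measurable_cst. Qed.

Lemma exists_expr_le (th B e : R) : 0 <= th < 1 -> 0 < e -> exists j, th ^+ j * B <= e.
Proof.
move=> /andP[th0 th1] e0.
have g0 : (fun j => B * th ^+ j) @ \oo --> (0 : R).
  by apply: cvg_geometric; rewrite ger0_norm.
have /cvgrPdist_le /(_ e e0) [j _ /(_ j (leqnn _))] := g0.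
by rewrite /= sub0r normrN => h; exists j; rewrite mulrC (le_trans (ler_norm _)).
Qed.

Lemma modular_dilate (lam : R) : exists2 K : R, 0 < K & forall u, LF u ->
  LF (fun x => lam * u x) /\ rho (fun x => lam * u x) <= K * rho u.
Proof.
have /andP[c10 c11] := c1P; pose L := `|lam| + 1.
have L0 : 0 < L by rewrite ltr_wpDl.
(* Enough doublings to undo the dilation L; the 1 in L keeps K positive when lam = 0. *)
have [j jL] := @exists_expr_le (1 - c1 / 2) L 1 ltac:(apply/andP; split; lra) ltr01.
pose K := L * (c1 / 2) ^- j / c1.
have K0 : 0 < K by rewrite !mulr_gt0// invr_gt0// exprn_gt0//; lra.
exists K => // u Lu; apply: modular_le => //.
  by apply: measurable_scale; case: Lu.
apply: filterS fF => x /[apply] H.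
apply: le_trans (orlicz_dilate H (u x) (ltW L0) jL).
apply: (orlicz_homo H); rewrite !normrM ler_wpM2r// (gtr0_norm L0).
by rewrite lerDl.
Qed.

Lemma LF_scale (lam : R) u : LF u -> LF (fun x => lam * u x).
Proof. by move=> Lu; have [K _ /(_ u Lu) []] := modular_dilate lam. Qed.

(** A sum is at most twice its larger term, and F is monotone in the absolute value, so F(w) is
    bounded by the larger of F(2 k1 u) and F(2 k2 v), hence by their sum. *)
Lemma LF_sum (k1 k2 : R) u v w : measurable_fun Omega w -> LF u -> LF v ->
  (forall x, `|w x| <= k1 * `|u x| + k2 * `|v x|) -> 0 < k1 -> 0 < k2 ->
  LF w /\ rho w <= rho (fun x => 2 * k1 * u x) + rho (fun x => 2 * k2 * v x).
Proof.
move=> mw Lu Lv wuv k10 k20.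
have iu := LF_intble (LF_scale (2 * k1) Lu).
have iv := LF_intble (LF_scale (2 * k2) Lv).
have bd : {ae mu, forall x, Omega x ->
    F x (w x) <= F x (2 * k1 * u x) + F x (2 * k2 * v x)}.
  apply: filterS fF => x /[apply] H.
  have p1 := orlicz_ge0 H (2 * k1 * u x); have p2 := orlicz_ge0 H (2 * k2 * v x).
  have [h|h] := leP (k1 * `|u x|) (k2 * `|v x|).
    apply: (@le_trans _ _ (F x (2 * k2 * v x))); last by rewrite lerDr.
    apply: (orlicz_homo H); rewrite !normrM (gtr0_norm k20) ger0_norm//.
    by have := wuv x; lra.
  apply: (@le_trans _ _ (F x (2 * k1 * u x))); last by rewrite lerDl.
  apply: (orlicz_homo H); rewrite !normrM (gtr0_norm k10) ger0_norm//.
  by have := wuv x; lra.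
have iw : intble (fun x => F x (w x)).
  apply: (ae_le_integrable mO (mF mw) (intbleD mO iu iv)).
  apply: filterS2 fF bd => x H' + Ox => /(_ Ox); have H := H' Ox.
  by rewrite ger0_norm//; exact: (orlicz_ge0 H).
split; first by split.
by rewrite -RintegralD//; apply: ae_le_Rintegral => //; exact: intbleD.
Qed.

Lemma LF_lin (k : R) u v : LF u -> LF v -> LF (fun x => k * u x + v x).
Proof.
move=> Lu Lv; have Lku := LF_scale k Lu.
have mw : measurable_fun Omega (fun x => k * u x + v x).
  by apply: measurable_funD; [case: Lku|case: Lv].
have [] // := @LF_sum 1 1 _ _ _ mw Lku Lv _ ltr01 ltr01.
by move=> x; rewrite !mul1r ler_normD.
Qed.

Lemma luxemburg_setE u (k : R) : LF u -> 0 < k ->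
  ((\int[mu]_(x in Omega) (F x (u x / k))%:E <= 1)%E <->
   rho (fun x => k^-1 * u x) <= 1).
Proof.
move=> Lu k0.
rewrite (eq_integral (fun x => (F x (k^-1 * u x))%:E)); last first.
  by move=> x _; rewrite mulrC.
by rewrite Rintegral_EFin ?lee_fin//; exact: LF_intble (LF_scale _ Lu).
Qed.

Lemma luxemburg_le u (k : R) : LF u -> 0 < k ->
  rho (fun x => k^-1 * u x) <= 1 -> snorm gLF u <= k.
Proof.
move=> Lu k0 H; apply: ge_inf; last by split => //; exact/luxemburg_setE.
by exists 0 => x [/ltW].
Qed.

Lemma luxemburg_nonempty u : LF u ->
  exists2 k : R, 0 < k & rho (fun x => k^-1 * u x) <= 1.
Proof.
(* [orlicz_shrink] gives rho(u/r) <= rho(u) / (c1 r), and c1 r = rho(u) + c1. *)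
move=> Lu; have /andP[c10 _] := c1P; pose r := rho u / c1 + 1.
have ru := modular_ge0 Lu.
have r1 : 1 <= r by rewrite lerDr divr_ge0// ltW.
have r0 : 0 < r by lra.
exists r => //.
have [] := @modular_le (c1 * r)^-1 (fun x => r^-1 * u x) u _ Lu.
- by apply: measurable_scale; case: Lu.
- apply: filterS fF => x /[apply] H; rewrite mulrC; exact: (orlicz_shrink H).
move=> _ /le_trans; apply.
rewrite ler_pdivrMl ?mulr_gt0// mulr1 /r mulrDr mulr1 mulrC divfK ?gt_eqF//.
by rewrite lerDl ltW.
Qed.

Lemma luxemburg_ge0 u : LF u -> 0 <= snorm gLF u.
Proof.
move=> Lu; have [k k0 H] := luxemburg_nonempty Lu.
apply: lb_le_inf; last by move=> x [/ltW].
by exists k; split => //; exact/luxemburg_setE.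
Qed.

Lemma luxemburg_lt u (k : R) : LF u -> snorm gLF u < k ->
  exists2 k', 0 < k' < k & rho (fun x => k'^-1 * u x) <= 1.
Proof.
move=> Lu uk; have [k0 k00 H0] := luxemburg_nonempty Lu.
have hi : [set k : R | 0 < k /\
    (\int[mu]_(x in Omega) (F x (u x / k))%:E <= 1)%E] !=set0.
  by exists k0; split => //; exact/luxemburg_setE.
have [k' [k'0 /luxemburg_setE H] k'k] := inf_lt hi uk.
by exists k'; [rewrite k'0|exact: H].
Qed.

Lemma luxemburg_scale_le u (lam : R) : LF u -> 0 < lam ->
  snorm gLF (fun x => lam * u x) <= lam * snorm gLF u.
Proof.
move=> Lu l0; apply/ler_addgt0Pl => e e0.
have el : 0 < e / lam by rewrite divr_gt0.
have [k /andP[k0 kl] H] := luxemburg_lt Lu (ltr_pwDr el (lexx (snorm gLF u))).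
apply: (@le_trans _ _ (lam * k)).
  apply: luxemburg_le; [exact: LF_scale|by rewrite mulr_gt0|].
  rewrite (_ : (fun x => _) = (fun x => k^-1 * u x))//.
  by apply/funext => x; field; rewrite !gt_eqF.
have := ltW kl; rewrite -(ler_pM2l l0) => /le_trans; apply.
by rewrite mulrDr [lam * (e / lam)]mulrC divfK ?gt_eqF// addrC.
Qed.

Lemma luxemburg_opp u : snorm gLF (- u) = snorm gLF u.
Proof.
congr inf; apply/funext => k /=; congr (_ /\ _).
by under eq_integral => x _ do rewrite /= mulNr F_even.
Qed.

(** Enough contractions make the gain (1 - c2/2)^j / c1 at most e; de is the resulting factor
    (c2/2)^j. *)
Lemma modular_contract (e : R) : 0 < e -> exists2 de : R, 0 < de <= 1 &
  forall u, LF u -> rho (fun x => de * u x) <= e * de * rho u.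
Proof.
move=> e0; have /andP[c10 c11] := c1P; have /andP[c20 c21] := c2P.
have [j je] := @exists_expr_le (1 - c2 / 2) c1^-1 e ltac:(apply/andP; split; lra) e0.
exists ((c2 / 2) ^+ j).
  by rewrite exprn_gt0 ?exprn_ile1//; lra.
move=> u Lu.
have [] // := @modular_le (e * (c2 / 2) ^+ j) (fun x => (c2 / 2) ^+ j * u x) u _ Lu.
  by apply: measurable_scale; case: Lu.
apply: filterS fF => x /[apply] H; apply: (le_trans (orlicz_contract H j (u x))).
rewrite ler_wpM2r ?(orlicz_ge0 H)// ler_wpM2r// exprn_ge0//; lra.
Qed.

(** The scaled sum is dominated by (de/2)|u|/k + (de/2)|v|/l, where u/k and v/l have modular at most
    1; [LF_sum] doubles the coefficients, and [modular_contract] at 1/2 bounds each modular by de/2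
    <= 1/2. Hence the constant 2/de. *)
Lemma luxemburg_quasi_triangle : exists2 C : R, 0 < C & forall u v, LF u -> LF v ->
  snorm gLF (fun x => u x + v x) <= C * (snorm gLF u + snorm gLF v).
Proof.
have e0 : 0 < 2^-1 :> R by [].
have [de /andP[d0 d1] Hd] := modular_contract e0.
exists (2 / de); first by rewrite divr_gt0.
move=> u v Lu Lv; set C := 2 / de.
have C0 : 0 < C by rewrite divr_gt0.
apply/ler_addgt0Pl => e e1.
have eC : 0 < e / C / 2 by rewrite !divr_gt0.
have [k /andP[k0 kl] Hk] := luxemburg_lt Lu (ltr_pwDr eC (lexx (snorm gLF u))).
have [l /andP[l0 ll] Hl] := luxemburg_lt Lv (ltr_pwDr eC (lexx (snorm gLF v))).
have Luv : LF (fun x => u x + v x).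
  by have := LF_lin 1 Lu Lv; rewrite (_ : (fun x => _) = (fun x => u x + v x))//; apply/funext => x; rewrite mul1r.
have kl0 : 0 < C * (k + l) by rewrite mulr_gt0// addr_gt0.
apply: (@le_trans _ _ (C * (k + l))); last first.
  have : k + l <= e / C + (snorm gLF u + snorm gLF v) by lra.
  by rewrite -(ler_pM2l C0) => /le_trans; apply; rewrite mulrDr [C * (e / C)]mulrC divfK ?gt_eqF.
apply: luxemburg_le => //.
have Lku := LF_scale k^-1 Lu; have Llv := LF_scale l^-1 Lv.
have mw : measurable_fun Omega (fun x => (C * (k + l))^-1 * (u x + v x)).
  by apply: measurable_scale; case: Luv.
have d2 : 0 < de / 2 by rewrite divr_gt0.
have [|_] := @LF_sum (de / 2) (de / 2) _ _ _ mw Lku Llv _ d2 d2.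
  move=> x; rewrite !normrM !normfV (gtr0_norm kl0) (gtr0_norm k0) (gtr0_norm l0).
  have -> : (C * (k + l))^-1 = de / 2 * (k + l)^-1.
    by rewrite /C; field; rewrite !gt_eqF// addr_gt0.
  rewrite -mulrDr -[X in X <= _]mulrA ler_wpM2l ?(ltW d2)//.
  rewrite ler_pdivrMl ?addr_gt0// mulrDr.
  apply: (le_trans (ler_normD _ _)); apply: lerD.
    by rewrite mulrA ler_peMl// mulrDl divff ?gt_eqF// lerDl divr_ge0// ltW.
  by rewrite mulrA ler_peMl// mulrDl divff ?gt_eqF// lerDr divr_ge0// ltW.
move=> /le_trans; apply.
have -> : 2 * (de / 2) = de by field.
have h1 : rho (fun x => de * (k^-1 * u x)) <= 2^-1 * de * 1.
  by apply: (le_trans (Hd _ Lku)); rewrite ler_wpM2l// mulr_ge0// ltW.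
have h2 : rho (fun x => de * (l^-1 * v x)) <= 2^-1 * de * 1.
  by apply: (le_trans (Hd _ Llv)); rewrite ler_wpM2l// mulr_ge0// ltW.
by lra.
Qed.

Lemma nemytskii_integrable u v : LF u -> LF v ->
  intble (fun x => f x (u x) * v x) /\
  `|int (fun x => f x (u x) * v x)| <= c1^-1 * (rho u + rho v).
Proof.
move=> Lu Lv; have [mu' _] := Lu; have [mv _] := Lv.
have iuv := intbleD mO (LF_intble Lu) (LF_intble Lv).
have ig := intbleZ mO c1^-1 iuv.
have mfuv : measurable_fun Omega (fun x => f x (u x) * v x).
  by apply: measurable_funM => //; exact: mf.
have bd : {ae mu, forall x, Omega x ->
    `|f x (u x) * v x| <= c1^-1 * (F x (u x) + F x (v x))}.
  by apply: filterS fF => x /[apply] H; exact: (orlicz_pairing H).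
have ifuv := ae_le_integrable mO mfuv ig bd.
split => //; apply: (le_trans (le_normr_Rintegral mO ifuv)).
rewrite -RintegralD; [|exact: mO|exact: LF_intble|exact: LF_intble].
rewrite -RintegralZl//; apply: ae_le_Rintegral => //; exact: integrable_norm.
Qed.

(** Once v is rescaled to modular at most 1, the pairing is bounded by the constant (rho u + 1) /
    c1, and rescaling back makes the bound linear in the norm. *)
Lemma nemytskii_bounded u : LF u -> exists2 C : R, 0 < C & forall v, LF v ->
  `|int (fun x => f x (u x) * v x)| <= C * snorm gLF v.
Proof.
move=> Lu; have /andP[c10 _] := c1P.
have ru := modular_ge0 Lu.
exists (c1^-1 * (rho u + 1)).
  by rewrite mulr_gt0 ?invr_gt0// ltr_wpDl.
set C := c1^-1 * _ => v Lv.
have C0 : 0 < C by rewrite mulr_gt0 ?invr_gt0// ltr_wpDl.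
apply/ler_addgt0Pl => e e0.
have eC : 0 < e / C by rewrite divr_gt0.
have [k /andP[k0 kl] Hk] := luxemburg_lt Lv (ltr_pwDr eC (lexx (snorm gLF v))).
have Lkv := LF_scale k^-1 Lv.
have [ifuv H] := nemytskii_integrable Lu Lkv.
have -> : int (fun x => f x (u x) * v x) = k * int (fun x => f x (u x) * (k^-1 * v x)).
  rewrite -RintegralZl//; apply: eq_Rintegral => x _.
  by rewrite mulrCA mulVKf// gt_eqF.
rewrite normrM (gtr0_norm k0).
apply: (@le_trans _ _ (k * C)).
  rewrite ler_wpM2l ?(ltW k0)//; apply: (le_trans H).
  by rewrite ler_wpM2l ?invr_ge0 ?(ltW c10)// lerD2l.
rewrite [k * C]mulrC; have := ler_wpM2l (ltW C0) (ltW kl) => /le_trans; apply.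
by rewrite mulrDr [C * (e / C)]mulrC divfK ?gt_eqF// addrC.
Qed.

Lemma modular_le_nemytskii u : LF u -> rho u <= int (fun x => f x (u x) * u x).
Proof.
move=> Lu; have [ifu _] := nemytskii_integrable Lu Lu.
apply: ae_le_Rintegral => //; first exact: LF_intble.
by apply: filterS fF => x /[apply] H; exact: (orlicz_le H).
Qed.

(* Superlinearity of the modular, a consequence of [orlicz_contract]. *)
Lemma luxemburg_le_modular (e : R) : 0 < e -> exists2 C : R, 0 < C & forall u, LF u ->
  snorm gLF u <= e * rho u + C.
Proof.
move=> e0; have /andP[c10 c11] := c1P.
(* The factor c1 cancels the 1/c1 of [orlicz_shrink]. *)
have ec : 0 < e * c1 by rewrite mulr_gt0.
have [de /andP[d0 d1] Hd] := modular_contract ec.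
exists (de^-1); first by rewrite invr_gt0.
move=> u Lu; have ru := modular_ge0 Lu.
have Ldu := LF_scale de Lu.
have [h|h] := leP (e * de * rho u) 1.
  apply: (@le_trans _ _ de^-1); last by rewrite lerDr mulr_ge0// ltW.
  apply: luxemburg_le => //; first by rewrite invr_gt0.
  rewrite invrK; apply: (le_trans (Hd _ Lu)).
  apply: le_trans h; rewrite ler_wpM2r// ler_wpM2r ?(ltW d0)//.
  by rewrite ler_piMr// ltW.
(* Otherwise de u is divided further by r > 1: its modular is at most e c1 de rho(u) = c1 r, so
   [orlicz_shrink] brings it down to 1, and the norm is at most r / de = e rho(u). *)
set r := e * de * rho u in h *; have r0 : 0 < r by lra.
apply: (@le_trans _ _ (r / de)); last first.
  rewrite /r mulrAC mulfK ?gt_eqF// lerDl invr_ge0 ltW//.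
apply: luxemburg_le => //; first by rewrite divr_gt0.
have [] := @modular_le (c1 * r)^-1 (fun x => (r / de)^-1 * u x) (fun x => de * u x) _ Ldu.
- by apply: measurable_scale; case: Lu.
- apply: filterS fF => x /[apply] H.
  rewrite (_ : (r / de)^-1 * u x = de * u x / r); last by rewrite invf_div mulrAC.
  by apply: (orlicz_shrink H); exact: ltW.
have cr0 : 0 < c1 * r := mulr_gt0 c10 r0.
move=> _ /le_trans; apply; rewrite ler_pdivrMl// mulr1.
by apply: (le_trans (Hd _ Lu)); rewrite /r le_eqVlt; apply/orP; left; apply/eqP; ring.
Qed.

(** Delta_2 for the dilation 1/e: a modular at most 1/K makes that of u/e at most 1. *)
Lemma luxemburg_small (e : R) : 0 < e -> exists2 eta : R, 0 < eta & forall u, LF u ->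
  rho u <= eta -> snorm gLF u <= e.
Proof.
move=> e0; have [K K0 HK] := modular_dilate e^-1.
exists (K^-1); first by rewrite invr_gt0.
move=> u Lu ru; apply: luxemburg_le => //.
have [_ /le_trans] := HK _ Lu; apply.
by rewrite -ler_pdivlMl// mulr1.
Qed.

End luxemburg.

(** * Spectral fractional spaces *)

Lemma le_sqrtM_sqr (R : rcfType) (x a b ha hb : R) : 0 <= ha -> 0 <= hb ->
  a = ha ^+ 2 -> b = hb ^+ 2 -> `|x| <= Num.sqrt a * Num.sqrt b -> `|x| <= ha * hb.
Proof. by move=> a0 b0 -> ->; rewrite !sqrtr_sqr (ger0_norm a0) (ger0_norm b0). Qed.

(* Polarization of [x = ||u + v||], with [su] the value of the form at
   (u + v, u), and so on. *)
Lemma triangle_sqr (R : realFieldType) (ss su sv us uu uv vs vu vv x a b : R) :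
  ss = 1 * su + sv -> us = 1 * uu + uv -> vs = 1 * vu + vv ->
  su = us -> sv = vs -> vu = uv -> ss = x ^+ 2 -> uu = a ^+ 2 -> vv = b ^+ 2 ->
  `|uv| <= a * b -> 0 <= a -> 0 <= b -> 0 <= x -> x <= a + b.
Proof.
move=> e1 e2 e3 e4 e5 e6 e7 e8 e9 le a0 b0 x0.
rewrite -(ler_pXn2r (n := 2))// ?nnegrE ?addr_ge0//.
have := le_trans (ler_norm _) le; rewrite -e7 e1 e4 e5 e2 e3 e6 e8 e9 sqrrD mulr2n.
by move: (a * b) (a ^+ 2) (b ^+ 2) => *; lra.
Qed.

Lemma eq_cvg_unique (R : realType) (x y : R^nat) (a b : R) :
  x @ \oo --> a -> y @ \oo --> b -> (forall m, x m = y m) -> a = b.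
Proof.
move=> xa yb xy; rewrite -(cvg_lim _ xa)// -(cvg_lim _ yb)//.
by rewrite (_ : x = y)//; exact/funext.
Qed.

Section spectral.
Context d (T : measurableType d) (R : realType).
Variables (mu : {measure set T -> \bar R}) (Omega : set T).
Hypothesis mO : measurable Omega.
Hypothesis mu_complete : measure_is_complete mu.
Hypothesis fO : (mu Omega < +oo)%E.
Variables (lam : nat -> R) (phi : nat -> T -> R).
Local Notation L2 := (sq_integrable mu Omega).
Local Notation ip := (dotp mu Omega).
Hypothesis lam_gt0 : forall k, 0 < lam k.
Hypothesis lam_nd : forall k, lam k <= lam k.+1.
Hypothesis Lphi : forall k, L2 (phi k).
Hypothesis phi_on : forall k l, ip (phi k) (phi l) = (k == l)%:R.
Hypothesis phi_complete : forall u, L2 u ->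
  snorm (gLp mu Omega 2%:E) (u - \sum_(k < m) ip u (phi k) *: phi k)
    @[m --> \oo] --> (0 : R).
Implicit Types (u v w : T -> R) (c : nat -> R).

Definition gHnorm2 (theta : R) u : \bar R :=
  (\sum_(k <oo) (lam k `^ theta * ip u (phi k) ^+ 2)%:E)%E.

Definition gHs (theta : R) : seminormed R (T -> R) := {|
  carrier := [set u | carrier (gLp mu Omega 2%:E) u /\ (gHnorm2 theta u < +oo)%E];
  snorm := fun u => Num.sqrt (fine (gHnorm2 theta u)) |}.

Definition gLDpow (alpha : R) u : T -> R :=
  xget (cst 0) [set w | carrier (gLp mu Omega 2%:E) w /\
    snorm (gLp mu Omega 2%:E)
      (w - \sum_(k < m) (lam k `^ alpha * ip u (phi k)) *: phi k)
      @[m --> \oo] --> (0 : R)].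

Local Notation S c m := (\sum_(k < m) c k *: phi k).

Lemma L2_psum c m : L2 (S c m).
Proof.
elim: m => [|m IH].
  rewrite big_ord0; split; first exact: measurable_cst.
  apply: (@intble_eq _ _ _ _ _ (cst 0)) => [x|]; first by rewrite expr0n.
  exact: intble_cst.
rewrite big_ord_recr/= addrC; exact: (L2_lin mO (c m) (Lphi m) IH).
Qed.

Lemma ip_psum c m v : L2 v -> ip (S c m) v = \sum_(k < m) c k * ip (phi k) v.
Proof.
move=> Lv; elim: m => [|m IH].
  rewrite !big_ord0 /dotp (@eq_Rintegral _ _ _ _ _ (cst 0)); last first.
    by move=> x _; rewrite mul0r.
  by rewrite Rint_cst// mul0r.
rewrite big_ord_recr/= [RHS]big_ord_recr/= -IH addrC.
by rewrite [LHS](ip_lin mO (c m) (Lphi m) (L2_psum c m) Lv) addrC.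
Qed.

Lemma ip_phi_psum c m k : (k < m)%N -> ip (phi k) (S c m) = c k.
Proof.
move=> km; rewrite ip_sym ip_psum// (bigD1 (Ordinal km))//= phi_on eqxx mulr1.
rewrite big1 ?addr0// => i ik; rewrite phi_on (_ : (i == k :> nat) = false) ?mulr0//.
by apply/negbTE; apply: contra ik => /eqP ik; apply/eqP/val_inj.
Qed.

Lemma ip_psum_psum c m m' : (m' <= m)%N ->
  ip (S c m') (S c m) = \sum_(k < m') c k ^+ 2.
Proof.
move=> mm; rewrite ip_psum; last exact: L2_psum.
by apply: eq_bigr => k _; rewrite ip_phi_psum ?expr2// (leq_trans _ mm).
Qed.

Lemma L2_sub u v : L2 u -> L2 v -> L2 (u - v).
Proof.
move=> Lu Lv; have := L2_lin mO (-1) Lv Lu.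
by rewrite (_ : (fun x => _) = u - v)//; apply/funext => x; rewrite mulN1r addrC.
Qed.

Lemma ip_subl u v w : L2 u -> L2 v -> L2 w -> ip (u - v) w = ip u w - ip v w.
Proof.
move=> Lu Lv Lw; have := ip_lin mO (-1) Lv Lu Lw.
by rewrite (_ : (fun x => _) = u - v); [move=> ->; rewrite mulN1r addrC|apply/funext => x; rewrite mulN1r addrC].
Qed.

Lemma ip_sub_sub u v : L2 u -> L2 v ->
  ip (u - v) (u - v) = ip u u - 2 * ip u v + ip v v.
Proof.
move=> Lu Lv; have Luv := L2_sub Lu Lv.
rewrite ip_subl// (ip_sym _ _ u) (ip_sym _ _ v) !ip_subl// (ip_sym _ _ v u); ring.
Qed.

Lemma psum_sub c m m' : (m' <= m)%N ->
  ip (S c m - S c m') (S c m - S c m') =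
  \sum_(k < m) c k ^+ 2 - \sum_(k < m') c k ^+ 2.
Proof.
move=> mm; rewrite ip_sub_sub; [|exact: L2_psum..].
rewrite (ip_sym _ _ (S c m) (S c m')) !ip_psum_psum//; ring.
Qed.

Local Notation nrm u := (snorm (gLp mu Omega 2%:E) u).

Lemma nrmE u : L2 u -> nrm u = Num.sqrt (ip u u).
Proof. by move=> Lu; apply: L2_snormE => //; exact/L2_carrierP. Qed.

(** The squared distance of two partial sums is the difference of two terms of the bounded
    nondecreasing sequence of sums of c_k^2, so Riesz-Fischer applies. This is what makes the series
    behind [gLDpow] converge. *)
Lemma exists_L2_sum c (B : R) : (forall m, \sum_(k < m) c k ^+ 2 <= B) ->
  exists2 w, L2 w & nrm (w - S c m) @[m --> \oo] --> (0 : R).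
Proof.
move=> cB; pose t m := \sum_(k < m) c k ^+ 2.
have nd_t : nondecreasing_seq t.
  by apply/nondecreasing_seqP => m; rewrite /t big_ord_recr/= lerDl sqr_ge0.
have ct : cvgn t.
  by apply: nondecreasing_is_cvgn => //; exists B => _ [m _ <-]; exact: cB.
have tl m : t m <= limn t by exact: nondecreasing_cvgn_le.
have cau (e : R) : 0 < e -> exists M, forall m m', (M <= m)%N -> (M <= m')%N ->
    ip (fun x => S c m x - S c m' x) (fun x => S c m x - S c m' x) <= e.
  move=> e0; have /cvgrPdist_le /(_ e e0) [M _ HM] := ct.
  exists M => m m' Mm Mm'.
  have sym : ip (fun x => S c m x - S c m' x) (fun x => S c m x - S c m' x) =
     `|t m - t m'|.
    have [mm|/ltnW mm] := leqP m' m.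
      by rewrite ger0_norm ?subr_ge0 ?nd_t//; exact: psum_sub.
    rewrite distrC ger0_norm ?subr_ge0 ?nd_t// -(psum_sub c mm).
    by apply: eq_Rintegral => x _ /=; rewrite -[LHS]mulrNN !opprB.
  have := HM m Mm; have := HM m' Mm'; have := tl m; have := tl m'.
  rewrite sym /= => t1 t2; rewrite (@ger0_norm _ (limn t - _)) ?subr_ge0// => t3.
  rewrite (@ger0_norm _ (limn t - _)) ?subr_ge0// => t4.
  by rewrite ler_norml; apply/andP; split; lra.
have [w Lw Hw] := riesz_fischer mO mu_complete (fun j => L2_psum c j) cau.
exists w => //; apply/cvgrPdist_le => e e0.
have [M HM] := Hw (e ^+ 2) ltac:(by rewrite exprn_gt0).
exists M => // m Mm; rewrite sub0r normrN ger0_norm ?Lp_snorm_ge0//.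
rewrite nrmE; last exact: L2_sub Lw (L2_psum c m).
by rewrite -[leRHS](ger0_norm (ltW e0)) -sqrtr_sqr ler_wsqrtr//; exact: HM.
Qed.

Lemma cvg_ip_psum c w v : L2 w -> L2 v ->
  nrm (w - S c m) @[m --> \oo] --> (0 : R) ->
  (\sum_(k < m) c k * ip (phi k) v) @[m --> \oo] --> ip w v.
Proof.
move=> Lw Lv H; apply/cvgrPdist_le => e e0.
pose B := Num.sqrt (ip v v) + 1.
have B0 : 0 < B by rewrite ltr_wpDl ?sqrtr_ge0.
have /cvgrPdist_le /(_ (e / B)) := H.
rewrite divr_gt0// => /(_ isT); apply: filterS => m.
have Ld := L2_sub Lw (L2_psum c m).
rewrite sub0r normrN ger0_norm ?Lp_snorm_ge0// nrmE// => h.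
rewrite -ip_psum// -ip_subl//; last exact: L2_psum.
apply: (le_trans (ip_cauchy_sqrt mO Ld Lv)).
apply: (@le_trans _ _ (e / B * B)); last by rewrite divfK ?gt_eqF.
by apply: ler_pM; rewrite ?sqrtr_ge0// /B lerDl.
Qed.

Lemma ip_phi_limit c w k : L2 w -> nrm (w - S c m) @[m --> \oo] --> (0 : R) ->
  ip w (phi k) = c k.
Proof.
move=> Lw H; have := cvg_ip_psum Lw (Lphi k) H.
move=> /cvg_lim <-//; apply/cvg_lim => //; apply: cvg_near_cst.
exists k.+1 => // m /= km; rewrite (bigD1 (Ordinal km))//= phi_on eqxx mulr1.
rewrite big1 ?addr0// => i ik; rewrite phi_on (_ : (i == k :> nat) = false) ?mulr0//.
by apply/negbTE; apply: contra ik => /eqP ik; apply/eqP/val_inj.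
Qed.

Lemma parseval u v : L2 u -> L2 v ->
  (\sum_(k < m) ip u (phi k) * ip v (phi k)) @[m --> \oo] --> ip u v.
Proof.
move=> Lu Lv; have := @cvg_ip_psum (fun k => ip u (phi k)) u v Lu Lv (phi_complete Lu).
by under eq_fun do under eq_bigr do rewrite (ip_sym _ _ (phi _) v).
Qed.

(** * The space H^theta, its norm and its bilinear form *)

Section Hs.
Variable theta : R.
Hypothesis theta_gt0 : 0 < theta.

Local Notation Hs := (carrier (gHs theta)).
Local Notation hn u := (snorm (gHs theta) u).
Local Notation Q u m := (\sum_(k < m) lam k `^ theta * ip u (phi k) ^+ 2).
Local Notation gW := (gLDpow (theta / 2)).

Let term_ge0 u k : 0 <= lam k `^ theta * ip u (phi k) ^+ 2.
Proof. by rewrite mulr_ge0 ?powR_ge0 ?sqr_ge0. Qed.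

Lemma Hs_L2 u : Hs u -> L2 u.
Proof. by move=> [/(L2_carrierP mu mO u).1]. Qed.

Lemma gHnorm2_ge0 u : (0 <= gHnorm2 theta u)%E.
Proof. by apply: nneseries_ge0 => k _ _; rewrite lee_fin. Qed.

Lemma Hs_cvg u : Hs u -> Q u m @[m --> \oo] --> hn u ^+ 2.
Proof.
move=> [_ H]; rewrite /= sqr_sqrtr ?fine_ge0 ?gHnorm2_ge0//.
have fin : gHnorm2 theta u \is a fin_num by rewrite ge0_fin_numE// gHnorm2_ge0.
have hE i (_ : (0 <= i)%N) (_ : xpredT i) : (0 <= (lam i `^ theta * ip u (phi i) ^+ 2)%:E)%E by rewrite lee_fin.
have := @is_cvg_nneseries R (fun k => (lam k `^ theta * ip u (phi k) ^+ 2)%:E) xpredT 0%N hE.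
rewrite -/(gHnorm2 theta u) => cv.
have : (\sum_(0 <= k < m) (lam k `^ theta * ip u (phi k) ^+ 2)%:E)%E @[m --> \oo] --> (fine (gHnorm2 theta u))%:E.
  by rewrite fineK.
move/fine_cvg; apply: cvg_trans; apply: near_eq_cvg; apply: nearW => m /=.
by rewrite sumEFin/= big_mkord.
Qed.

Lemma Hs_le u m : Hs u -> Q u m <= hn u ^+ 2.
Proof.
move=> Hu; have H := Hs_cvg Hu; rewrite -(cvg_lim _ H)//.
apply: (@nondecreasing_cvgn_le _ (fun m => Q u m)); last exact: cvgP H.
by apply/nondecreasing_seqP => j; rewrite big_ord_recr/= lerDl.
Qed.

Lemma Hs_bounded u (B : R) : L2 u -> (forall m, Q u m <= B) -> Hs u.
Proof.
move=> Lu QB; split; first exact: (L2_carrierP mu mO u).2.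
apply: (@le_lt_trans _ _ B%:E); last exact: ltry.
apply: lime_le.
  by apply: is_cvg_nneseries => k _ _; rewrite lee_fin.
by apply: nearW => m; rewrite sumEFin lee_fin big_mkord.
Qed.

Let powR_half k : (lam k `^ (theta / 2)) ^+ 2 = lam k `^ theta.
Proof. by rewrite -powR_mulrn ?powR_ge0// -powRrM divfK. Qed.

(** Membership in H^theta makes the coefficients square summable, so the series converges and [xget]
    does not fall back on its default. Later arguments see the chosen function through these
    coefficients. *)
Lemma LDpow_spec u : Hs u -> L2 (gW u) /\
  forall k, ip (gW u) (phi k) = lam k `^ (theta / 2) * ip u (phi k).
Proof.
move=> Hu; pose c k := lam k `^ (theta / 2) * ip u (phi k).
have cB m : \sum_(k < m) c k ^+ 2 <= hn u ^+ 2.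
  apply: le_trans (Hs_le m Hu); rewrite le_eqVlt; apply/orP; left; apply/eqP.
  by apply: eq_bigr => k _; rewrite exprMn powR_half.
have [w Lw cw] := exists_L2_sum cB.
have [LW cW] : carrier (gLp mu Omega 2%:E) (gW u) /\
    nrm (gW u - S c m) @[m --> \oo] --> (0 : R).
  rewrite /gLDpow; case: xgetP => [w' -> [//]|/(_ w)[]].
  by split => //; exact: (L2_carrierP mu mO w).2.
have LW2 : L2 (gW u) := (L2_carrierP mu mO (gW u)).1 LW.
by split => // k; exact: (@ip_phi_limit c _ k LW2 cW).
Qed.

Lemma Hs_snorm_ge0 u : 0 <= hn u.
Proof. exact: sqrtr_ge0. Qed.

Lemma Hs_lin (k : R) u v : Hs u -> Hs v -> Hs (fun x => k * u x + v x).
Proof.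
move=> Hu Hv; have Lu := Hs_L2 Hu; have Lv := Hs_L2 Hv.
apply: (@Hs_bounded _ (2 * k ^+ 2 * hn u ^+ 2 + 2 * hn v ^+ 2)).
  exact: L2_lin.
move=> m; apply: (@le_trans _ _ (2 * k ^+ 2 * Q u m + 2 * Q v m)); last first.
  by apply: lerD; apply: ler_wpM2l; rewrite ?Hs_le// mulr_ge0// sqr_ge0.
rewrite !mulr_sumr -big_split/=; apply: ler_sum => i _.
rewrite ip_lin// -subr_ge0.
have p := powR_ge0 (lam i) theta.
rewrite (_ : _ - _ = lam i `^ theta * (k * ip u (phi i) - ip v (phi i)) ^+ 2).
  by rewrite mulr_ge0// sqr_ge0.
by ring.
Qed.

Lemma Hs_scale (k : R) u : Hs u -> Hs (fun x => k * u x) /\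
  hn (fun x => k * u x) = `|k| * hn u.
Proof.
move=> Hu.
have qE m : Q (fun x => k * u x) m = k ^+ 2 * Q u m.
  rewrite mulr_sumr; apply: eq_bigr => i _.
  have -> : ip (fun x => k * u x) (phi i) = k * ip u (phi i).
    rewrite /dotp -RintegralZl//; last exact: ip_integrable (Hs_L2 Hu) (Lphi i).
    by apply: eq_Rintegral => x _; rewrite mulrA.
  ring.
have Lk : L2 (fun x => k * u x).
  have := L2_lin mO (k - 1) (Hs_L2 Hu) (Hs_L2 Hu).
  by rewrite (_ : (fun x => _) = (fun x => k * u x))//; apply/funext => x; ring.
have Hk : Hs (fun x => k * u x).
  apply: (@Hs_bounded _ (k ^+ 2 * hn u ^+ 2)) => // m.
  by rewrite qE ler_wpM2l ?sqr_ge0// Hs_le.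
split => //; apply/eqP; rewrite -(eqrXn2 (n := 2))// ?mulr_ge0 ?Hs_snorm_ge0//.
apply/eqP; rewrite exprMn real_normK ?num_real//.
have H1 := Hs_cvg Hk.
have H2 : (fun m => k ^+ 2 * Q u m) @ \oo --> k ^+ 2 * hn u ^+ 2.
  by apply: cvgM; [exact: cvg_cst|exact: Hs_cvg].
exact: (eq_cvg_unique H1 H2).
Qed.

Section form.
Variable W : (T -> R) -> T -> R.
Hypothesis W_spec : forall u, Hs u -> L2 (W u) /\
  forall k, ip (W u) (phi k) = lam k `^ (theta / 2) * ip u (phi k).

(** [W] stands for L_D^(theta/2). It is a choice up to null sets, so W (k u + v) need not equal k W
    u + W v pointwise; linearity and the value on the diagonal are read off the series of
    [hform_cvg]. *)
Definition hform u v := ip (W u) (W v).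

Lemma hform_cvg u v : Hs u -> Hs v ->
  (\sum_(k < m) lam k `^ theta * (ip u (phi k) * ip v (phi k)))
    @[m --> \oo] --> hform u v.
Proof.
move=> /W_spec [Lu uk] /W_spec [Lv vk].
have E k : lam k `^ theta * (ip u (phi k) * ip v (phi k)) =
    ip (W u) (phi k) * ip (W v) (phi k).
  apply: etrans (esym (congr2 *%R (uk k) (vk k))); rewrite mulrACA.
  exact: (congr2 *%R (esym (powR_half k)) (erefl _)).
have -> : (fun m => \sum_(k < m) lam k `^ theta * (ip u (phi k) * ip v (phi k))) =
    (fun m => \sum_(k < m) ip (W u) (phi k) * ip (W v) (phi k)).
  by apply/funext => m; apply: eq_bigr => k _; exact: E.
exact: parseval.
Qed.

Lemma hform_sym u v : hform u v = hform v u.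
Proof. exact: ip_sym. Qed.

Lemma hform_linr (k : R) u v w : Hs u -> Hs v -> Hs w ->
  hform w (fun x => k * u x + v x) = k * hform w u + hform w v.
Proof.
move=> Hu Hv Hw; have Lu := Hs_L2 Hu; have Lv := Hs_L2 Hv.
have H1 := hform_cvg Hw (Hs_lin k Hu Hv).
have H2 : (fun m => k * (\sum_(i < m) lam i `^ theta * (ip w (phi i) * ip u (phi i))) +
    \sum_(i < m) lam i `^ theta * (ip w (phi i) * ip v (phi i))) @ \oo -->
    k * hform w u + hform w v.
  apply: cvgD; last exact: hform_cvg.
  by apply: cvgM; [exact: cvg_cst|exact: hform_cvg].
apply: (eq_cvg_unique H1 H2) => m /=.
rewrite mulr_sumr -big_split/=; apply: eq_bigr => i _; rewrite ip_lin//; ring.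
Qed.

Lemma hform_diag u : Hs u -> hform u u = hn u ^+ 2.
Proof.
move=> Hu; have H1 := hform_cvg Hu Hu; have H2 := Hs_cvg Hu.
by apply: (eq_cvg_unique H1 H2) => m; apply: eq_bigr => k _; rewrite expr2.
Qed.

Lemma hform_le u v : Hs u -> Hs v -> `|hform u v| <= hn u * hn v.
Proof.
move=> Hu Hv; have [Lu _] := W_spec Hu; have [Lv _] := W_spec Hv.
exact: (le_sqrtM_sqr (Hs_snorm_ge0 u) (Hs_snorm_ge0 v)
  (hform_diag Hu) (hform_diag Hv) (ip_cauchy_sqrt mO Lu Lv)).
Qed.

Lemma Hs_triangle u v : Hs u -> Hs v -> hn (fun x => u x + v x) <= hn u + hn v.
Proof.
move=> Hu Hv; have -> : (fun x => u x + v x) = (fun x => 1 * u x + v x).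
  by apply/funext => x; rewrite mul1r.
have Huv := Hs_lin 1 Hu Hv.
exact: (triangle_sqr (hform_linr 1 Hu Hv Huv) (hform_linr 1 Hu Hv Hu)
  (hform_linr 1 Hu Hv Hv) (hform_sym _ _) (hform_sym _ _) (hform_sym _ _)
  (hform_diag Huv) (hform_diag Hu) (hform_diag Hv) (hform_le Hu Hv)
  (Hs_snorm_ge0 _) (Hs_snorm_ge0 _) (Hs_snorm_ge0 _)).
Qed.

End form.

(** Each lam_k^theta is positive, so a zero norm kills every coefficient, and then Parseval kills
    the L^2 norm. *)
Lemma Hs_null u : Hs u -> hn u = 0 -> {ae mu, forall x, Omega x -> u x = 0}.
Proof.
move=> Hu hu0; have Lu := Hs_L2 Hu.
have u0 k : ip u (phi k) = 0.
  have := Hs_le k.+1 Hu; rewrite hu0 expr0n/= big_ord_recr/= => h.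
  have q0 : 0 <= Q u k by apply: sumr_ge0 => i _; exact: term_ge0.
  have /eqP : lam k `^ theta * ip u (phi k) ^+ 2 = 0.
    by apply/eqP; rewrite eq_le term_ge0 andbT; lra.
  rewrite mulf_eq0 gt_eqF ?powR_gt0//= sqrf_eq0 => /eqP; exact.
apply: (ip_eq0 mO Lu); have H := parseval Lu Lu.
rewrite -(cvg_lim _ H)//; apply/cvg_lim => //.
apply: cvg_near_cst; apply: nearW => m; apply: big1 => k _.
by rewrite u0 mul0r.
Qed.

Lemma lam_homo k m : (m <= k)%N -> lam m <= lam k.
Proof.
by have /nondecreasing_seqP := lam_nd; exact.
Qed.

Lemma spectral_tail z v m : L2 z -> Hs v ->
  `|ip z v - \sum_(k < m) ip z (phi k) * ip v (phi k)| <=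
  nrm z * (Num.sqrt (lam m `^ theta)^-1 * hn v).
Proof.
move=> Lz Hv; have Lv := Hs_L2 Hv.
pose c k := ip v (phi k); have LS := L2_psum c m.
(* The sum pairs z with the projection of v onto the first m modes, so the difference is z against v
   minus that projection, whose squared L^2 norm is the tail of Parseval's series. *)
have -> : \sum_(k < m) ip z (phi k) * ip v (phi k) = ip (S c m) z.
  by rewrite ip_psum//; apply: eq_bigr => k _; rewrite mulrC (ip_sym _ _ z).
rewrite (ip_sym _ _ z v) -ip_subl// ip_sym nrmE//.
apply: (le_trans (ip_cauchy_sqrt mO Lz (L2_sub Lv LS))).
rewrite ler_wpM2l ?sqrtr_ge0//.
have l0 : 0 < lam m `^ theta by rewrite powR_gt0.
rewrite -[X in _ <= _ * X](ger0_norm (Hs_snorm_ge0 v)) -sqrtr_sqr -sqrtrM; last first.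
  by rewrite invr_ge0 ltW.
rewrite ler_wsqrtr// ip_sub_sub// (ip_sym _ _ v (S c m)) ip_psum//.
have e1 : \sum_(k < m) c k * ip (phi k) v = \sum_(k < m) c k ^+ 2.
  by apply: eq_bigr => k _; rewrite (ip_sym _ _ (phi k)) expr2.
rewrite e1 ip_psum_psum//.
have -> : ip v v - 2 * \sum_(k < m) c k ^+ 2 + \sum_(k < m) c k ^+ 2 =
  ip v v - \sum_(k < m) c k ^+ 2 by ring.
have H := parseval Lv Lv.
have : ip v v <= \sum_(k < m) c k ^+ 2 + (lam m `^ theta)^-1 * hn v ^+ 2; last by lra.
(* It suffices to bound the partial sums with M >= m terms; for k >= m the weight lam_k^theta is at
   least lam_m^theta. *)
rewrite -(cvg_lim _ H)//; apply: limr_le; first exact: cvgP H.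
exists m => // M /= mM.
rewrite -(big_mkord xpredT (fun k => ip v (phi k) * ip v (phi k))) (big_cat_nat (leq0n m) mM)//= big_mkord.
apply: lerD; first by apply: ler_sum => k _; rewrite expr2.
rewrite ler_pdivlMl// mulr_sumr.
apply: le_trans (Hs_le M Hv).
rewrite -(big_mkord xpredT (fun k => lam k `^ theta * ip v (phi k) ^+ 2)) [leRHS](big_cat_nat (leq0n m) mM)//=.
rewrite (@le_trans _ _ (\sum_(m <= i < M) lam i `^ theta * ip v (phi i) ^+ 2))//; last first.
  by rewrite lerDr sumr_ge0// => i _; exact: term_ge0.
rewrite big_nat [leRHS]big_nat; apply: ler_sum => k /andP[mk _].
rewrite -expr2 ler_wpM2r ?sqr_ge0//; apply: ge0_ler_powR; [exact: ltW|..|exact: lam_homo].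
- by rewrite nnegrE ltW.
- by rewrite nnegrE ltW.
Qed.

End Hs.
End spectral.

(** * Dual norms and compactness *)

Section quasinormed.
Context (R : realType).

Record quasinorm (E : zmodType) (X : seminormed R E) : Prop := {
  qn_sub : forall u v, carrier X u -> carrier X v -> carrier X (u - v) ;
  qn_ge0 : forall u, carrier X u -> 0 <= snorm X u ;
  qn_opp : forall u, carrier X u -> snorm X (- u) = snorm X u ;
  qn_add : exists2 C, 0 < C & forall u v, carrier X u -> carrier X v ->
    snorm X (u + v) <= C * (snorm X u + snorm X v) }.

Record quasinormed_space (E : lmodType R) (X : seminormed R E) : Prop := {
  qns_quasinorm : quasinorm X ;
  qns_lin : forall (k : R) u v, carrier X u -> carrier X v -> carrier X (k *: u + v) ;
  qns_scale : forall (k : R) u, 0 < k -> carrier X u -> snorm X (k *: u) <= k * snorm X u }.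

Lemma qn_dist3 (E : zmodType) (X : seminormed R E) : quasinorm X ->
  exists2 C, 0 < C & forall u v w, carrier X u -> carrier X v -> carrier X w ->
    snorm X (u - w) <= C * (snorm X (v - u) + snorm X (v - w)).
Proof.
move=> qX; have [C C0 HC] := qn_add qX; exists C => // u v w Xu Xv Xw.
have -> : u - w = - (v - u) + (v - w) by rewrite opprB addrA subrK.
rewrite -(qn_opp qX (qn_sub qX Xv Xu)) HC//; last exact: qn_sub.
by rewrite opprB; exact: qn_sub.
Qed.

(** * The norm of functionals on a quasinormed space *)

Section dual_norm.
Context (E : lmodType R) (X : seminormed R E).
Hypothesis qX : quasinormed_space X.
Local Notation N := (snorm X).
Implicit Types (l : E -> R) (u v : E).

Lemma qns_zero u : carrier X u -> carrier X 0.
Proof. by move=> Xu; have := qns_lin qX (-1) Xu Xu; rewrite scaleN1r addNr. Qed.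

Lemma qns_scaled (k : R) u : carrier X u -> carrier X (k *: u).
Proof. by move=> Xu; have := qns_lin qX k Xu (qns_zero Xu); rewrite addr0. Qed.

Definition linear_on l := forall (k : R) u v, carrier X u -> carrier X v ->
  l (k *: u + v) = k * l u + l v.

Lemma linear_on_scale l (k : R) u : linear_on l -> carrier X u -> l (k *: u) = k * l u.
Proof.
move=> ll Xu; have X0 := qns_zero Xu.
have l0 : l 0 = 0.
  by have := ll 1 0 0 X0 X0; rewrite scaler0 addr0 mul1r => /eqP; rewrite -subr_eq subrr => /eqP.
by have := ll k u 0 Xu X0; rewrite addr0 l0 addr0.
Qed.

(** Rescaling into the unit ball, with any k > N u in place of N u, which may be 0. Absolute
    homogeneity is the form of the hypothesis on l so that differences of functionals are covered
    directly. *)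
Lemma unit_ball_bound (C : R) l : 0 <= C ->
  (forall (k : R) u, carrier X u -> `|l (k *: u)| = `|k| * `|l u|) ->
  (forall u, carrier X u -> N u <= 1 -> `|l u| <= C) ->
  forall u, carrier X u -> `|l u| <= C * N u.
Proof.
move=> C0 lh lC u Xu; have Nu := qn_ge0 (qns_quasinorm qX) Xu.
have H k : N u < k -> `|l u| <= C * k.
  move=> uk; have k0 : 0 < k := le_lt_trans Nu uk.
  have := lC _ (qns_scaled k^-1 Xu); rewrite lh// gtr0_norm ?invr_gt0//.
  rewrite ler_pdivrMl// [k * C]mulrC; apply.
  apply: (le_trans (qns_scale qX _ Xu)); first by rewrite invr_gt0.
  by rewrite ler_pdivrMl// mulr1 ltW.
apply/ler_addgt0Pl => e e0.
have eC : 0 < e / (C + 1) by rewrite divr_gt0// ltr_wpDl.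
apply: (le_trans (H (N u + e / (C + 1)) _)); first by rewrite ltrDl.
rewrite mulrDr addrC lerD2r mulrA ler_pdivrMr ?ltr_wpDl//.
by rewrite mulrC ler_wpM2l ?(ltW e0)// lerDl.
Qed.

Lemma dual_norm_ubound l : carrier (dual X) l ->
  has_ubound [set `|l u| | u in [set u | carrier X u /\ N u <= 1]].
Proof.
move=> [_ [C HC]]; exists `|C| => _ [u [Xu u1] <-].
apply: (le_trans (HC _ Xu)); apply: (le_trans (ler_norm _)).
by rewrite normrM (ger0_norm (qn_ge0 (qns_quasinorm qX) Xu)) ler_piMr.
Qed.

Lemma dual_norm_ge0 l : 0 <= snorm (dual X) l.
Proof.
rewrite /=; set A := (X in sup X).
have [[y Ay]|] := pselect (A !=set0); last first.
  by move=> /set0P/negP; rewrite negbK => /eqP ->; rewrite sup0.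
have [hs|hs] := pselect (has_sup A); last by rewrite sup_out.
apply: (@le_trans _ _ y); first by case: Ay => u _ <-.
exact: (ub_le_sup hs.2 Ay).
Qed.

Lemma dual_norm_unit l u : carrier (dual X) l -> carrier X u -> N u <= 1 ->
  `|l u| <= snorm (dual X) l.
Proof.
by move=> Dl Xu u1; apply: ub_le_sup; [exact: dual_norm_ubound|exists u].
Qed.

Lemma dual_norm_bound l u : carrier (dual X) l -> carrier X u ->
  `|l u| <= snorm (dual X) l * N u.
Proof.
move=> Dl Xu; have [ll _] := Dl; apply: unit_ball_bound => //.
- exact: dual_norm_ge0.
- by move=> k w Xw; rewrite linear_on_scale// normrM.
- by move=> w Xw w1; exact: dual_norm_unit.
Qed.

Lemma dual_norm_le l (e : R) : 0 <= e ->
  (forall u, carrier X u -> N u <= 1 -> `|l u| <= e) -> snorm (dual X) l <= e.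
Proof.
move=> e0 H; rewrite /=; set A := (X in sup X).
have [A0|] := pselect (A !=set0); last first.
  by move=> /set0P/negP; rewrite negbK => /eqP ->; rewrite sup0.
by apply: ge_sup => // _ [u [Xu u1] <-]; exact: H.
Qed.

End dual_norm.

(** If no colour class belonged to U, all their complements would, and so would their finite
    intersection, which is empty. *)
Lemma ultra_color (E1 : Type) (I : finType) (c : E1 -> I) (U : set_system E1) :
  UltraFilter U -> exists i, U [set a | c a = i].
Proof.
move=> uU; have pU : ProperFilter U by exact: ultra_proper.
have [//|nex] := pselect (exists i, U [set a | c a = i]).
have H i : U [set a | c a <> i].
  have [Ui|//] := in_ultra_setVsetC [set a | c a = i] uU.
  by case: nex; exists i.
have : U [set a | forall i, c a <> i].
  by apply: filter_forall => i; exact: H.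
by move=> /filter_ex [a /(_ (c a))].
Qed.

(** * Compactness through ultrafilters *)

Section compactness.
Context (E1 : Type) (E : lmodType R) (E' : zmodType).
Variables (X : seminormed R E) (Y : seminormed R E').
Hypotheses (qX : quasinormed_space X) (qY : quasinorm Y).
Variables (A : set E1) (L : E1 -> E -> R) (B : (E -> R) -> E').
Hypothesis LA : forall a, A a -> carrier (dual X) (L a).
(** Total boundedness of the functionals L a, stated as a finite colouring rather than with finitely
    many centres: an ultrafilter then concentrates on one colour. *)
Hypothesis tb : forall e : R, 0 < e -> exists (I : finType) (c : E1 -> I),
  forall a a', A a -> A a' -> c a = c a' ->
    forall v, carrier X v -> snorm X v <= 1 -> `|L a v - L a' v| <= e.
Hypothesis cB : continuous_op (dual X) Y B.

Section limit.
Variable U : set_system E1.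
Hypothesis uU : UltraFilter U.
Hypothesis UA : U A.
Let pU : ProperFilter U. Proof. exact: ultra_proper. Qed.
Existing Instance pU.

Lemma ultra_cluster (e : R) : 0 < e -> exists2 S, U S & S `<=` A /\
  forall a a', S a -> S a' -> forall v, carrier X v ->
    `|L a v - L a' v| <= e * snorm X v.
Proof.
move=> e0; have [I [c Hc]] := tb e0.
have [i Ui] := ultra_color c uU.
exists (A `&` [set a | c a = i]); first exact: filterI.
split; first exact: subIsetl.
move=> a a' [Aa ca] [Aa' ca'] v Xv.
have [la _] := LA Aa; have [la' _] := LA Aa'.
apply: (@unit_ball_bound _ _ qX e (fun v => L a v - L a' v)) => //.
- exact: ltW.
- move=> k w Xw; rewrite (linear_on_scale qX k la Xw) (linear_on_scale qX k la' Xw).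
  by rewrite -mulrBr normrM.
- by move=> w Xw w1; apply: Hc => //; rewrite ca ca'.
Qed.

(** Off the carrier of X the limit may be a default value, which [dual] does not see. *)
Definition ultra_limit (v : E) : R := lim (L a v @[a --> U]).

Lemma ultra_limit_cvg v : carrier X v -> L a v @[a --> U] --> ultra_limit v.
Proof.
move=> Xv; apply: cauchy_cvg; apply/cauchy_exP => e e0.
have Nv := qn_ge0 (qns_quasinorm qX) Xv.
have e1 : 0 < e / 2 / (snorm X v + 1) by rewrite !divr_gt0// ltr_wpDl.
have [S US [_ HS]] := ultra_cluster e1.
have [a0 Sa0] := filter_ex US.
exists (L a0 v); suff : U [set a | ball (L a0 v) e (L a v)] by [].
apply: filterS US => a Sa; rewrite -ball_normE /ball_/=.
apply: (le_lt_trans (HS _ _ Sa0 Sa v Xv)).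
rewrite mulrAC ltr_pdivrMr ?ltr_wpDl//.
have : 0 <= e / 2 * snorm X v by rewrite mulr_ge0// divr_ge0// ltW.
nra.
Qed.

(** A pointwise limit of a uniformly Cauchy family is a uniform limit: S depends on e alone, while
    the index a' used for comparison may depend on v and e'. *)
Lemma ultra_limit_close (e : R) : 0 < e -> exists2 S, U S & S `<=` A /\
  forall a, S a -> forall v, carrier X v ->
    `|L a v - ultra_limit v| <= e * snorm X v.
Proof.
move=> e0; have [S US [SA HS]] := ultra_cluster e0.
exists S => //; split => // a Sa v Xv.
apply/ler_addgt0Pl => e' e'0.
have /cvgrPdist_le /(_ e' e'0) H := ultra_limit_cvg Xv.
have [a' [Sa' Ha']] := filter_ex (filterI US H).
have := HS _ _ Sa Sa' v Xv; move: Ha'; rewrite /= distrC => h1 h2.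
have -> : L a v - ultra_limit v = (L a' v - ultra_limit v) + (L a v - L a' v) by ring.
by apply: (le_trans (ler_normD _ _)); exact: lerD.
Qed.

Lemma ultra_limit_dual : carrier (dual X) ultra_limit.
Proof.
split.
  move=> k u v Xu Xv; have Xkuv := qns_lin qX k Xu Xv.
  have H1 := ultra_limit_cvg Xkuv.
  have H2 : (fun a => k * L a u + L a v) @ U --> k * ultra_limit u + ultra_limit v.
    apply: cvgD; last exact: ultra_limit_cvg.
    by apply: cvgM; [exact: cvg_cst|exact: ultra_limit_cvg].
  apply: (cvg_unique _ _ H2) => //.
  apply: cvg_trans H1; apply: near_eq_cvg; apply: filterS UA => a Aa.
  by have [la _] := LA Aa; rewrite /= la.
have [S US [SA HS]] := ultra_limit_close ltr01.
have [a Sa] := filter_ex US; have [_ [C HC]] := LA (SA _ Sa).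
exists (C + 1) => u Xu; rewrite mulrDl.
have -> : ultra_limit u = L a u - (L a u - ultra_limit u) by ring.
by apply: (le_trans (ler_normB _ _)); apply: lerD; [exact: HC|exact: HS].
Qed.

Lemma ultra_image_close (e : R) : 0 < e ->
  U [set a | A a /\ snorm Y (B (L a) - B ultra_limit) < e].
Proof.
move=> e0; have [d d0 Hd] := cB.2 _ _ ultra_limit_dual e0.
have d20 : 0 < d / 2 by rewrite divr_gt0.
have [S US [SA HS]] := ultra_limit_close d20.
apply: filterS US => a Sa; split; first exact: SA.
apply: Hd; first exact/LA/SA.
apply: (@le_lt_trans _ _ (d / 2)); last by rewrite ltr_pdivrMr// ltr_pMr// ltr1n.
apply: dual_norm_le; first exact: ltW.
move=> u Xu u1; apply: (le_trans (HS _ Sa u Xu)).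
by rewrite ler_piMr// ltW.
Qed.

End limit.

(** The filter F lives on the closure of the image, whose points need not be images, so it is pulled
    back to [G], generated by the sets of indices whose images lie within e of a member P of F. [G]
    is proper because points of the closure are limits of images; an ultrafilter finer than [G]
    yields the cluster point. *)
Lemma totally_bounded_relatively_compact : relatively_compact Y ((B \o L) @` A).
Proof.
move=> F pF; set K := sn_closure Y _ => FK.
have [C C0 HC] := qn_dist3 qY.
have Yimg a : A a -> carrier Y (B (L a)) by move=> Aa; exact/cB.1/LA.
pose G : set_system E1 := [set S | exists P e, [/\ F P, 0 < e &
  forall a, A a -> (exists2 p, P p & snorm Y (B (L a) - p) < e) -> S a]].
have pG : ProperFilter G.
  split.
    move=> [P [e [FP e0 H]]].
    have [p [Pp [Yp Kp]]] := filter_ex (filterI FP FK).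
    have [_ [a Aa <-] ap] := Kp e e0.
    by apply: (H a Aa); exists p.
  split.
  - by exists setT, 1; split => //; exact: filterT.
  - move=> S1 S2 [P1 [e1 [FP1 e10 H1]]] [P2 [e2 [FP2 e20 H2]]].
    exists (P1 `&` P2), (Num.min e1 e2); split; first exact: filterI.
      by rewrite lt_min e10.
    move=> a Aa [p [P1p P2p]]; rewrite lt_min => /andP[h1 h2].
    by split; [apply: H1 => //; exists p|apply: H2 => //; exists p].
  - move=> S1 S2 S12 [P [e [FP e0 H]]]; exists P, e; split => // a Aa Ha.
    exact/S12/H.
have [U [uU GU]] := ultraFilterLemma pG.
have pU : ProperFilter U by exact: ultra_proper.
have UA : U A by apply: GU; exists setT, 1; split => //; exact: filterT.
have YB : carrier Y (B (ultra_limit U)) by apply: cB.1; exact: ultra_limit_dual.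
have close (e : R) : 0 < e -> U [set a | A a /\ snorm Y (B (L a) - B (ultra_limit U)) < e].
  exact: ultra_image_close.
exists (B (ultra_limit U)).
  split => // e e0; have [a [Aa ae]] := filter_ex (close e e0).
  by exists (B (L a)) => //; exists a.
(* Two distances are added, from an image to p and from that image to the limit, and the constant C
   of the quasinorm multiplies their sum. *)
move=> P e FP e0; pose e' := e / C / 2.
have e'0 : 0 < e' by rewrite !divr_gt0.
pose Z := [set a | A a /\ exists2 p, (P `&` K) p & snorm Y (B (L a) - p) < e'].
have UZ : U Z by apply: GU; exists (P `&` K), e'; split => //; exact: filterI.
have [a [[Aa [p [Pp [Yp _]] h1]] [_ h2]]] := filter_ex (filterI UZ (close e' e'0)).
exists p => //; apply: (le_lt_trans (HC p (B (L a)) _ Yp (Yimg a Aa) YB)).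
rewrite -ltr_pdivlMl// mulrC (_ : e / C = e' + e'); first exact: ltrD.
by rewrite /e' -mulrDr; field; rewrite gt_eqF.
Qed.

End compactness.
End quasinormed.

(** * Strongly monotone operators *)

(** (H, h, a) abstracts H^s with its norm and form, (L, nF, rho, b) the Orlicz space with its
    Luxemburg functional, modular and Nemytskii form. Testing the equation controls rho, whereas the
    norm contains nF; [md_nF_rho] and [md_nF_small] bridge the two, for large and for small
    values. *)
Record monotone_data (R : realType) (E : lmodType R) (H L : set E)
    (h nF rho : E -> R) (a b : E -> E -> R) : Prop := {
  md_H_lin : forall (k : R) u v, H u -> H v -> H (k *: u + v) ;
  md_L_lin : forall (k : R) u v, L u -> L v -> L (k *: u + v) ;
  md_h_ge0 : forall u, H u -> 0 <= h u ;
  md_h_scale : forall (k : R) u, H u -> h (k *: u) = `|k| * h u ;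
  md_h_tri : forall u v, H u -> H v -> h (u + v) <= h u + h v ;
  md_a_linr : forall (k : R) u v w, H u -> H v -> H w ->
    a w (k *: u + v) = k * a w u + a w v ;
  md_a_sym : forall u v, a u v = a v u ;
  md_a_diag : forall u, H u -> a u u = h u ^+ 2 ;
  md_a_le : forall u v, H u -> H v -> `|a u v| <= h u * h v ;
  md_nF_ge0 : forall u, L u -> 0 <= nF u ;
  md_nF_scale : forall (k : R) u, 0 < k -> L u -> nF (k *: u) <= k * nF u ;
  md_nF_opp : forall u, L u -> nF (- u) = nF u ;
  md_nF_tri : exists2 C, 0 < C & forall u v, L u -> L v ->
    nF (u + v) <= C * (nF u + nF v) ;
  md_b_linr : forall (k : R) u v w, L u -> L v -> L w ->
    b w (k *: u + v) = k * b w u + b w v ;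
  md_b_bound : forall u, L u -> exists2 C, 0 < C & forall v, L v ->
    `|b u v| <= C * nF v ;
  md_rho_ge0 : forall u, L u -> 0 <= rho u ;
  md_rho_b : forall u, L u -> rho u <= b u u ;
  md_b_mono : forall u v, L u -> L v -> 0 <= b u (u - v) - b v (u - v) ;
  md_nF_rho : forall e, 0 < e -> exists2 C, 0 < C & forall u, L u ->
    nF u <= e * rho u + C ;
  md_nF_small : forall e, 0 < e -> exists2 eta, 0 < eta & forall u, L u ->
    rho u <= eta -> nF u <= e }.

Section monotone_operator.
Context (R : realType) (E : lmodType R).
Variables (H L : set E) (h nF rho : E -> R) (a b : E -> E -> R).
Implicit Types (u v w : E) (l : E -> R).
Hypothesis data : monotone_data H L h nF rho a b.
Let H_lin := md_H_lin data.
Let L_lin := md_L_lin data.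
Let h_ge0 := md_h_ge0 data.
Let h_scale := md_h_scale data.
Let h_tri := md_h_tri data.
Let a_linr := md_a_linr data.
Let a_sym := md_a_sym data.
Let a_diag := md_a_diag data.
Let a_le := md_a_le data.
Let nF_ge0 := md_nF_ge0 data.
Let nF_scale := md_nF_scale data.
Let nF_opp := md_nF_opp data.
Let nF_tri := md_nF_tri data.
Let b_linr := md_b_linr data.
Let b_bound := md_b_bound data.
Let rho_ge0 := md_rho_ge0 data.
Let rho_b := md_rho_b data.
Let b_mono := md_b_mono data.
Let nF_rho := md_nF_rho data.
Let nF_small := md_nF_small data.

Definition sumspace : seminormed R E := {|
  carrier := H `&` L; snorm := fun u => h u + nF u |}.
Local Notation X := sumspace.

Definition sum_op u v := a u v + b u v.

Lemma H_sub u v : H u -> H v -> H (u - v).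
Proof. by move=> Hu Hv; rewrite addrC -scaleN1r; exact: H_lin. Qed.

Lemma L_sub u v : L u -> L v -> L (u - v).
Proof. by move=> Hu Hv; rewrite addrC -scaleN1r; exact: L_lin. Qed.

Lemma sumspace_quasinormed : quasinormed_space X.
Proof.
have h_opp u : H u -> h (- u) = h u.
  by move=> Hu; rewrite -scaleN1r h_scale// normrN1 mul1r.
split; first split.
- by move=> u v [Hu Lu] [Hv Lv]; split; [exact: H_sub|exact: L_sub].
- by move=> u [Hu Lu]; rewrite /= addr_ge0 ?h_ge0 ?nF_ge0.
- by move=> u [Hu Lu]; rewrite /= h_opp// nF_opp.
- have [C C0 HC] := nF_tri; exists (C + 1); first by rewrite addr_gt0.
  move=> u v [Hu Lu] [Hv Lv]; rewrite /=.
  have := HC u v Lu Lv; have := h_tri Hu Hv.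
  have := h_ge0 Hu; have := h_ge0 Hv; have := nF_ge0 Lu; have := nF_ge0 Lv.
  by nra.
- by move=> k u v [Hu Lu] [Hv Lv]; split; [exact: H_lin|exact: L_lin].
- move=> k u k0 [Hu Lu]; rewrite /= h_scale// gtr0_norm// mulrDr lerD2l.
  exact: nF_scale.
Qed.

Lemma sum_op_dual u : carrier X u -> carrier (dual X) (sum_op u).
Proof.
move=> [Hu Lu]; split.
  move=> k v w [Hv Lv] [Hw Lw]; rewrite /sum_op a_linr// b_linr//; ring.
have [C C0 HC] := b_bound Lu.
exists (h u + C) => v [Hv Lv]; apply: (le_trans (ler_normD _ _)).
have := a_le Hu Hv; have := HC v Lv; rewrite /=.
have := h_ge0 Hu; have := h_ge0 Hv; have := nF_ge0 Lv.
by move=> *; nra.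
Qed.

Lemma a_diff u v : H u -> H v -> a u (u - v) - a v (u - v) = h (u - v) ^+ 2.
Proof.
move=> Hu Hv; have Hw := H_sub Hu Hv; rewrite -a_diag// (a_sym u) (a_sym v).
have -> : a (u - v) (u - v) = a (u - v) (-1 *: v + u) by rewrite scaleN1r addrC.
by rewrite a_linr// mulN1r addrC.
Qed.

(** Tested on u - v, the equality makes a sum of two nonnegative terms vanish, one of which is the
    square of h. *)
Lemma sum_op_inj u v : carrier X u -> carrier X v ->
  (forall w, carrier X w -> sum_op u w = sum_op v w) -> h (u - v) = 0.
Proof.
move=> [Hu Lu] [Hv Lv] eq.
have Xw : carrier X (u - v) by split; [exact: H_sub|exact: L_sub].
have := eq _ Xw; rewrite /sum_op => e.
have := a_diff Hu Hv; have := b_mono Lu Lv => b0 ad.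
have : h (u - v) ^+ 2 = 0.
  by apply/eqP; rewrite eq_le sqr_ge0 andbT -ad; lra.
by move=> /eqP; rewrite sqrf_eq0 => /eqP.
Qed.

Lemma dual_sub l1 l2 : carrier (dual X) l1 -> carrier (dual X) l2 ->
  carrier (dual X) (l1 - l2).
Proof.
move=> [ll1 [C1 H1]] [ll2 [C2 H2]]; split.
  move=> k u v Xu Xv; have -> w : (l1 - l2) w = l1 w - l2 w by [].
  rewrite ll1// ll2//; have -> w : (l1 - l2) w = l1 w - l2 w by [].
  have -> : (l1 - l2) v = l1 v - l2 v by [].
  by ring.
exists (C1 + C2) => u Xu; have -> : (l1 - l2) u = l1 u - l2 u by [].
by rewrite mulrDl; apply: (le_trans (ler_normB _ _)); apply: lerD; [exact: H1|exact: H2].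
Qed.

Lemma sum_op_coercive u l : carrier X u -> carrier (dual X) l ->
  (forall v, carrier X v -> sum_op u v = l v) ->
  h u ^+ 2 + rho u <= snorm (dual X) l * snorm X u.
Proof.
move=> Xu Dl eq; have [Hu Lu] := Xu.
apply: (le_trans _ (le_trans (ler_norm _) (dual_norm_bound sumspace_quasinormed Dl Xu))).
by rewrite -eq// /sum_op a_diag// lerD2l rho_b.
Qed.

Section strongly_monotone.
Variable c : R.
Hypothesis c_gt0 : 0 < c.
Hypothesis b_strong : forall u v, L u -> L v ->
  c * rho (u - v) <= b u (u - v) - b v (u - v).

Lemma sum_op_strongly_monotone u v l l' : carrier X u -> carrier X v ->
  carrier (dual X) l -> carrier (dual X) l' ->
  (forall w, carrier X w -> sum_op u w = l w) ->
  (forall w, carrier X w -> sum_op v w = l' w) ->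
  h (u - v) ^+ 2 + c * rho (u - v) <= snorm (dual X) (l - l') * snorm X (u - v).
Proof.
move=> [Hu Lu] [Hv Lv] Dl Dl' eu ev.
have Xw : carrier X (u - v) by split; [exact: H_sub|exact: L_sub].
have Dll := dual_sub Dl Dl'.
apply: (le_trans _ (le_trans (ler_norm _) (dual_norm_bound sumspace_quasinormed Dll Xw))).
have -> : (l - l') (u - v) = l (u - v) - l' (u - v) by [].
rewrite -eu// -ev// /sum_op -a_diff//.
have := b_strong Lu Lv; lra.
Qed.

End strongly_monotone.

(* The superlinear growth of [rho] absorbs the [nF] part of the right-hand side. *)
Lemma coercive_bound (M c : R) : 0 <= M -> 0 < c -> exists2 B, 0 < B & forall u,
  carrier X u -> h u ^+ 2 + c * rho u <= M * snorm X u -> snorm X u <= B.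
Proof.
(* This choice makes M e <= c/2, so that M nF uses up at most half of c rho. *)
move=> M0 c0; pose e := c / 2 / (M + 1).
have M1 : 0 < M + 1 by rewrite ltr_wpDl.
have e0 : 0 < e by rewrite !divr_gt0.
have [C C0 HC] := nF_rho e0.
have eM : e * M <= c / 2.
  by rewrite /e (mulrAC (c / 2)) ler_pdivrMr// ler_wpM2l ?divr_ge0 ?(ltW c0)// lerDl.
(* With x = h u and y = rho u, what is left is x^2 + (c/2) y <= M x + M C; it forces x <= [B1] and
   then y <= [r]. *)
pose B1 := 1 + M + M * C.
pose r := 2 / c * (M * (B1 + C)).
have B10 : 0 <= B1 by rewrite /B1; have := mulr_ge0 M0 (ltW C0); lra.
have r0 : 0 <= r.
  apply: mulr_ge0; first by rewrite divr_ge0// ltW.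
  by apply: mulr_ge0 => //; rewrite addr_ge0// ltW.
exists (B1 + (e * r + C)).
  by have := mulr_ge0 (ltW e0) r0; lra.
move=> u [Hu Lu] /=; have hu := h_ge0 Hu; have ru := rho_ge0 Lu; have nu := nF_ge0 Lu.
have := HC u Lu; move: (h u) (rho u) (nF u) hu ru nu => x y z x0 y0 z0 zy H0.
have Mz : M * z <= c / 2 * y + M * C.
  apply: (le_trans (ler_wpM2l M0 zy)); rewrite mulrDr lerD2r mulrA ler_wpM2r//.
  by rewrite mulrC.
have H1 : x ^+ 2 + c / 2 * y <= M * x + M * C.
  by move: H0; rewrite mulrDr; lra.
have cy : 0 <= c / 2 * y by rewrite mulr_ge0// divr_ge0// ltW.
have xB : x <= B1.
  rewrite leNgt; apply/negP => Bx.
  have MC0 := mulr_ge0 M0 (ltW C0).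
  have x1 : 1 <= x by move: Bx; rewrite /B1; lra.
  have : M * C <= M * C * x by rewrite ler_peMr.
  have : (1 + M + M * C) * x <= x * x by rewrite ler_wpM2r// ltW.
  by move: H1; rewrite expr2; lra.
apply: lerD => //; apply: (le_trans zy); rewrite lerD2r ler_wpM2l ?(ltW e0)//.
rewrite /r; have -> : 2 / c * (M * (B1 + C)) = (M * (B1 + C)) / (c / 2).
  by field; rewrite gt_eqF.
rewrite ler_pdivlMr ?divr_gt0// mulrC.
have : M * x <= M * B1 by rewrite ler_wpM2l.
by have := sqr_ge0 x; move: H1; rewrite (mulrDr M B1 C); lra.
Qed.

Lemma small_bound (c e : R) : 0 < c -> 0 < e -> exists2 de, 0 < de & forall u N,
  carrier X u -> N < de -> h u ^+ 2 + c * rho u <= N * snorm X u -> snorm X u < e.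
Proof.
move=> c0 e0; have [B B0 HB] := coercive_bound ler01 c0.
have e4 : 0 < e / 4 by rewrite divr_gt0.
have [eta eta0 Heta] := nF_small e4.
(* N < 1 first confines u to norm at most B; the other two bounds then make the right-hand side at
   most (e/4)^2, which serves for h, and at most c eta, which serves for rho. *)
pose de := Num.min 1 (Num.min ((e / 4) ^+ 2 / B) (c * eta / B)).
exists de; first by rewrite !lt_min ltr01 !divr_gt0// ?exprn_gt0// mulr_gt0.
move=> u N Xu; rewrite !lt_min => /and3P[N1 N2 N3] H0.
have [Hu Lu] := Xu; have Xu0 : 0 <= snorm X u.
  by rewrite /= addr_ge0 ?h_ge0 ?nF_ge0.
have uB : snorm X u <= B.
  by apply: HB => //; apply: (le_trans H0); rewrite ler_wpM2r// ltW.
have ru := rho_ge0 Lu; have hu := h_ge0 Hu; have cr : 0 <= c * rho u by rewrite mulr_ge0// ltW.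
have H1 k : 0 <= k -> N < k / B -> h u ^+ 2 + c * rho u <= k.
  move=> k0 Nk; apply: (le_trans H0); apply: (@le_trans _ _ (k / B * snorm X u)).
    by rewrite ler_wpM2r// ltW.
  by rewrite mulrAC ler_pdivrMr// ler_wpM2l.
have he : h u <= e / 4.
  rewrite -(ler_pXn2r (n := 2))// ?nnegrE ?(ltW e4)//.
  have := H1 _ (sqr_ge0 (e / 4)) N2; lra.
have ne : nF u <= e / 4.
  apply: Heta => //; rewrite -(ler_pM2l c0).
  have := H1 _ (mulr_ge0 (ltW c0) (ltW eta0)) N3; have := sqr_ge0 (h u); lra.
by rewrite /=; lra.
Qed.

Section inverse.
Variable Ainv : (E -> R) -> E.
Hypothesis Ainv_carrier : forall l, carrier (dual X) l -> carrier X (Ainv l).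
Hypothesis AinvK : forall l, carrier (dual X) l ->
  forall v, carrier X v -> sum_op (Ainv l) v = l v.

Lemma inverse_bounded : bounded_op (dual X) X Ainv.
Proof.
split => // A [AD [M HM]]; have M0 : 0 <= `|M| by [].
have [B B0 HB] := coercive_bound M0 ltr01.
split; first by move=> _ [l Al <-]; exact/Ainv_carrier/AD.
exists B => _ [l Al <-]; have Dl := AD _ Al; have Xl := Ainv_carrier Dl.
apply: HB => //; rewrite mul1r.
apply: (le_trans (sum_op_coercive Xl Dl (AinvK Dl))).
apply: ler_wpM2r; first exact: (qn_ge0 (qns_quasinorm sumspace_quasinormed)).
exact: (le_trans (HM _ Al) (ler_norm _)).
Qed.

Lemma inverse_continuous (c : R) : 0 < c ->
  (forall u v, L u -> L v -> c * rho (u - v) <= b u (u - v) - b v (u - v)) ->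
  continuous_op (dual X) X Ainv.
Proof.
move=> c0 bc; split => // l e Dl e0; have [de de0 Hde] := small_bound c0 e0.
exists de => // l' Dl' ll'.
apply: Hde ll' _; last first.
  apply: sum_op_strongly_monotone => //; [exact: Ainv_carrier|exact: Ainv_carrier|exact: AinvK|exact: AinvK].
by apply: (qn_sub (qns_quasinorm sumspace_quasinormed)); exact: Ainv_carrier.
Qed.

End inverse.
End monotone_operator.

(** * Pairing with Lebesgue functions *)

Section pairing.
Context d (T : measurableType d) (R : realType).
Variables (mu : {measure set T -> \bar R}) (Omega : set T).
Hypothesis mO : measurable Omega.
Hypothesis fO : (mu Omega < +oo)%E.
Variables (lam : nat -> R) (phi : nat -> T -> R) (theta : R).
Local Notation L2 := (sq_integrable mu Omega).
Local Notation ip := (dotp mu Omega).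
Hypothesis lam_gt0 : forall k, 0 < lam k.
Hypothesis lam_nd : forall k, lam k <= lam k.+1.
Hypothesis lam_cvg : lam k @[k --> \oo] --> +oo.
Hypothesis Lphi : forall k, L2 (phi k).
Hypothesis phi_on : forall k l, ip (phi k) (phi l) = (k == l)%:R.
Hypothesis phi_complete : forall u, L2 u ->
  snorm (gLp mu Omega 2%:E) (u - \sum_(k < m) ip u (phi k) *: phi k)
    @[m --> \oo] --> (0 : R).
Hypothesis theta_gt0 : 0 < theta.
Local Notation Hs := (carrier (gHs mu Omega lam phi theta)).
Local Notation hn u := (snorm (gHs mu Omega lam phi theta) u).
Local Notation Lp p := (gLp mu Omega p).

Variable X : seminormed R (T -> R).
Hypothesis qX : quasinormed_space X.
Hypothesis X_Hs : forall v, carrier X v -> Hs v /\ hn v <= snorm X v.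
Variables (q Cq : R) (r : \bar R).
Hypothesis q1 : 1 < q.
Hypothesis qr : ((q / (q - 1))%:E < r)%E.
Hypothesis Cq_gt0 : 0 < Cq.
Hypothesis X_Lq : forall v, carrier X v ->
  carrier (Lp q%:E) v /\ snorm (Lp q%:E) v <= Cq * snorm X v.
Implicit Types (z v w : T -> R).

Local Notation p := (q / (q - 1)).

Let q0 : 0 < q. Proof. exact: lt_trans q1. Qed.
Let p1 : 1 <= p.
Proof. by rewrite ler_pdivlMr ?subr_gt0// mul1r gerBl. Qed.
Let p0 : 0 < p. Proof. exact: lt_le_trans p1. Qed.
Let pq : p^-1 + q^-1 = 1.
Proof. by field; rewrite gt_eqF//= subr_eq0 gt_eqF. Qed.
Let r1 : (1 <= r)%E.
Proof. by apply: le_trans (ltW qr); rewrite lee_fin. Qed.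

Lemma pairing_Lp z v : carrier (Lp p%:E) z -> carrier X v ->
  mu.-integrable Omega (EFin \o (fun x => z x * v x)) /\
  `|ip z v| <= snorm (Lp p%:E) z * (Cq * snorm X v).
Proof.
move=> Lz Xv; have [Lv vq] := X_Lq Xv.
have [i H] := Lp_hoelder mO p0 q0 pq Lz Lv; split => //.
by apply: (le_trans H); apply: ler_wpM2l => //; exact: Lp_snorm_ge0.
Qed.

Lemma pairing_linear z : carrier (Lp p%:E) z -> linear_on X (ip z).
Proof.
move=> Lz k u v Xu Xv; have [iu _] := pairing_Lp Lz Xu; have [iv _] := pairing_Lp Lz Xv.
rewrite /dotp -Rintegral_lin//; apply: eq_Rintegral => x _.
rewrite -[(k *: u + v) x]/(k * u x + v x); ring.
Qed.

Lemma pairing_sub z z' v : carrier (Lp p%:E) z -> carrier (Lp p%:E) z' ->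
  carrier X v -> ip z v - ip z' v = ip (z - z') v.
Proof.
move=> Lz Lz' Xv; have [i _] := pairing_Lp Lz Xv; have [i' _] := pairing_Lp Lz' Xv.
rewrite /dotp -RintegralB//; apply: eq_Rintegral => x _.
rewrite -[(z - z') x]/(z x - z' x); ring.
Qed.

Lemma pairing_bounded : exists2 C : R, 0 < C & forall z v, carrier (Lp r) z ->
  carrier X v -> carrier (Lp p%:E) z /\
  `|ip z v| <= C * snorm (Lp r) z * snorm X v.
Proof.
have [C C0 HC] := Lp_embed mO fO p0 (ltW qr).
exists (C * Cq); first exact: mulr_gt0.
move=> z v Lz Xv; have [Lpz zp] := HC z Lz; split => //.
have [_ H] := pairing_Lp Lpz Xv; apply: (le_trans H).
have XN := qn_ge0 (qns_quasinorm qX) Xv.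
rewrite (_ : C * Cq * _ * _ = C * snorm (Lp r) z * (Cq * snorm X v)); last ring.
by rewrite ler_wpM2r// mulr_ge0// ltW.
Qed.

Lemma pairing_dual z : carrier (Lp r) z -> carrier (dual X) (ip z).
Proof.
move=> Lz; have [C C0 HC] := pairing_bounded; split.
  have [C' _ HC'] := Lp_embed mO fO p0 (ltW qr).
  have [Lpz _] := HC' z Lz; exact: pairing_linear.
by exists (C * snorm (Lp r) z) => v Xv; exact: (HC z v Lz Xv).2.
Qed.

Lemma Lp_sub z z' : carrier (Lp r) z -> carrier (Lp r) z' -> carrier (Lp r) (z - z').
Proof. by move=> Lz Lz'; exact: (Lp_add mO r1 Lz (Lp_opp Lz').1).1. Qed.

Lemma pairing_lipschitz : exists2 C : R, 0 < C & forall z z',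
  carrier (Lp r) z -> carrier (Lp r) z' ->
  snorm (dual X) (ip z - ip z') <= C * snorm (Lp r) (z - z').
Proof.
have [C C0 HC] := pairing_bounded; exists C => // z z' Lz Lz'.
have Lzz := Lp_sub Lz Lz'.
have N0 := Lp_snorm_ge0 mu Omega r (z - z').
have CN : 0 <= C * snorm (Lp r) (z - z') by rewrite mulr_ge0// ltW.
apply: dual_norm_le => // v Xv v1.
have [Lpz _] := HC z v Lz Xv; have [Lpz' _] := HC z' v Lz' Xv.
have -> : (ip z - ip z') v = ip (z - z') v by rewrite -pairing_sub.
have [_ H] := HC (z - z') v Lzz Xv; apply: (le_trans H).
by rewrite ler_piMr.
Qed.

Lemma L2_truncation (M : R) z : 0 < M -> measurable_fun Omega z ->
  L2 (truncation M z) /\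
  ip (truncation M z) (truncation M z) <= M ^+ 2 * fine (mu Omega).
Proof.
move=> M0 mz; have mt := measurable_truncation mO M mz.
have bd x : truncation M z x ^+ 2 <= M ^+ 2.
  rewrite /truncation; case: ifPn => h; last by rewrite expr0n sqr_ge0.
  by rewrite -(real_normK (num_real (z x))) ler_pXn2r ?nnegrE// ltW.
have it : mu.-integrable Omega (EFin \o (fun x => truncation M z x ^+ 2)).
  apply: (ae_le_integrable mO _ (intble_cst mO fO (M ^+ 2))).
    exact: measurable_funX.
  by apply: aeW => x _; rewrite ger0_norm ?sqr_ge0// bd.
split; first by split.
rewrite -Rint_cst//; apply: le_Rintegral => //; last by move=> x _; rewrite -expr2 bd.
exact: intble_cst.
Qed.

(** [spectral_tail] with m = 0 and z = phi_k, whose L^2 norm is 1. *)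
Lemma coef_bound v k : Hs v -> hn v <= 1 ->
  `|ip (phi k) v| <= Num.sqrt (lam 0%N `^ theta)^-1.
Proof.
move=> Hv v1; have := spectral_tail mO fO lam_gt0 lam_nd Lphi phi_on phi_complete theta_gt0 0 (Lphi k) Hv.
rewrite big_ord0 subr0 nrmE// phi_on eqxx sqrtr1 mul1r.
by move=> /le_trans; apply; rewrite ler_piMr// sqrtr_ge0.
Qed.

Lemma lam_powR_large (B : R) : exists m, B <= lam m `^ theta.
Proof.
pose b := (`|B| + 1) `^ theta^-1.
have /cvgryPge /(_ b) [m _ /(_ m (leqnn _)) /= bm] := lam_cvg.
exists m; apply: (@le_trans _ _ (b `^ theta)).
  rewrite /b -powRrM mulVf ?gt_eqF// powRr1 ?addr_ge0//.
  by rewrite (le_trans (ler_norm _))// lerDl.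
apply: ge0_ler_powR => //; rewrite ?nnegrE; first exact: ltW.
  exact: powR_ge0.
exact: ltW.
Qed.

(* The low modes of the truncated function decide the pairing up to [eps]: [c]
   rounds them to multiples of [eta]. *)
Lemma pairing_totally_bounded (A : set (T -> R)) (eps : R) :
  sn_bounded (Lp r) A -> 0 < eps ->
  exists (I : finType) (c : (T -> R) -> I), forall z z', A z -> A z' -> c z = c z' ->
    forall v, carrier X v -> snorm X v <= 1 -> `|ip z v - ip z' v| <= eps.
Proof.
move=> [AL [K0 HK0]] e0; pose K := `|K0| + 1.
have Kp : 0 < K by rewrite ltr_wpDl.
have HK z : A z -> snorm (Lp r) z <= K.
  by move=> Az; apply: (le_trans (HK0 _ Az)); rewrite (le_trans (ler_norm _))// lerDl.
(* The error is a sum of five terms of size [e8]: a truncation and a tail of modes for each of z and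
   z', and the difference of the low modes. *)
pose e8 := eps / 8; have e80 : 0 < e8 by rewrite divr_gt0.
pose e1 := e8 / Cq; have e10 : 0 < e1 by rewrite divr_gt0.
have ep0 : 0 < e1 `^ p by rewrite powR_gt0.
have [M M0 HM] := truncation_tail mO fO p0 qr Kp ep0.
pose D := Num.sqrt (M ^+ 2 * fine (mu Omega)) + 1.
have D0 : 0 < D by rewrite ltr_wpDl ?sqrtr_ge0.
have De : 0 < D / e8 by rewrite divr_gt0.
(* From this mode on, the tail is at most [D] times e8 / D. *)
have [m Hm] := lam_powR_large ((D / e8) ^+ 2).
pose V := Num.sqrt (lam 0%N `^ theta)^-1 + 1.
have V0 : 0 < V by rewrite ltr_wpDl ?sqrtr_ge0.
(* A coefficient error [eta] times the bound [V] on the coefficients of v, summed over m modes,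
   stays below [e8]; m + 1 avoids dividing by 0. *)
pose eta := e8 / m.+1%:R / V.
have eta0 : 0 < eta by rewrite !divr_gt0.
(* The shift by D makes g nonnegative, and then g <= 2 D / eta < N, so [inord] loses nothing. *)
pose N := (Num.truncn (2 * D / eta)).+1.
pose t (z : T -> R) : T -> R := truncation M z.
pose g z k := (ip (t z) (phi k) + D) / eta.
exists {ffun 'I_m -> 'I_N.+1}, (fun z => [ffun k : 'I_m => inord (Num.truncn (g z k))]).
have Lt z : A z -> [/\ L2 (t z), Num.sqrt (ip (t z) (t z)) <= D &
    forall v, carrier X v -> snorm X v <= 1 -> `|ip z v - ip (t z) v| <= e8].
  move=> Az; have [mz _] := AL _ Az.
  have [Lt bt] := L2_truncation M0 mz; split => //.
    by apply: (@le_trans _ _ (Num.sqrt (M ^+ 2 * fine (mu Omega)))); [rewrite ler_wsqrtr|rewrite lerDl].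
  move=> v Xv v1; have [it bit] := HM z (AL _ Az) (HK _ Az).
  have Lzt : carrier (Lp p%:E) (z - t z).
    apply/Lp_carrierP => //; split => //.
    by apply: measurable_funB => //; exact: measurable_truncation.
  have [_ H] := pairing_Lp Lzt Xv.
  have nz : snorm (Lp p%:E) (z - t z) <= e1 by apply/Lp_snorm_le => //; exact: ltW.
  have [Hv hv] := X_Hs Xv.
  have [C _ HC] := pairing_bounded; have [Lpz _] := HC z v (AL _ Az) Xv.
  have [izv _] := pairing_Lp Lpz Xv.
  have itv := ip_integrable mO Lt (Hs_L2 mO Hv).
  have -> : ip z v - ip (t z) v = ip (z - t z) v.
    rewrite /dotp -RintegralB//; apply: eq_Rintegral => x _.
    rewrite -[(z - t z) x]/(z x - t z x); ring.
  apply: (le_trans H); apply: (@le_trans _ _ (e1 * (Cq * 1))).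
    apply: ler_pM => //; first exact: Lp_snorm_ge0.
      by rewrite mulr_ge0 ?(ltW Cq_gt0)// (qn_ge0 (qns_quasinorm qX)).
    by rewrite ler_wpM2l// ltW.
  by rewrite mulr1 /e1 divfK// gt_eqF.
have coefD z k : A z -> `|ip (t z) (phi k)| <= D.
  move=> Az; have [Ltz bz _] := Lt z Az.
  apply: (le_trans (ip_cauchy_sqrt mO Ltz (Lphi k))).
  by rewrite phi_on eqxx sqrtr1 mulr1.
have g_lt z k : A z -> 0 <= g z k /\ (Num.truncn (g z k) <= N)%N.
  move=> Az; have := coefD z k Az; rewrite ler_norml => /andP[h1 h2].
  have g0 : 0 <= g z k by rewrite divr_ge0 ?(ltW eta0)//; lra.
  split => //; rewrite /N leqW// le_truncn// /g ler_pM2r ?invr_gt0//; lra.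
have low z z' k : A z -> A z' -> (k < m)%N ->
    [ffun k : 'I_m => inord (Num.truncn (g z k)) : 'I_N.+1] =
    [ffun k : 'I_m => inord (Num.truncn (g z' k)) : 'I_N.+1] ->
    `|ip (t z) (phi k) - ip (t z') (phi k)| <= eta.
  move=> Az Az' km /ffunP /(_ (Ordinal km)); rewrite !ffunE /= => /(congr1 val) /=.
  have [g0 gN] := g_lt z k Az; have [g0' gN'] := g_lt z' k Az'.
  rewrite !inordK// => eqt.
  have /andP[a1 a2] := truncn_itv g0; have /andP[b1 b2] := truncn_itv g0'.
  rewrite eqt in a1 a2.
  have : `|g z k - g z' k| <= 1.
    by move: a2 b2; rewrite -natr1 => a2 b2; rewrite ler_norml; apply/andP; split; lra.
  rewrite /g -mulrBl normrM normfV (gtr0_norm eta0) ler_pdivrMr// mul1r.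
  by rewrite opprD addrACA subrr addr0.
move=> z z' Az Az' czz v Xv v1.
have [Hv hv1] := X_Hs Xv; have hv := le_trans hv1 v1.
have tail w : A w -> `|ip (t w) v - \sum_(k < m) ip (t w) (phi k) * ip v (phi k)| <= e8.
  move=> Aw; have [Lw bw _] := Lt w Aw.
  have := spectral_tail mO fO lam_gt0 lam_nd Lphi phi_on phi_complete theta_gt0 m Lw Hv.
  move=> /le_trans; apply; rewrite nrmE//.
  have lm0 : 0 < lam m `^ theta by rewrite powR_gt0.
  apply: (@le_trans _ _ (D * (e8 / D))); last by rewrite mulrC divfK// gt_eqF.
  apply: ler_pM => //; rewrite ?sqrtr_ge0//.
    by rewrite mulr_ge0 ?sqrtr_ge0.
  apply: (@le_trans _ _ (Num.sqrt (lam m `^ theta)^-1)).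
    by rewrite ler_piMr// sqrtr_ge0.
  apply: (@le_trans _ _ (Num.sqrt ((e8 / D) ^+ 2))); last first.
    by rewrite sqrtr_sqr gtr0_norm// divr_gt0.
  apply: ler_wsqrtr; rewrite -(invf_div D e8) exprVn lef_pV2 ?posrE//.
  exact: exprn_gt0.
have [_ _ /(_ v Xv v1) tz] := Lt z Az; have [_ _ /(_ v Xv v1) tz'] := Lt z' Az'.
have sz := tail z Az; have sz' := tail z' Az'.
have sum : `|\sum_(k < m) ip (t z) (phi k) * ip v (phi k) -
    \sum_(k < m) ip (t z') (phi k) * ip v (phi k)| <= e8.
  rewrite -sumrB; apply: (le_trans (ler_norm_sum _ _ _)).
  apply: (@le_trans _ _ (\sum_(k < m) eta * V)).
    apply: ler_sum => k _; rewrite -mulrBl normrM; apply: ler_pM => //.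
      exact: low.
    by rewrite (ip_sym _ _ v); apply: (le_trans (coef_bound k Hv hv)); rewrite lerDl.
  rewrite sumr_const card_ord -mulr_natr /eta divfK ?gt_eqF//.
  by rewrite mulrAC ler_pdivrMr// ler_wpM2l ?(ltW e80)// ler_nat.
have e8E : eps = 8 * e8 by rewrite /e8; field.
rewrite e8E.
move: tz tz' sz sz' sum; rewrite !ler_norml.
move: (ip z v) (ip (t z) v) (ip z' v) (ip (t z') v) => x1 x2 x3 x4.
by move=> /andP[? ?] /andP[? ?] /andP[? ?] /andP[? ?] /andP[? ?]; apply/andP; split; lra.
Qed.

End pairing.

(** * The operator [A_F] over a general measure space *)

Lemma Lp_quasinorm d (T : measurableType d) (R : realType)
    (mu : {measure set T -> \bar R}) (Omega : set T) (p : R) :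
  measurable Omega -> 1 <= p -> quasinorm (gLp mu Omega p%:E).
Proof.
move=> mO p1; have p1' : (1 <= p%:E)%E by [].
split.
- by move=> u v Lu Lv; exact: (Lp_add mO p1' Lu (Lp_opp Lv).1).1.
- by move=> u _; exact: Lp_snorm_ge0.
- by move=> u Lu; exact: (Lp_opp Lu).2.
- exists 1 => // u v Lu Lv; rewrite mul1r.
  exact: (Lp_add mO p1' Lu Lv).2.
Qed.

Section concrete.
Context d (T : measurableType d) (R : realType).
Variables (mu : {measure set T -> \bar R}) (Omega : set T).
Hypothesis mO : measurable Omega.
Hypothesis mu_complete : measure_is_complete mu.
Hypothesis fO : (mu Omega < +oo)%E.
Variables (lam : nat -> R) (phi : nat -> T -> R) (theta : R).
Local Notation L2 := (sq_integrable mu Omega).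
Local Notation ip := (dotp mu Omega).
Hypothesis lam_gt0 : forall k, 0 < lam k.
Hypothesis lam_nd : forall k, lam k <= lam k.+1.
Hypothesis lam_cvg : lam k @[k --> \oo] --> +oo.
Hypothesis Lphi : forall k, L2 (phi k).
Hypothesis phi_on : forall k l, ip (phi k) (phi l) = (k == l)%:R.
Hypothesis phi_complete : forall u, L2 u ->
  snorm (gLp mu Omega 2%:E) (u - \sum_(k < m) ip u (phi k) *: phi k)
    @[m --> \oo] --> (0 : R).
Hypothesis theta_gt0 : 0 < theta.
Variables (f F : T -> R -> R) (c1 c2 : R).
Hypotheses (c1P : 0 < c1 <= 1) (c2P : 0 < c2 <= 1).
Hypothesis fF : {ae mu, forall x, Omega x -> orlicz_pair c1 c2 (f x) (F x)}.
Hypothesis F_even : forall x t, F x (- t) = F x t.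
Hypothesis mf : forall u, measurable_fun Omega u ->
  measurable_fun Omega (fun x => f x (u x)).
Hypothesis mF : forall u, measurable_fun Omega u ->
  measurable_fun Omega (fun x => F x (u x)).
Hypothesis f_mono : {ae mu, forall x, Omega x ->
  forall xi eta, 0 <= (f x xi - f x eta) * (xi - eta)}.

Local Notation sHs := (gHs mu Omega lam phi theta).
Local Notation sLF := (gLF mu Omega F).
Local Notation rho := (modular mu Omega F).
Local Notation W := (gLDpow mu Omega lam phi (theta / 2)).
Local Notation Lp p := (gLp mu Omega p).

Definition nemytskii_form (u v : T -> R) : R := \int[mu]_(x in Omega) (f x (u x) * v x).
Local Notation b := nemytskii_form.
Local Notation a := (hform mu Omega W).

Let W_spec u (Hu : carrier sHs u) :=
  LDpow_spec mO mu_complete fO Lphi phi_on Hu.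

Lemma nemytskii_form_diff (u v w : T -> R) :
  carrier sLF u -> carrier sLF v -> carrier sLF w ->
  mu.-integrable Omega (EFin \o (fun x => (f x (u x) - f x (v x)) * w x)) /\
  b u w - b v w = \int[mu]_(x in Omega) ((f x (u x) - f x (v x)) * w x).
Proof.
move=> Lu Lv Lw.
have [iu _] := nemytskii_integrable mO fF mf Lu Lw.
have [iv _] := nemytskii_integrable mO fF mf Lv Lw.
split.
  by apply: (intble_eq _ (intbleB mO iu iv)) => x; rewrite mulrBl.
rewrite /nemytskii_form -RintegralB//; apply: eq_Rintegral => x _.
by rewrite mulrBl.
Qed.

Lemma concrete_data : monotone_data (carrier sHs) (carrier sLF) (snorm sHs)
  (snorm sLF) rho a b.
Proof.
split.
- by move=> k u v; exact: (Hs_lin mO Lphi).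
- by move=> k u v; exact: (LF_lin mO c1P fF mF).
- by move=> u _; exact: Hs_snorm_ge0.
- by move=> k u Hu; exact: (Hs_scale mO Lphi k Hu).2.
- move=> u v; exact: (Hs_triangle mO fO Lphi phi_complete W_spec).
- move=> k u v w; exact: (hform_linr mO fO Lphi phi_complete W_spec).
- by move=> u v; exact: hform_sym.
- move=> u; exact: (hform_diag mO fO Lphi phi_complete W_spec).
- move=> u v; exact: (hform_le mO fO Lphi phi_complete W_spec).
- by move=> u; exact: (luxemburg_ge0 mO c1P fF mF).
- by move=> k u k0 Lu; exact: (luxemburg_scale_le mO c1P fF mF Lu k0).
- by move=> u _; exact: luxemburg_opp.
- have [C C0 HC] := luxemburg_quasi_triangle mO c1P c2P fF mF.
  by exists C => // u v; exact: HC.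
- move=> k u v w Lu Lv Lw.
  have [iu _] := nemytskii_integrable mO fF mf Lw Lu.
  have [iv _] := nemytskii_integrable mO fF mf Lw Lv.
  rewrite /nemytskii_form -Rintegral_lin//; apply: eq_Rintegral => x _.
  rewrite -[(k *: u + v) x]/(k * u x + v x); ring.
- by move=> u; exact: (nemytskii_bounded mO c1P fF mf mF).
- by move=> u; exact: (modular_ge0 mO fF).
- by move=> u; exact: (modular_le_nemytskii mO fF mf).
- move=> u v Lu Lv; have Luv := LF_lin mO c1P fF mF (-1) Lv Lu.
  have Lw : carrier sLF (u - v).
    rewrite (_ : u - v = fun x => -1 * v x + u x)//.
    by apply/funext => x; rewrite mulN1r addrC.
  have [i ->] := nemytskii_form_diff Lu Lv Lw.
  have i0 := intble_cst mO fO 0.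
  rewrite -[leLHS](_ : \int[mu]_(x in Omega) cst 0 x = 0); last first.
    by rewrite Rint_cst// mul0r.
  by apply: ae_le_Rintegral => //; apply: filterS f_mono => x /[apply]; exact.
- by move=> e e0; exact: (luxemburg_le_modular mO c1P c2P fF mF e0).
- by move=> e e0; exact: (luxemburg_small mO c1P fF mF e0).
Qed.

Lemma nemytskii_strong (c : R) : 0 < c ->
  {ae mu, forall x, Omega x -> forall xi eta,
    c * F x (xi - eta) <= (f x xi - f x eta) * (xi - eta)} ->
  forall u v, carrier sLF u -> carrier sLF v ->
    c * rho (u - v) <= b u (u - v) - b v (u - v).
Proof.
move=> c0 H u v Lu Lv.
have Lw : carrier sLF (u - v) := L_sub concrete_data Lu Lv.
have [i ->] := nemytskii_form_diff Lu Lv Lw.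
rewrite /modular -RintegralZl//; last by case: Lw.
apply: ae_le_Rintegral => //.
  by apply: intbleZ => //; case: Lw.
by apply: filterS H => x /[apply]; exact.
Qed.

Local Notation V0 := (sumspace (carrier sHs) (carrier sLF) (snorm sHs) (snorm sLF)).
Local Notation A := (sum_op a b).

Lemma concrete_injective u1 u2 : carrier V0 u1 -> carrier V0 u2 ->
  (forall v, carrier V0 v -> A u1 v = A u2 v) -> u1 = u2 %[ae mu in Omega].
Proof.
move=> V1 V2 eq; have h0 := sum_op_inj concrete_data V1 V2 eq.
have Hw : carrier sHs (u1 - u2) := H_sub concrete_data V1.1 V2.1.
have := Hs_null mO fO lam_gt0 Lphi phi_complete Hw h0.
apply: filterS => x /[apply] H.
by apply/eqP; rewrite -subr_eq0; apply/eqP.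
Qed.

(** [growth] acts through strong monotonicity, [crit] through q >= 1 and the embedding into L^q,
    hence both are abstract here. *)
Theorem concrete_inverse (growth : Prop) (crit : R -> Prop) :
  (growth -> exists2 c : R, 0 < c & {ae mu, forall x, Omega x -> forall xi eta,
    c * F x (xi - eta) <= (f x xi - f x eta) * (xi - eta)}) ->
  (forall q, crit q -> 1 <= q) ->
  (forall q, crit q -> exists C : R, forall u, carrier sHs u ->
     carrier (Lp q%:E) u /\ snorm (Lp q%:E) u <= C * snorm sHs u) ->
  (forall l, carrier (dual V0) l ->
    exists2 u, carrier V0 u & forall v, carrier V0 v -> A u v = l v) ->
  exists Ainv : ((T -> R) -> R) -> (T -> R),
    [/\ forall l, carrier (dual V0) l ->
          forall v, carrier V0 v -> A (Ainv l) v = l v,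
        forall u, carrier V0 u -> Ainv (A u) = u %[ae mu in Omega],
        bounded_op (dual V0) V0 Ainv &
        growth ->
          continuous_op (dual V0) V0 Ainv /\
          forall (q : R) (r : \bar R), crit q ->
            (hoelder_conjugate q%:E < r)%E ->
            [/\ maps_into (Lp r) (dual V0) ip,
                compact_op (Lp r) V0 (Ainv \o ip) &
                forall p : R, 1 < p < q ->
                  compact_op (Lp r) (Lp p%:E) (Ainv \o ip)]].
Proof.
move=> Hgrowth crit1 Hemb Hsurj; have D := concrete_data.
have qV := sumspace_quasinormed D.
have [Ainv HA] : {Ainv : ((T -> R) -> R) -> (T -> R) & forall l,
    carrier (dual V0) l -> carrier V0 (Ainv l) /\
      forall v, carrier V0 v -> A (Ainv l) v = l v}.
  apply: (@choice _ _ (fun l u => carrier (dual V0) l -> carrier V0 u /\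
      forall v, carrier V0 v -> A u v = l v)) => l.
  (* Outside the dual the inverse takes an arbitrary value. *)
  have [Dl|nDl] := pselect (carrier (dual V0) l); last by exists (cst 0).
  by have [u Vu Hu] := Hsurj l Dl; exists u.
have Ac l (Dl : carrier (dual V0) l) := (HA l Dl).1.
have AK l (Dl : carrier (dual V0) l) := (HA l Dl).2.
exists Ainv; split.
- exact: AK.
- move=> u Vu; have Du := sum_op_dual D Vu.
  by apply: concrete_injective => //; [exact: Ac|exact: AK].
- exact: (inverse_bounded D Ac AK).
move=> gr; have [c c0 Hc] := Hgrowth gr.
have cont : continuous_op (dual V0) V0 Ainv.
  exact: (inverse_continuous D Ac AK c0 (nemytskii_strong c0 Hc)).
split=> // q r qcrit qr.
(* For q = 1 the conjugate exponent is +oo and no r lies above it. *)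
have q1 : 1 < q.
  rewrite lt_neqAle (crit1 _ qcrit) andbT; apply/negP => /eqP q1.
  by move: qr; rewrite -q1 hoelder_conjugate1 ltNge leey.
have qcE : (hoelder_conjugate q%:E = (q / (q - 1))%:E)%E.
  rewrite /hoelder_conjugate/= eqe gt_eqF ?(lt_trans ltr01)//.
  by rewrite -EFinD inver subr_eq0 gt_eqF// -EFinM.
rewrite qcE in qr.
have [C HC] := Hemb _ qcrit.
have C0 : 0 < `|C| + 1 by rewrite ltr_wpDl.
have V_Hs v : carrier V0 v -> carrier sHs v /\ snorm sHs v <= snorm V0 v.
  by move=> [Hv Lv]; split => //; rewrite /= lerDl; exact: (md_nF_ge0 D).
have V_Lq v : carrier V0 v -> carrier (Lp q%:E) v /\
    snorm (Lp q%:E) v <= (`|C| + 1) * snorm V0 v.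
  move=> Vv; have [Hv hv] := V_Hs v Vv; have [Lv vC] := HC v Hv; split => //.
  have h0 : 0 <= snorm sHs v by exact: Hs_snorm_ge0.
  apply: (le_trans vC); apply: (@le_trans _ _ ((`|C| + 1) * snorm sHs v)).
    by rewrite ler_wpM2r// (le_trans (ler_norm _))// lerDl.
  by rewrite ler_wpM2l// ltW.
have ipD z : carrier (Lp r) z -> carrier (dual V0) (ip z).
  exact: (pairing_dual mO fO qV q1 qr C0 V_Lq).
(* The source side is the same for both targets; what changes is the continuity of the inverse into
   Y. *)
have compact (Y : seminormed R (T -> R)) : quasinorm Y ->
    continuous_op (dual V0) Y Ainv -> compact_op (Lp r) Y (Ainv \o ip).
  move=> qY [YA cY]; split; first split.
  - by move=> z Lz; exact/YA/ipD.
  - move=> z e Lz e0; have [de de0 Hde] := cY _ _ (ipD z Lz) e0.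
    have [K K0 HK] := pairing_lipschitz mO fO qV q1 qr C0 V_Lq.
    exists (de / K); first by rewrite divr_gt0.
    move=> y Ly yz; apply: Hde; first exact: ipD.
    by apply: (le_lt_trans (HK y z Ly Lz)); rewrite -ltr_pdivlMl// mulrC.
  move=> S bS; apply: (totally_bounded_relatively_compact qV qY) => //.
  - by move=> z Sz; apply: ipD; case: bS => + _; exact.
  - move=> e e0; exact: (pairing_totally_bounded mO fO lam_gt0 lam_nd lam_cvg
      Lphi phi_on phi_complete theta_gt0 qV V_Hs q1 qr C0 V_Lq bS e0).
split => //; first exact: (compact _ (qns_quasinorm qV) cont).
move=> p /andP[p1 pq]; have p0 : 0 < p by rewrite (lt_trans ltr01).
have pqE : (p%:E <= q%:E)%E by rewrite lee_fin ltW.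
have [K K0 HK] := Lp_embed mO fO p0 pqE.
(* Continuity into L^p is composed of continuity into V_0 and the embeddings of V_0 into L^q and of
   L^q into L^p, the measure being finite. *)
apply: compact; first exact: (Lp_quasinorm mu mO (ltW p1)).
split; first by move=> l /Ac /V_Lq [/HK []].
move=> l e Dl e0; pose k := K * (`|C| + 1).
have k0 : 0 < k by rewrite mulr_gt0.
have ek : 0 < e / k by rewrite divr_gt0.
have [de de0 Hde] := cont.2 l (e / k) Dl ek.
exists de => // y Dy yl.
have Vd := qn_sub (qns_quasinorm qV) (Ac y Dy) (Ac l Dl).
have [Lq Hq] := V_Lq _ Vd; have [_ Hp] := HK _ Lq.
apply: (le_lt_trans Hp); apply: (le_lt_trans (ler_wpM2l (ltW K0) Hq)).
by rewrite mulrA -ltr_pdivlMl// mulrC Hde.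
Qed.

End concrete.

(** * From assumption (A) and the eigenbasis to the general setting *)

Lemma assumption_orlicz_pair (R : realType) (f : R -> R) (c1 c2 : R) :
  0 < c1 <= 1 -> 0 < c2 <= 1 ->
  (forall t, f (- t) = - f t) -> {homo f : t t' / t < t'} -> continuous f ->
  f 0 = 0 -> f t @[t --> +oo] --> +oo ->
  let F t := \int[lebesgue_measure]_(tau in `[0, `|t|]%classic) f tau in
  let h := 'pinv_(fun=> 0) setT f in
  (forall t, c1 * (t * f t) <= F t <= t * f t) ->
  (forall t, c2 * (t * h t) <=
     \int[lebesgue_measure]_(tau in `[0, `|t|]%classic) h tau <= t * h t) ->
  orlicz_pair c1 c2 f F.
Proof.
move=> c1P c2P fo fi fc f0 fp F h HF Hh; split.
- exact: (F_ge0 fi f0).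
- exact: (F_homo fi f0).
- exact: (F_dilate fo fi f0 c1P HF).
- exact: (F_contract fo fi fc f0 fp c1P c2P HF Hh).
- by move=> r t r1; exact: (F_shrink fo fi c1P HF t r1).
- by move=> t v; exact: (f_mul_bound fo fi f0 c1P HF t v).
- by move=> t; have /andP[_] := HF t; rewrite mulrC.
Qed.

Lemma critical_exponent_ge1 (R : realType) (n : nat) (s q : R) : 0 < s < 1 ->
  critical_exponent n.+1 s q -> 1 <= q.
Proof.
move=> /andP[s0 s1] [[Ns ->]|[]//].
have d0 : 0 < n.+1%:R - 2 * s.
  rewrite subr_gt0; case: Ns => [N2|[-> ?]]; last by lra.
  by apply: (@lt_le_trans _ _ 2%:R); [lra|rewrite ler_nat].
rewrite ler_pdivlMr// mul1r; have : 0 <= n.+1%:R :> R by []; lra.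
Qed.

Theorem proposition3p5 (R : realType) (n : nat) (Omega : set (euclid R n))
    (s : R) (a : 'I_n.+1 -> 'I_n.+1 -> euclid R n -> R)
    (lam : nat -> R) (phi : nat -> euclid R n -> R)
    (f : euclid R n -> R -> R) :
  let Ls := Lp Omega in
  let V0 := V_0 Omega f lam phi s in
  let AF := op_A_F Omega f lam phi s in
  let L2V := functional_of Omega in
  open Omega -> bounded_set Omega -> 0 < s < 1 ->
  elliptic_coefficients Omega a -> eigenbasis Omega a lam phi ->
  assumption_A Omega f ->
  (* the continuous embedding of H^s(Omega) into L^{2^*}(Omega) *)
  (forall q : R, critical_exponent n.+1 s q ->
    exists C : R, forall u, carrier (Hs Omega lam phi s) u ->
      carrier (Ls q%:E) u /\
      snorm (Ls q%:E) u <= C * snorm (Hs Omega lam phi s) u) ->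
  (* A_F is surjective *)
  (forall l, carrier (dual V0) l ->
    exists2 u, carrier V0 u & forall v, carrier V0 v -> AF u v = l v) ->
  (* A_F maps V_0 into its dual and is injective *)
  maps_into V0 (dual V0) AF /\
  (forall u1 u2, carrier V0 u1 -> carrier V0 u2 ->
    (forall v, carrier V0 v -> AF u1 v = AF u2 v) ->
    u1 = u2 %[ae (leb R n) in Omega]) /\
  (* hence invertible, with an inverse having the stated properties *)
  exists Ainv : ((euclid R n -> R) -> R) -> (euclid R n -> R),
    [/\ forall l, carrier (dual V0) l ->
          forall v, carrier V0 v -> AF (Ainv l) v = l v,
        forall u, carrier V0 u -> Ainv (AF u) = u %[ae (leb R n) in Omega],
        bounded_op (dual V0) V0 Ainv &
        growth_condition Omega f ->
          continuous_op (dual V0) V0 Ainv /\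
          forall (q : R) (r : \bar R), critical_exponent n.+1 s q ->
            (hoelder_conjugate q%:E < r)%E ->
            [/\ maps_into (Ls r) (dual V0) L2V,
                compact_op (Ls r) V0 (Ainv \o L2V) &
                forall p : R, 1 < p < q ->
                  compact_op (Ls r) (Ls p%:E) (Ainv \o L2V)]].
Proof.
move=> Ls V0 AF L2V oO bO s01 _ Eb Af Hemb Hsurj.
have mO : measurable Omega := measurable_open oO.
have fO : (leb R n Omega < +oo)%E := leb_bounded_set bO.
have cmu := @leb_complete R n.
have lam_gt0 k : 0 < lam k.
  elim: k => [|k IH]; first exact: eig_gt0 Eb.
  exact: (lt_le_trans IH (eig_nondecreasing Eb k)).
have Lphi k : sq_integrable (leb R n) Omega (phi k).
  by have [[[/(L2_carrierP (leb R n) mO (phi k)).1]]] := eig_LD Eb k.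
have phi_complete u (Lu : sq_integrable (leb R n) Omega u) :=
  eig_complete Eb ((L2_carrierP (leb R n) mO u).2 Lu).
have [s0 s1] := andP s01.
have [c1 c1P AF1] := A_F Af; have [c2 c2P AF2] := A_Fconj Af.
have fF : {ae leb R n, forall x, Omega x -> orlicz_pair c1 c2 (f x) (F_ f x)}.
  apply: filterS3 (A_fun Af) AF1 AF2 => x H1 H2 H3 Ox.
  have [h1 h2 h3 h4 h5] := H1 Ox.
  exact: (assumption_orlicz_pair c1P c2P h1 h2 h3 h4 h5 (H2 Ox) (H3 Ox)).
have F_even x t : F_ f x (- t) = F_ f x t by rewrite /F_ /primitive normrN.
have mf u : measurable_fun Omega u -> measurable_fun Omega (fun x => f x (u x)).
  apply: (measurable_superposition cmu mO (A_meas Af)).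
  by apply: filterS (A_fun Af) => x H Ox; have [] := H Ox.
have mF u : measurable_fun Omega u -> measurable_fun Omega (fun x => F_ f x (u x)).
  apply: (measurable_primitive_superposition cmu mO (A_meas Af)).
  apply: filterS (A_fun Af) => x H Ox; have [_ h2 h3 h4 _] := H Ox.
  by split => //; exact: ltW_homo.
have f_mono : {ae leb R n, forall x, Omega x ->
    forall xi eta, 0 <= (f x xi - f x eta) * (xi - eta)}.
  apply: filterS (A_fun Af) => x H Ox xi eta; have [_ h2 _ _ _] := H Ox.
  exact: f_monotone.
have gr : growth_condition Omega f -> exists2 c : R, 0 < c &
    {ae leb R n, forall x, Omega x -> forall xi eta,
      c * F_ f x (xi - eta) <= (f x xi - f x eta) * (xi - eta)}.
  move=> [c /andP[c0 _] Hc]; exists c => //.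
  apply: filterS3 (A_fun Af) fF Hc => x H1 H2 H3 Ox xi eta.
  have [h1 h2 h3 h4 h5] := H1 Ox.
  (* F(x,t) <= t f(x,t) turns the constant of the growth condition into one of strong monotonicity
     for the modular. *)
  apply: le_trans (f_monotone_growth h1 h2 h4 (H3 Ox xi eta)).
  by apply: ler_wpM2l; [exact: ltW|rewrite mulrC; exact: (orlicz_le (H2 Ox))].
have D := concrete_data mO cmu fO lam s Lphi (eig_orthonormal Eb)
  phi_complete c1P c2P fF F_even mf mF f_mono.
split; first exact: (sum_op_dual D).
split.
  move=> u1 u2.
  exact: (concrete_injective mO cmu fO lam_gt0 Lphi (eig_orthonormal Eb)
    phi_complete c1P c2P fF F_even mf mF f_mono).
exact: (concrete_inverse mO cmu fO lam_gt0 (eig_nondecreasing Eb) (eig_cvg Eb)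
  Lphi (eig_orthonormal Eb) phi_complete s0 c1P c2P fF F_even mf mF f_mono gr
  (fun q => @critical_exponent_ge1 R n s q s01) Hemb Hsurj).
Qed.
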